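(* Let $\ell\ge1$ and let $Y_{\ell,n}$ denote the number of $\ell$-protected nodes in a random binary search tree $\mathcal{T}_n$. Then, for the constants $\mu_{Y,\ell}=\mathbb{P}(\text{the root of }\mathcal{T}\text{ is }\ell\text{-protected})>0$ and some constants $\sigma_{Y,\ell}^2\ge0$, with at least $\sigma_{Y,2}^2>0$, as $n\to\infty$, $$\frac{\mathbb{E}(Y_{\ell,n})}{n}\to\mu_{Y,\ell},\qquad \frac{\mathrm{Var}(Y_{\ell,n})}{n}\to\sigma_{Y,\ell}^2,$$ and both $$\frac{Y_{\ell,n}-n\mu_{Y,\ell}}{\sqrt n}\xrightarrow{d}\mathcal{N}(0,\sigma_{Y,\ell}^2)\quad\text{and}\quad\frac{Y_{\ell,n}-\mathbb{E}(Y_{\ell,n})}{\sqrt n}\xrightarrow{d}\mathcal{N}(0,\sigma_{Y,\ell}^2).$$ Similarly, let $Z_{\ell,n}$ denote the number of $\ell$-protected nodes in a random recursive tree $\Lambda_n$. Then, for the constants $\mu_{Z,\ell}=\mathbb{P}(\text{the root of }\boldsymbol\Lambda\text{ is }\ell\text{-protected})>0$ and some constants $\sigma_{Z,\ell}^2\ge0$, with at least $\sigma_{Z,2}^2>0$, as $n\to\infty$, $$\frac{\mathbb{E}(Z_{\ell,n})}{n}\to\mu_{Z,\ell},\qquad \frac{\mathrm{Var}(Z_{\ell,n})}{n}\to\sigma_{Z,\ell}^2,$$ and both $$\frac{Z_{\ell,n}-\mathbb{E}(Z_{\ell,n})}{\sqrt n}\xrightarrow{d}\mathcal{N}(0,\sigma_{Z,\ell}^2)\quad\text{and}\quad\frac{Z_{\ell,n}-n\mu_{Z,\ell}}{\sqrt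 n}\xrightarrow{d}\mathcal{N}(0,\sigma_{Z,\ell}^2).$$
   Context: Random binary search tree $\mathcal{T}_n$: insert the keys of a uniformly random permutation of $\{1,\dots,n\}$ one by one; the first key is placed at the root, and each later key starts at the root and at each occupied node proceeds to the left child position if it is smaller than the key there and to the right child position if it is larger, until it reaches an empty position, where it is placed. Random recursive tree $\Lambda_n$: start with a root labelled $1$; for $i=2,\dots,n$, node $i$ is attached as a child of a uniformly random node among $1,\dots,i-1$ (independently of earlier choices). $\mathcal{T}$ denotes the random binary search tree $\mathcal{T}_N$ with random size $N$, $\mathbb{P}(N=k)=\frac{2}{(k+1)(k+2)}$, $k\ge1$; $\boldsymbol\Lambda$ denotes the random recursive tree $\Lambda_N$ with random size $N$, $\mathbb{P}(N=k)=\frac{1}{k(k+1)}$, $k\ge1$. A leaf is a node without children. A node is $\ell$-protected if the shortest distance from it to a descendant that is a leaf is at least $\ell$ (a leaf counts as its own descendant at distance $0$; thus e.g. a node is $2$-protected if and only if it is neither a leaf nor the parent of a leaf). $\mathcal{N}(0,0)$ is the point mass at $0$. *)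

(* Defs.v *)
From HB Require Import structures.
From mathcomp Require Import all_boot all_order all_algebra perm.
From mathcomp Require Import ring.
From mathcomp Require Import all_classical all_reals all_analysis.

Set Implicit Arguments.
Unset Strict Implicit.
Unset Printing Implicit Defensive.

Import Order.TTheory GRing.Theory Num.Theory.
Import numFieldNormedType.Exports.

Local Open Scope classical_set_scope.
Local Open Scope ring_scope.

(* The law of [X i] for [i] uniform on [I]; the otherwise unused argument [hI]
   ensures that it is a probability. *)
Definition uniform_image d (T : measurableType d) (R : realType)
    (I : finType) (hI : (0 < #|I|)%N) (X : I -> T) : set T -> \bar R :=
  fun A => (#|[pred i | X i \in A]|%:R / #|I|%:R)%:E.

Section uniform_image_probability.
Context d (T : measurableType d) (R : realType).
Context (I : finType) (hI : (0 < #|I|)%N) (X : I -> T).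

Let uniform_imageE : uniform_image R hI X =
  mscale (#|I|%:R^-1)%:nng
    (msum (fun k => dirac (X (nth (enum_val (Ordinal hI)) (enum I) k))) #|I|).
Proof.
apply/funext => A; rewrite /uniform_image /mscale/= /msum.
have -> : (\sum_(k < #|I|)
    \d_(X (nth (enum_val (Ordinal hI)) (enum I) k)) A)%E =
    (\sum_(i in I) ((X i \in A) : nat)%:R%:E :> \bar R)%E.
  rewrite [RHS]big_enum_val/=; apply: eq_bigr => k _.
  by rewrite diracE -enum_val_nth.
rewrite sumEFin -EFinM mulrC -natr_sum; congr (_ * _%:R)%:E.
rewrite -sum1_card big_mkcond/=; apply: eq_bigr => i _.
by rewrite inE; case: (X i \in A).
Qed.

Let uniform_image0 : uniform_image R hI X set0 = 0%E.
Proof. by rewrite uniform_imageE measure0. Qed.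

Let uniform_image_ge0 A : (0 <= uniform_image R hI X A)%E.
Proof. by rewrite uniform_imageE measure_ge0. Qed.

Let uniform_image_sigma_additive : semi_sigma_additive (uniform_image R hI X).
Proof. by rewrite uniform_imageE; exact: measure_semi_sigma_additive. Qed.

HB.instance Definition _ := isMeasure.Build _ _ _ (uniform_image R hI X)
  uniform_image0 uniform_image_ge0 uniform_image_sigma_additive.

Let uniform_image_setT : uniform_image R hI X setT = 1%E.
Proof.
rewrite /uniform_image (_ : #|_| = #|I|); last first.
  by apply: eq_card => i; rewrite !inE in_setT.
by rewrite divff// pnatr_eq0 -lt0n.
Qed.

HB.instance Definition _ := Measure_isProbability.Build _ _ _
  (uniform_image R hI X) uniform_image_setT.

End uniform_image_probability.

(* The law of [X_N], where [N >= 1] has probability mass function [w] and is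
   independent of the [X_k], and [X_k] has law [P k]; the argument [w1]
   ensures that it is a probability. *)
Definition random_index d (T : measurableType d) (R : realType)
    (w : nat -> {nonneg R}) (w1 : (\sum_(1 <= k <oo) (w k)%:num%:E = 1)%E)
    (P : nat -> probability T R) : set T -> \bar R :=
  mseries (fun k => mscale (w k) (P k)) 1.

Section random_index_probability.
Context d (T : measurableType d) (R : realType) (w : nat -> {nonneg R}).
Context (w1 : (\sum_(1 <= k <oo) (w k)%:num%:E = 1)%E).
Context (P : nat -> probability T R).

HB.instance Definition _ := Measure.on (random_index w1 P).

Let random_index_setT : random_index w1 P setT = 1%E.
Proof.
rewrite /random_index /mseries -[RHS]w1; apply: eq_eseriesr => k _.
by rewrite -[RHS]mule1 -(probability_setT (P k)).
Qed.

HB.instance Definition _ := Measure_isProbability.Build _ _ _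
  (random_index w1 P) random_index_setT.

End random_index_probability.

Definition bst_size_pmf (R : realType) (k : nat) : {nonneg R} :=
  (2 / (k.+1%:R * k.+2%:R))%:nng.

(* The value at [k = 0] is never used. *)
Definition rrt_size_pmf (R : realType) (k : nat) : {nonneg R} :=
  (1 / (k%:R * k.+1%:R))%:nng.

Lemma sum_telescope_inv (R : realType) (c : R) (a : nat) (w : nat -> R) :
  (forall k, (1 <= k)%N -> w k = c / (k + a)%:R - c / (k.+1 + a)%:R) ->
  (\sum_(1 <= k <oo) (w k)%:E = (c / a.+1%:R)%:E)%E.
Proof.
move=> wE.
have sE n : \sum_(1 <= k < n.+1) w k = c / a.+1%:R - c / (n.+1 + a)%:R.
  elim: n => [|n IH]; first by rewrite big_nil add1n subrr.
  by rewrite big_nat_recr//= IH wE// addrA subrK.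
apply/cvg_lim => //; rewrite -(cvg_shiftS _ _).
rewrite (_ : (fun _ => _) =
    EFin \o (fun n => c / a.+1%:R - c / (n.+1 + a)%:R)); last first.
  by apply/funext => n /=; rewrite sumEFin sE.
apply: cvg_EFin; first exact: nearW.
rewrite -[X in _ --> X]subr0; apply: cvgB; first exact: cvg_cst.
rewrite -[X in _ --> X](mulr0 c); apply: cvgM; first exact: cvg_cst.
rewrite (_ : (fun _ => _) = [sequence harmonic (n + a)%N]_n).
  by rewrite cvg_shiftn; exact: cvg_harmonic.
by apply/funext => n /=; rewrite addSn.
Qed.

Lemma sum_bst_size_pmf (R : realType) :
  (\sum_(1 <= k <oo) (bst_size_pmf R k)%:num%:E = 1)%E.
Proof.
rewrite (@sum_telescope_inv _ 2 1) ?divff// => k _ /=.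
by rewrite !addn1; field; rewrite -natrD nat1r !pnatr_eq0.
Qed.

Lemma sum_rrt_size_pmf (R : realType) :
  (\sum_(1 <= k <oo) (rrt_size_pmf R k)%:num%:E = 1)%E.
Proof.
rewrite (@sum_telescope_inv _ 1 0) ?divff// => -[//|k] _ /=.
by rewrite !addn0; field; rewrite -natrD nat1r !pnatr_eq0.
Qed.

Inductive btree := BEmpty | BNode of btree & nat & btree.

HB.instance Definition _ := gen_eqMixin btree.
HB.instance Definition _ := gen_choiceMixin btree.
HB.instance Definition _ := isPointed.Build btree BEmpty.
HB.instance Definition _ := @isMeasurable.Build default_measure_display
  btree discrete_measurable discrete_measurable0
  discrete_measurableC discrete_measurableU.

Fixpoint binsert (k : nat) (t : btree) : btree :=
  match t with
  | BEmpty => BNode BEmpty k BEmpty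
  | BNode l x r =>
      if (k < x)%N then BNode (binsert k l) x r else BNode l x (binsert k r)
  end.

Definition bst_of_perm n (s : 'S_n) : btree :=
  foldl (fun t k => binsert k t) BEmpty [seq (val (s i)).+1 | i <- enum 'I_n].

Lemma card_perm_gt0 n : (0 < #|{: 'S_n}|)%N.
Proof. by apply/card_gt0P; exists (perm_one 'I_n). Qed.

Definition bst_law (R : realType) (n : nat) : probability btree R :=
  uniform_image R (card_perm_gt0 n) (@bst_of_perm n).

Definition bst_random_law (R : realType) : probability btree R :=
  random_index (sum_bst_size_pmf R) (bst_law R).

(* The distances from the root to the leaves below it. *)
Fixpoint bleaf_dists (t : btree) : seq nat :=
  match t with
  | BEmpty => [::]
  | BNode BEmpty _ BEmpty => [:: 0%N]
  | BNode l _ r => [seq d.+1 | d <- bleaf_dists l ++ bleaf_dists r]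
  end.

(* Meaningful for nonempty [t] only. *)
Definition broot_protected (l : nat) (t : btree) : bool :=
  all (leq l) (bleaf_dists t).

(* The subtrees consisting of a node and its descendants, one for each node. *)
Fixpoint bfringe (t : btree) : seq btree :=
  match t with
  | BEmpty => [::]
  | BNode l _ r => t :: bfringe l ++ bfringe r
  end.

Definition bprotected_count (l : nat) (t : btree) : nat :=
  count (broot_protected l) (bfringe t).

Inductive rtree := RNode of nat & seq rtree.

HB.instance Definition _ := gen_eqMixin rtree.
HB.instance Definition _ := gen_choiceMixin rtree.
HB.instance Definition _ := isPointed.Build rtree (RNode 1 [::]).
HB.instance Definition _ := @isMeasurable.Build default_measure_display
  rtree discrete_measurable discrete_measurable0
  discrete_measurableC discrete_measurableU.

(* Adds a child labelled [j] to the node labelled [i]. *)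
Fixpoint rattach (i j : nat) (t : rtree) : rtree :=
  let: RNode x ts := t in
  let ts' := map (rattach i j) ts in
  RNode x (if x == i then rcons ts' (RNode j [::]) else ts').

(* The parent of node [i + 2] is [(p i).+1], a node in [{1, ..., i + 1}];
   choosing [p] uniformly makes these parents independent and uniform. *)
Definition rrt_choices n := {dffun forall i : 'I_n.-1, 'I_i.+1}.

Definition rrt_of_choices n (p : rrt_choices n) : rtree :=
  foldl (fun t i => rattach (val (p i)).+1 (val i).+2 t) (RNode 1 [::])
    (enum 'I_n.-1).

Lemma card_rrt_choices_gt0 n : (0 < #|{: rrt_choices n}|)%N.
Proof.
by apply/card_gt0P; exists [ffun i : 'I_n.-1 => ord0 : 'I_i.+1].
Qed.

(* This is the one-node tree also for [n = 0]. *)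
Definition rrt_law (R : realType) (n : nat) : probability rtree R :=
  uniform_image R (card_rrt_choices_gt0 n) (@rrt_of_choices n).

Definition rrt_random_law (R : realType) : probability rtree R :=
  random_index (sum_rrt_size_pmf R) (rrt_law R).

Fixpoint rleaf_dists (t : rtree) : seq nat :=
  let: RNode _ ts := t in
  if ts is [::] then [:: 0%N]
  else [seq d.+1 | d <- flatten (map rleaf_dists ts)].

Definition rroot_protected (l : nat) (t : rtree) : bool :=
  all (leq l) (rleaf_dists t).

Fixpoint rfringe (t : rtree) : seq rtree :=
  let: RNode _ ts := t in t :: flatten (map rfringe ts).

Definition rprotected_count (l : nat) (t : rtree) : nat :=
  count (rroot_protected l) (rfringe t).

(* Parametrised by the variance [v >= 0], whereas [normal_prob] takes the
   standard deviation and is not a point mass when that is 0. *)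
Definition centered_normal (R : realType) (v : R) :
    probability (measurableTypeR R) R :=
  if v == 0 then dirac (0 : measurableTypeR R) : probability _ _
  else normal_prob 0 (Num.sqrt v) : probability _ _.

Definition cvg_in_distribution d (T : measurableType d) (R : realType)
    (P : nat -> probability T R) (X : nat -> T -> R)
    (mu : probability (measurableTypeR R) R) :=
  forall f : R -> R, continuous f -> bounded_fun f ->
    ('E_(P n)[f \o X n] @[n --> \oo] --> \int[mu]_x (f x)%:E)%E.

(* Main.v *)
Require Import Defs.
From HB Require Import structures.
From mathcomp Require Import all_boot all_order all_algebra perm.
From mathcomp Require Import ring lra zify.
From mathcomp Require Import all_classical all_reals all_analysis.
From mathcomp Require Import measurable_realfun.

(** Both trees are coded by binary shapes. The shape of a search tree is the
    tree without its keys; a recursive tree is coded by making its first child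
    the left subtree and its other children the right subtree. Either way, a
    new node fills a uniformly random external position of the shape
    ([shape_bst_lift_perm], [shape_rattach]). Hence one operator, the mean
    [avg n] over the [n!] ways to grow a shape with [n] forks, computes the
    expectations for the search tree with [n] nodes ([expectation_bst]) and for
    the recursive tree with [n + 1] nodes ([expectation_rrt]). Under it, the
    left subtree has a uniform size in [{0, ..., n - 1}] and, given the sizes,
    the two subtrees are independent random shapes of the same kind ([avgS]).
    The number of protected nodes is a sum [total f] over the fringe subtrees
    of the shape of a toll [f] with [|f| <= 1]; for recursive trees, the toll is
    the change in the protection of the root that comes with its first child.
    The limits hold for every bounded toll.

    Mean. A sequence with
    [a (n+1) = r (n+1) + 2/(n+1) (a 0 + ... + a n)]
    is a weighted sum of the [r k] with weights [2/((k+1)(k+2))] ([rec_eq]), so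
    that bounded [r] give [(n+1) mu + O(1)] ([avg_total_cvg]). These weights
    are the distribution of the size of the search tree with random size, which
    makes [mu] the probability of a protected root; for recursive trees this
    follows by a summation by parts ([rrt_mean]).

    Variance. The centered functional of a shape is the sum of those of its
    subtrees and of a bounded [innovation] with mean zero. In the recursion for
    the variance the only delicate term is the covariance of the innovation
    with the sum over the subtrees, which is [O(sqrt n)] as soon as the variance
    is linear; as the recursion is then solved by a convergent series, this
    bound reproduces itself ([var_linear]), and the variance is
    [(n+1) s2 + O(sqrt n)] ([var_cvg]).

    Limit law. For a smooth [g], let [d n] be the largest distance over all
    shifts [x] between the mean of [g (x + W)], where [W] is the centered
    functional, and the mean of [g] under the normal law with mean [x] and
    variance [(n+1) s2]. Both means split along the two subtrees, the first
    up to the innovation, and the second exactly because variances of normal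
    laws add up. So [d] obeys the same recursion, with a toll of order
    [a^2 sqrt n] when [g] varies at scale [1/a]: the innovation has mean zero
    and thus acts to second order only ([lindeberg_step]). For [n <= K], Taylor
    expansion and the agreement of the first two moments bound [d n] by
    [O(a^2 sqrt n) + O(a^3)] with a constant in the last term that depends on
    [K] ([lindeberg_base]). Altogether [d n] is at most
    [n a^2 O(1/sqrt K) + n a^3 O_K(1)] up to smaller terms ([lindeberg_bound]);
    with [a = 1/sqrt n], let [n] and then [K] tend to infinity ([clt_taylor]).
    Bounded continuous functions are approximated by smooth ones up to
    [e (1 + x^2)], which suffices as second moments are bounded
    ([taylor_approx], [clt_bounded]).

    Positive variance. Take two shapes of the same size that look the same from
    above but have different totals. The normalized difference of the numbers
    of their occurrences as fringe subtrees is uncorrelated with everything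
    above them; its variance and its covariance with the functional are linear
    with explicit constants, the latter nonzero. Cauchy-Schwarz bounds the
    variance of the functional below ([variance_linear_lower]). *)

Set Implicit Arguments.
Unset Strict Implicit.
Unset Printing Implicit Defensive.
Import Order.TTheory GRing.Theory Num.Theory.
Import numFieldNormedType.Exports.
Local Open Scope classical_set_scope.
Local Open Scope ring_scope.

(** * Random binary shapes *)

Inductive bshape := Tip | Fork of bshape & bshape.

HB.instance Definition _ := gen_eqMixin bshape.

Fixpoint nforks (t : bshape) : nat :=
  if t is Fork a b then (nforks a + nforks b).+1 else 0.

(** The shapes obtained by filling one external position, in the order of these
    positions from left to right. *)
Fixpoint grow (t : bshape) : seq bshape :=
  if t is Fork a b then
    [seq Fork a' b | a' <- grow a] ++ [seq Fork a b' | b' <- grow b]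
  else [:: Fork Tip Tip].

(** A shape is listed once for each order in which its forks can appear, so equal
    weights on this list are the law of the shape after [n] uniform growth steps. *)
Fixpoint grown (n : nat) : seq bshape :=
  if n is m.+1 then flatten [seq grow t | t <- grown m] else [:: Tip].

Lemma size_grow t : size (grow t) = (nforks t).+1.
Proof.
by elim: t => //= a IHa b IHb; rewrite size_cat !size_map IHa IHb addSn addnS.
Qed.

Lemma nforks_grow t t' : t' \in grow t -> nforks t' = (nforks t).+1.
Proof.
elim: t t' => [|a IHa b IHb] t' /=; first by rewrite inE => /eqP ->.
rewrite mem_cat => /orP[] /mapP[s hs ->] /=; first by rewrite (IHa _ hs).
by rewrite (IHb _ hs) addnS.
Qed.

Lemma nforks_grown n t : t \in grown n -> nforks t = n.
Proof.
elim: n t => [|n IH] t /=; first by rewrite inE => /eqP ->.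
by case/flatten_mapP => s /IH <- /nforks_grow.
Qed.

Lemma size_grown n : size (grown n) = n`!.
Proof.
elim: n => //= n IH.
rewrite size_flatten /seq.shape -map_comp sumnE big_map.
rewrite big_seq (eq_bigr (fun=> n.+1)) => [|t /nforks_grown <-]; last first.
  by rewrite /= size_grow.
by rewrite -big_seq big_const_seq count_predT iter_addn_0 IH factS.
Qed.

HB.lock Definition avg {R : realType} (n : nat) (g : bshape -> R) : R :=
  (n`!%:R)^-1 * \sum_(t <- grown n) g t.

Arguments avg {R} n g.

Section avg.
Context {R : realType}.
Implicit Types (g h : bshape -> R) (c : R).

Lemma eq_avg n g h : (forall t, nforks t = n -> g t = h t) -> avg n g = avg n h.
Proof.
by move=> gh; rewrite avg.unlock; congr (_ * _); apply: eq_big_seq => t /nforks_grown /gh.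
Qed.

Lemma avgD n g h : avg n (fun t => g t + h t) = avg n g + avg n h.
Proof. by rewrite avg.unlock big_split/= mulrDr. Qed.

Lemma avgZ n c g : avg n (fun t => c * g t) = c * avg n g.
Proof. by rewrite avg.unlock -mulr_sumr mulrCA. Qed.

Lemma avgZr n c g : avg n (fun t => g t * c) = avg n g * c.
Proof. by rewrite avg.unlock -mulr_suml mulrA. Qed.

Lemma avgN n g : avg n (fun t => - g t) = - avg n g.
Proof. by rewrite avg.unlock sumrN mulrN. Qed.

Lemma avgB n g h : avg n (fun t => g t - h t) = avg n g - avg n h.
Proof. by rewrite avgD avgN. Qed.

Lemma avg_sum (I : Type) (r : seq I) n (G : I -> bshape -> R) :
  avg n (fun t => \sum_(i <- r) G i t) = \sum_(i <- r) avg n (G i).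
Proof. by rewrite avg.unlock exchange_big mulr_sumr. Qed.

Lemma avg_cst n c : avg n (fun=> c) = c.
Proof.
rewrite avg.unlock big_const_seq count_predT size_grown iter_addr_0 -[c *+ _]mulr_natr.
by rewrite mulrCA mulVf ?mulr1// pnatr_eq0 -lt0n fact_gt0.
Qed.

Lemma avg_le n g h : (forall t, nforks t = n -> g t <= h t) -> avg n g <= avg n h.
Proof.
move=> gh; rewrite avg.unlock ler_wpM2l ?invr_ge0//.
by rewrite big_seq [leRHS]big_seq; apply: ler_sum => t /nforks_grown /gh.
Qed.

Lemma avg_ge0 n g : (forall t, nforks t = n -> 0 <= g t) -> 0 <= avg n g.
Proof. by move=> g0; rewrite -(avg_cst n 0); exact: avg_le. Qed.

Lemma ler_norm_avg n g : `|avg n g| <= avg n (fun t => `|g t|).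
Proof.
rewrite ler_norml -avgN; apply/andP; split; apply: avg_le => t _.
  by rewrite lerNl -normrN ler_norm.
exact: ler_norm.
Qed.

Lemma avg0 g : avg 0 g = g Tip.
Proof. by rewrite avg.unlock/= big_seq1 fact0 invr1 mul1r. Qed.

Lemma sum_grown_flatten n g :
  \sum_(t <- grown n.+1) g t = \sum_(t <- grown n) \sum_(u <- grow t) g u.
Proof. by rewrite /= big_flatten/= big_map. Qed.

Lemma avg_grow n g :
  avg n.+1 g = n.+1%:R^-1 * avg n (fun t => \sum_(u <- grow t) g u).
Proof. by rewrite avg.unlock sum_grown_flatten mulrA -invfM -natrM -factS. Qed.

(** The left subtree grows like a Polya urn: with [k] forks on the left and
    [n - k] on the right there are [k + 1] and [n - k + 1] positions to fill, and
    these weights keep the uniform law on the size of the left subtree. *)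
Lemma avgS n g : avg n.+1 g = n.+1%:R^-1 *
  \sum_(k < n.+1) avg k (fun a => avg (n - k) (fun b => g (Fork a b))).
Proof.
elim: n g => [|n IH] g.
  by rewrite avg_grow big_ord1 !avg0 /= big_seq1.
rewrite avg_grow IH; congr (_ * _).
pose q j := avg j (fun a => avg (n.+1 - j) (fun b => g (Fork a b))).
have qE (k : 'I_n.+1) :
    avg k (fun a => avg (n - k) (fun b => \sum_(u <- grow (Fork a b)) g u)) =
    k.+1%:R * q k.+1 + (n.+1 - k)%:R * q k.
  have kn : (k <= n)%N by rewrite -ltnS.
  transitivity (avg k (fun a => \sum_(u <- grow a) avg (n - k) (fun b => g (Fork u b)))
      + avg k (fun a => (n.+1 - k)%:R * avg (n.+1 - k) (fun b => g (Fork a b)))).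
    rewrite -avgD; apply: eq_avg => a _; rewrite (subSn kn) avg_grow mulrA divff ?pnatr_eq0// mul1r.
    by rewrite -avg_sum -avgD; apply: eq_avg => b _; rewrite /= big_cat/= !big_map.
  rewrite avgZ; congr (_ + _).
  by rewrite /q subSS avg_grow mulrA divff ?pnatr_eq0// mul1r.
(* The two ways to reach the size [i] on the left have the weights [i] and
   [n + 1 - i], with the sum [n + 1] for every [i]. *)
rewrite (eq_bigr _ (fun k _ => qE k)) big_split/=.
have -> : \sum_(i < n.+1) i.+1%:R * q i.+1 = \sum_(i < n.+2) i%:R * q i.
  by rewrite [RHS]big_ord_recl/= mul0r add0r.
have -> : \sum_(i < n.+1) (n.+1 - i)%:R * q i = \sum_(i < n.+2) (n.+1 - i)%:R * q i.
  by rewrite [RHS]big_ord_recr/= subnn mul0r addr0.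
rewrite -big_split/= (eq_bigr (fun i : 'I_n.+2 => n.+1%:R * q i)).
  by rewrite -mulr_sumr mulrA mulVf ?mul1r// pnatr_eq0.
by move=> i _; rewrite -mulrDl -natrD subnKC// -ltnS.
Qed.

End avg.

(** * Shapes of binary search trees *)

Fixpoint shape_of_btree (t : btree) : bshape :=
  if t is BNode l _ r then Fork (shape_of_btree l) (shape_of_btree r) else Tip.

Fixpoint inorder (t : btree) : seq nat :=
  if t is BNode l x r then inorder l ++ x :: inorder r else [::].

(** Relabelling by an increasing map makes room for a new key among
    [{1, ..., n}] without affecting the shape. *)
Fixpoint relabel (phi : nat -> nat) (t : btree) : btree :=
  if t is BNode l x r then BNode (relabel phi l) (phi x) (relabel phi r)
  else BEmpty.

Definition bst_of_seq (ks : seq nat) : btree :=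
  foldl (fun t k => binsert k t) BEmpty ks.

Lemma size_inorder t : size (inorder t) = nforks (shape_of_btree t).
Proof. by elim: t => //= l IHl x r IHr; rewrite size_cat/= IHl IHr addnS. Qed.

Lemma inorder_binsert k t : perm_eq (inorder (binsert k t)) (k :: inorder t).
Proof.
elim: t => //= l IHl x r IHr; case: ifP => _ /=.
  by rewrite -cat_cons perm_cat2r.
have /seq.permP hr := IHr; apply/seq.permP => p.
by rewrite /= !count_cat /= hr /=; lia.
Qed.

Lemma inorder_bst ks : perm_eq (inorder (bst_of_seq ks)) ks.
Proof.
elim/last_ind: ks => // ks k IH.
rewrite /bst_of_seq foldl_rcons -/(bst_of_seq ks).
rewrite (perm_trans (inorder_binsert _ _))//.
by rewrite perm_sym perm_rcons perm_cons perm_sym.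
Qed.

Lemma sorted_cat_cons (s1 s2 : seq nat) x : sorted ltn (s1 ++ x :: s2) =
  [&& sorted ltn s1, sorted ltn s2, all (gtn x) s1 & all (ltn x) s2].
Proof.
have tr : transitive ltn by move=> ? ? ?; exact: ltn_trans.
rewrite !sorted_pairwise// pairwise_cat pairwise_cons/= allrel_consr.
apply/idP/idP => [/and4P[/andP[a b] c d e]|/and4P[a b c d]].
  by rewrite c d e a.
rewrite a b c d !andbT; apply/andP; split; first by [].
by apply/allrelP => u v /(allP c) /= h1 /(allP d) h2; apply: ltn_trans h1 h2.
Qed.

Lemma sorted_binsert k t : k \notin inorder t -> sorted ltn (inorder t) ->
  sorted ltn (inorder (binsert k t)).
Proof.
elim: t => //= l IHl x r IHr.
rewrite mem_cat inE !negb_or => /and3P[kl kx kr].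
rewrite sorted_cat_cons => /and4P[sl sr al ar].
case: ifP => kltx /=; rewrite sorted_cat_cons.
  by rewrite IHl// sr ar (perm_all _ (inorder_binsert _ _))/= kltx al.
rewrite IHr// sl al (perm_all _ (inorder_binsert _ _))/= ar !andbT.
by rewrite ltn_neqAle eq_sym kx leqNgt kltx.
Qed.

Lemma sorted_bst ks : uniq ks -> sorted ltn (inorder (bst_of_seq ks)).
Proof.
elim/last_ind: ks => // ks k IH; rewrite rcons_uniq => /andP[kks uks].
rewrite /bst_of_seq foldl_rcons -/(bst_of_seq ks) sorted_binsert ?IH//.
by rewrite (perm_mem (inorder_bst _)).
Qed.

(** Inserting a new key fills the external position whose rank is the number
    of smaller keys. *)
Lemma shape_binsert k t : k \notin inorder t -> sorted ltn (inorder t) ->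
  shape_of_btree (binsert k t) =
  nth Tip (grow (shape_of_btree t)) (count (gtn k) (inorder t)).
Proof.
elim: t => //= l IHl x r IHr.
rewrite mem_cat inE !negb_or => /and3P[kl kx kr].
rewrite sorted_cat_cons => /and4P[sl sr al ar].
have cl : (count (gtn k) (inorder l) < size (grow (shape_of_btree l)))%N.
  by rewrite size_grow ltnS -size_inorder count_size.
rewrite count_cat/= nth_cat size_map.
have [kltx|xlek] := ltnP k x.
  have -> : count (gtn k) (inorder r) = 0%N.
    apply/eqP; rewrite -leqn0 leqNgt -has_count; apply/hasPn => y /(allP ar)/= xy.
    by rewrite -leqNgt (leq_trans (ltnW kltx))// ltnW.
  by rewrite (ltnNge x) (ltnW kltx)/= !addn0 cl (nth_map Tip)// IHl.
have xltk : (x < k)%N by rewrite ltn_neqAle eq_sym kx.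
have -> : count (gtn k) (inorder l) = nforks (shape_of_btree l).
  rewrite -size_inorder; apply/eqP; rewrite -all_count; apply/allP => y /(allP al)/= yx.
  exact: ltn_trans xltk.
rewrite xltk size_grow addnA addn1 ltnNge leq_addr/= addKn (nth_map Tip) ?IHr//.
by rewrite size_grow ltnS -size_inorder count_size.
Qed.

Section relabel.
Variable phi : nat -> nat.
Hypothesis phi_mono : {mono phi : x y / (x < y)%N}.

Lemma shape_relabel t : shape_of_btree (relabel phi t) = shape_of_btree t.
Proof. by elim: t => //= l -> x r ->. Qed.

Lemma inorder_relabel t : inorder (relabel phi t) = map phi (inorder t).
Proof. by elim: t => //= l -> x r ->; rewrite map_cat. Qed.

Lemma binsert_relabel k t :
  binsert (phi k) (relabel phi t) = relabel phi (binsert k t).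
Proof. by elim: t => //= l IHl x r IHr; rewrite phi_mono; case: ifP => _ /=; rewrite ?IHl ?IHr. Qed.

Lemma bst_relabel ks : bst_of_seq (map phi ks) = relabel phi (bst_of_seq ks).
Proof.
elim/last_ind: ks => // ks k IH.
by rewrite map_rcons /bst_of_seq !foldl_rcons -/(bst_of_seq _) IH binsert_relabel.
Qed.

End relabel.

Lemma perm_keys n (s : 'S_n) :
  perm_eq [seq (val (s i)).+1 | i <- enum 'I_n] (iota 1 n).
Proof.
have -> : iota 1 n = [seq (val i).+1 | i <- enum 'I_n].
  by rewrite -[1%N]addn0 iotaDl -val_enum_ord -map_comp.
rewrite (map_comp (fun i : 'I_n => (val i).+1) s); apply: perm_map.
apply: uniq_perm; rewrite ?(map_inj_uniq (@perm_inj _ s)) ?enum_uniq//.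
move=> i; rewrite mem_enum [RHS]inE; apply/mapP; exists (s^-1%g i); rewrite ?mem_enum//.
by rewrite permKV.
Qed.

Lemma bump_mono h : {mono bump h : x y / (x < y)%N}.
Proof. by move=> x y; rewrite !ltnNge leq_bump2. Qed.

Lemma count_gtn_iota i n : (i <= n)%N -> count (gtn i.+1) (iota 1 n) = i.
Proof.
move=> le_in; rewrite -(subnKC le_in) iotaD count_cat.
rewrite (eq_in_count (a2 := predT)) => [|x]; last by rewrite mem_iota /=; lia.
rewrite [X in (_ + X)%N](eq_in_count (a2 := pred0)) => [|x]; last first.
  by rewrite mem_iota /=; lia.
by rewrite count_predT count_pred0 size_iota addn0.
Qed.

(** A permutation of [n + 1] keys is a choice of the last key [i + 1] and the
    relative order [s] of the others. When the last key comes, [i] of the keys in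
    the tree are smaller, so it fills the external position with index [i]. *)
Lemma shape_bst_lift_perm n (i : 'I_n.+1) (s : 'S_n) :
  shape_of_btree (bst_of_perm (lift_perm ord_max i s)) =
  nth Tip (grow (shape_of_btree (bst_of_perm s))) i.
Proof.
have keysE : [seq (val (lift_perm ord_max i s j)).+1 | j <- enum 'I_n.+1] =
    rcons (map (bump i.+1) [seq (val (s j)).+1 | j <- enum 'I_n]) i.+1.
  rewrite enum_ordSr map_rcons lift_perm_id -!map_comp; congr rcons.
  apply: eq_map => j /=.
  have -> : widen_ord (leqnSn n) j = lift ord_max j.
    by apply: val_inj; rewrite /= /bump leqNgt ltn_ord.
  by rewrite lift_perm_lift /= /bump ltnS addnS.
set ks := [seq (val (s j)).+1 | j <- enum 'I_n] in keysE *.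
have uks : uniq ks by rewrite (perm_uniq (perm_keys s)) iota_uniq.
have -> : bst_of_perm (lift_perm ord_max i s) =
    binsert i.+1 (relabel (bump i.+1) (bst_of_perm s)).
  rewrite /bst_of_perm keysE foldl_rcons -/(bst_of_seq _) bst_relabel//.
  exact: bump_mono.
have bst_inorder : perm_eq (inorder (bst_of_perm s)) (iota 1 n).
  by rewrite (perm_trans (inorder_bst _))// perm_keys.
rewrite shape_binsert ?shape_relabel ?inorder_relabel//; first last.
- rewrite sorted_map (eq_sorted (e' := ltn)); first exact: sorted_bst.
  by move=> x y; exact: bump_mono.
- by apply/mapP => -[x _ /eqP]; rewrite (negbTE (neq_bump _ _)).
congr nth; rewrite count_map (seq.permP bst_inorder).
rewrite (eq_count (a2 := gtn i.+1)); last first.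
  by move=> x; rewrite /= /bump; case: leqP => h; lia.
by rewrite count_gtn_iota// -ltnS.
Qed.

Lemma lift_perm_max_bij n :
  bijective (fun p : 'S_n * 'I_n.+1 => lift_perm ord_max p.2 p.1).
Proof.
apply: inj_card_bij => [[s i] [t j] /= /permP st|].
  have ij : i = j by have := st ord_max; rewrite !lift_perm_id.
  subst j; congr (_, _); apply/permP => k.
  by have := st (lift ord_max k); rewrite !lift_perm_lift => /lift_inj.
by rewrite card_prod !card_Sn card_ord factS mulnC.
Qed.

(** Counting histories: permutations of [n + 1] keys are pairs of a permutation of
    [n] keys and an external position of the resulting tree. *)
Lemma sum_bst (R : nmodType) n (g : bshape -> R) :
  \sum_(s : 'S_n) g (shape_of_btree (bst_of_perm s)) = \sum_(t <- grown n) g t.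
Proof.
elim: n g => [|n IH] g.
  rewrite /= big_seq1 (eq_bigr (fun=> g Tip)); first by rewrite sumr_const card_Sn.
  by move=> s _; rewrite /bst_of_perm enum_ord0.
rewrite (reindex _ (onW_bij _ (lift_perm_max_bij n)))/=.
rewrite -(pair_bigA _ (fun s i => g (shape_of_btree (bst_of_perm (lift_perm ord_max i s)))))/=.
rewrite big_flatten/= big_map -(IH (fun t => \sum_(u <- grow t) g u)).
apply: eq_bigr => s _.
rewrite (big_nth Tip) size_grow.
have -> : nforks (shape_of_btree (bst_of_perm s)) = n.
  by rewrite -size_inorder (perm_size (inorder_bst _)) size_map size_enum_ord.
by rewrite big_mkord; apply: eq_bigr => i _; rewrite shape_bst_lift_perm.
Qed.

(** * Shapes of recursive trees *)

(** The left subtree codes the first child, the right subtree the root with its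
    other children; the label of the root is dropped, hence one fork less than
    nodes. *)
Fixpoint shape_of_rtree (t : rtree) : bshape :=
  let: RNode _ ts := t in foldr (fun c b => Fork (shape_of_rtree c) b) Tip ts.

(** The labels in the order of the external positions that code their nodes; see
    [shape_rattach]. *)
Fixpoint rlabels (t : rtree) : seq nat :=
  let: RNode x ts := t in rcons (flatten (map rlabels ts)) x.

(** Induction along the coding by shapes: a tree is its first child and the tree
    without its first child. *)
Lemma rtree_ind_first (P : rtree -> Prop) :
  (forall x, P (RNode x [::])) ->
  (forall x c cs, P c -> P (RNode x cs) -> P (RNode x (c :: cs))) ->
  forall t, P t.
Proof.
move=> P0 PS t; have [n] := ubnP (nforks (shape_of_rtree t)).
elim: n t => // n IH [x [|c cs]] /= ltn; first exact: P0.
by apply: PS; apply: IH => /=; lia.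
Qed.

Lemma shape_rattach_cons i j x c cs :
  shape_of_rtree (rattach i j (RNode x (c :: cs))) =
  Fork (shape_of_rtree (rattach i j c))
       (shape_of_rtree (rattach i j (RNode x cs))).
Proof. by rewrite /=; case: ifP. Qed.

Lemma rlabels_cons x c cs :
  rlabels (RNode x (c :: cs)) = rlabels c ++ rlabels (RNode x cs).
Proof. by rewrite /= rcons_cat. Qed.

Lemma rlabels_rattach_cons i j x c cs :
  rlabels (rattach i j (RNode x (c :: cs))) =
  rlabels (rattach i j c) ++ rlabels (rattach i j (RNode x cs)).
Proof. by rewrite /= ; case: ifP => _ /=; rewrite rcons_cat. Qed.

Lemma rattach_notin i j t : i \notin rlabels t ->
  shape_of_rtree (rattach i j t) = shape_of_rtree t /\
  rlabels (rattach i j t) = rlabels t.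
Proof.
elim/rtree_ind_first: t => [x|x c cs IHc IHt].
  by rewrite inE eq_sym /= => /negbTE ->.
rewrite rlabels_cons mem_cat negb_or => /andP[/IHc[sc lc] /IHt[st lt]].
by rewrite shape_rattach_cons rlabels_rattach_cons sc st lc lt.
Qed.

Lemma rlabels_rattach i j t : uniq (rlabels t) -> i \in rlabels t ->
  perm_eq (rlabels (rattach i j t)) (j :: rlabels t).
Proof.
elim/rtree_ind_first: t => [x _|x c cs IHc IHt].
  by rewrite inE /= => /eqP ->; rewrite eqxx.
rewrite rlabels_cons cat_uniq mem_cat => /and3P[uc /hasPn dis ut].
case: (boolP (i \in rlabels c)) => [ic _|inc]; last rewrite orFb => it.
  have /(rattach_notin j)[_ lt] : i \notin rlabels (RNode x cs).
    by apply: contraL ic => /dis.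
  by rewrite rlabels_rattach_cons lt -cat_cons perm_cat2r IHc.
rewrite rlabels_rattach_cons (rattach_notin j inc).2.
rewrite (perm_trans (y := rlabels c ++ j :: rlabels (RNode x cs)))//.
  by rewrite perm_cat2l IHt.
by apply/seq.permP => p; rewrite /= !count_cat /=; lia.
Qed.

(** A node is coded by the external position that ends the chain of its
    children, so attaching a child fills that position. *)
Lemma shape_rattach j t : uniq (rlabels t) ->
  [seq shape_of_rtree (rattach i j t) | i <- rlabels t] =
  grow (shape_of_rtree t).
Proof.
elim/rtree_ind_first: t => [x _|x c cs IHc IHt]; first by rewrite /= eqxx.
rewrite rlabels_cons cat_uniq => /and3P[uc /hasPn dis ut].
rewrite map_cat [grow _]/= -/(shape_of_rtree (RNode x cs)).
rewrite -IHc// -IHt// -!map_comp; congr (_ ++ _); apply/eq_in_map => i hi.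
  have /(rattach_notin j)[st _] : i \notin rlabels (RNode x cs).
    by apply: contraL hi => /dis.
  by rewrite shape_rattach_cons st.
by rewrite shape_rattach_cons (rattach_notin j (dis _ hi)).1.
Qed.

Section choices.
Variable n : nat.

Definition choices_init (p : rrt_choices n.+2) : rrt_choices n.+1 :=
  [ffun i : 'I_n => (p (widen_ord (leqnSn n) i) : 'I_i.+1)].

Definition choices_last (p : rrt_choices n.+2) : 'I_n.+1 := p ord_max.

Lemma choices_split_bij :
  bijective (fun p => (choices_init p, choices_last p)).
Proof.
apply: inj_card_bij => [p q [/ffunP pq pqn]|].
  apply/ffunP => i; have [j ->|->] := unliftP ord_max i; last exact: pqn.
  have := pq j; rewrite !ffunE.
  suff -> : lift ord_max j = widen_ord (leqnSn n) j by [].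
  by apply: val_inj; rewrite /= /bump leqNgt ltn_ord.
rewrite card_prod !card_dep_ffun /= !foldrE !big_image/= big_ord_recr/=.
by rewrite !card_ord.
Qed.

Lemma rrt_of_choicesS (p : rrt_choices n.+2) : rrt_of_choices p =
  rattach (choices_last p).+1 n.+2 (rrt_of_choices (choices_init p)).
Proof.
rewrite /rrt_of_choices enum_ordSr foldl_rcons; congr rattach.
elim/last_ind: (enum (ordinal n)) => // s i IH.
by rewrite map_rcons !foldl_rcons IH ffunE.
Qed.

End choices.

Lemma rlabels_rrt n (p : rrt_choices n.+1) :
  perm_eq (rlabels (rrt_of_choices p)) (iota 1 n.+1).
Proof.
elim: n p => [|n IH] p; first by rewrite /rrt_of_choices enum_ord0.
rewrite rrt_of_choicesS.
have := IH (choices_init p) => permI.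
rewrite (perm_trans (rlabels_rattach _ _ _))//.
- by rewrite (perm_uniq permI) iota_uniq.
- by rewrite (perm_mem permI) mem_iota /= add1n ltnS.
- have -> : iota 1 n.+2 = rcons (iota 1 n.+1) n.+2.
    by rewrite -[in LHS](addn1 n.+1) iotaD cats1 add1n.
  by rewrite perm_sym perm_rcons perm_cons perm_sym.
Qed.

(** Counting histories: the parents of [n + 2] nodes are those of the first
    [n + 1] nodes and a label in [{1, ..., n + 1}], that is, a position to fill. *)
Lemma sum_rrt (R : nmodType) n (g : bshape -> R) :
  \sum_(p : rrt_choices n.+1) g (shape_of_rtree (rrt_of_choices p)) =
  \sum_(t <- grown n) g t.
Proof.
elim: n g => [|n IH] g.
  rewrite /= big_seq1 (eq_bigr (fun=> g Tip)).
    by rewrite sumr_const card_dep_ffun /= foldrE big_image big_ord0.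
  by move=> p _; rewrite /rrt_of_choices enum_ord0.
transitivity (\sum_(q : rrt_choices n.+1 * 'I_n.+1)
    g (shape_of_rtree (rattach q.2.+1 n.+2 (rrt_of_choices q.1)))).
  rewrite (reindex _ (onW_bij _ (choices_split_bij n))).
  by apply: eq_bigr => p _; rewrite rrt_of_choicesS.
rewrite -(pair_bigA _ (fun p (i : 'I_n.+1) =>
  g (shape_of_rtree (rattach i.+1 n.+2 (rrt_of_choices p)))))/=.
rewrite big_flatten/= big_map -(IH (fun t => \sum_(u <- grow t) g u)).
apply: eq_bigr => p _.
have permI := rlabels_rrt p.
rewrite -(shape_rattach n.+2); last by rewrite (perm_uniq permI) iota_uniq.
rewrite big_map (perm_big _ permI) (_ : iota 1 n.+1 = iota (1 + 0) n.+1)//.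
by rewrite iotaDl big_map -val_enum_ord big_map big_enum.
Qed.

(** * The recursion of divide and conquer *)

Section recursion.
Context {R : realType}.
Implicit Types (a r rho theta : nat -> R).

(** The contribution of a toll at size [k] to the solution of the recursion, per
    unit of [n + 2]; also the limiting proportion of fringe subtrees of size [k]. *)
Definition toll_weight (k : nat) : R := 2 / (k.+1%:R * k.+2%:R).

Lemma toll_weight_gt0 k : 0 < toll_weight k.
Proof. by rewrite divr_gt0// mulr_gt0. Qed.

Lemma toll_weightS k : toll_weight k.+1 * (1 + 2 / k.+1%:R) = toll_weight k.
Proof.
rewrite /toll_weight -[k.+3%:R]natr1 -[k.+2%:R]natr1.
have : 0 < k.+1%:R :> R by []; move: (k.+1%:R) => x x0.
by field; rewrite !gt_eqF//; lra.
Qed.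

(** The sum up to [n] times [toll_weight n] grows at step [n + 1] by the weighted
    toll only, because [toll_weightS] cancels the factor [1 + 2/(n + 1)]. The start
    at [K] leaves the first terms free, which bounds on small sizes can exploit. *)
Lemma rec_sum_le a r K n : (K <= n)%N ->
  (forall m, (K <= m < n)%N ->
    a m.+1 <= r m.+1 + 2 / m.+1%:R * \sum_(k < m.+1) a k) ->
  toll_weight n * \sum_(k < n.+1) a k <=
  toll_weight K * \sum_(k < K.+1) a k +
    \sum_(K.+1 <= k < n.+1) toll_weight k * r k.
Proof.
elim: n => [|n IH].
  by rewrite leqn0 => /eqP -> _; rewrite big_geq// addr0.
rewrite leq_eqVlt ltnS => /predU1P[-> _|Kn ha]; first by rewrite big_geq// addr0.
rewrite big_ord_recr/= big_nat_recr//= addrA.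
have {}IH := IH Kn (fun m hm => ha m ltac:(lia)).
have h : \sum_(k < n.+1) a k + a n.+1 <=
    (1 + 2 / n.+1%:R) * \sum_(k < n.+1) a k + r n.+1.
  rewrite mulrDl mul1r -addrA lerD2l [leRHS]addrC.
  by apply: ha; lia.
rewrite (le_trans (ler_wpM2l (ltW (toll_weight_gt0 _)) h))//.
by rewrite mulrDr mulrA toll_weightS lerD2r.
Qed.

Lemma rec_le a r K n : (K <= n)%N ->
  (forall m, (K <= m <= n)%N ->
    a m.+1 <= r m.+1 + 2 / m.+1%:R * \sum_(k < m.+1) a k) ->
  a n.+1 <= r n.+1 + n.+2%:R * (toll_weight K * \sum_(k < K.+1) a k +
    \sum_(K.+1 <= k < n.+1) toll_weight k * r k).
Proof.
move=> Kn ha; rewrite (le_trans (ha n _)) ?Kn ?leqnn// lerD2l.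
have := rec_sum_le Kn (fun m hm => ha m ltac:(lia)).
move=> /(ler_wpM2l (ler0n R n.+2))/(le_trans _); apply.
rewrite mulrA /toll_weight le_eqVlt; apply/orP; left; apply/eqP; congr (_ * _).
have : 0 < n.+1%:R :> R by []; rewrite -[n.+2%:R]natr1.
by move: (n.+1%:R) => x x0; field; rewrite !gt_eqF//; lra.
Qed.

Lemma rec_eq a r n :
  (forall m, a m.+1 = r m.+1 + 2 / m.+1%:R * \sum_(k < m.+1) a k) ->
  a n.+1 = r n.+1 + n.+2%:R *
    (a 0%N + \sum_(1 <= k < n.+1) toll_weight k * r k).
Proof.
move=> ha; have w0 : toll_weight 0 = 1 by rewrite /toll_weight mul1r divff.
apply/eqP; rewrite eq_le; apply/andP; split.
  have := @rec_le a r 0 n (leq0n _) (fun m _ => ltac:(by rewrite ha)).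
  by rewrite w0 mul1r big_ord1.
have := @rec_le (fun k => - a k) (fun k => - r k) 0 n (leq0n _).
rewrite w0 mul1r big_ord1 -lerN2 opprK => h.
rewrite (le_trans _ (h _))//.
  rewrite opprD opprK -mulrN opprD opprK -sumrN.
  rewrite le_eqVlt; apply/orP; left; apply/eqP; congr (_ + _ * (_ + _)).
  by apply: eq_bigr => k _; rewrite mulrN opprK.
by move=> m _; rewrite sumrN mulrN -opprD ha.
Qed.

Section limit.
Variables rho theta : nat -> R.
Hypothesis rho_theta : forall k, (1 <= k)%N ->
  toll_weight k * rho k <= theta k - theta k.+1.

Lemma toll_sum_le r m n : (1 <= m)%N -> (m <= n)%N ->
  (forall k, (m <= k < n)%N -> `|r k| <= rho k) ->
  `|\sum_(m <= k < n) toll_weight k * r k| <= theta m - theta n.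
Proof.
move=> m0; elim: n => [|n IH]; first by rewrite leqn0 => /eqP ->; rewrite big_geq// subrr normr0.
rewrite leq_eqVlt ltnS => /predU1P[-> _|mn hr]; first by rewrite big_geq// subrr normr0.
rewrite big_nat_recr//= (le_trans (ler_normD _ _))//.
have h1 := IH mn (fun k hk => hr k ltac:(lia)).
have h2 : `|toll_weight n * r n| <= theta n - theta n.+1.
  rewrite (le_trans _ (rho_theta _))//; last by lia.
  rewrite normrM gtr0_norm ?toll_weight_gt0// ler_wpM2l ?(ltW (toll_weight_gt0 _))//.
  by apply: hr; lia.
lra.
Qed.

(** The tail of the series is bounded by the telescoping [theta]; adding [theta] to
    the partial sums makes them nonincreasing, hence convergent. *)
Lemma toll_series_cvg r : (forall k, 0 <= theta k) -> theta @ \oo --> 0 ->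
  (forall k, (1 <= k)%N -> `|r k| <= rho k) ->
  exists S, (\sum_(1 <= k < n.+1) toll_weight k * r k @[n --> \oo] --> S) /\
    forall n, `|\sum_(1 <= k < n.+1) toll_weight k * r k - S| <= theta n.+1.
Proof.
move=> th_ge0 th0 hr; pose u n := \sum_(1 <= k < n.+1) toll_weight k * r k.
have du m n : (m <= n)%N -> `|u n - u m| <= theta m.+1 - theta n.+1.
  move=> mn; rewrite /u (@big_cat_nat _ _ _ m.+1)//= addrAC subrr add0r.
  by apply: toll_sum_le => // k hk; apply: hr; lia.
have th0S : (fun n => theta n.+1) @ \oo --> 0 by rewrite (cvg_shiftS theta).
have cvgw : cvgn (fun n => u n + theta n.+1).
  apply: nonincreasing_is_cvgn => [m n mn|].
    by have := du m n mn; rewrite ler_norml => /andP[]; lra.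
  exists (u 0%N - theta 1) => _ [n _ <-].
  have := du 0%N n (leq0n _); rewrite ler_norml => /andP[].
  by have := th_ge0 n.+1; lra.
have cvgu : u @ \oo --> limn (fun n => u n + theta n.+1).
  rewrite -[X in _ --> X]subr0 [X in X @ _](_ : u =
    (fun n => u n + theta n.+1) \- (fun n => theta n.+1)).
    exact: cvgB.
  by apply/funext => n; rewrite /= addrK.
exists (limn (fun n => u n + theta n.+1)); split => // m.
apply: (@cvgr_to_le _ \oo _ _ (fun n => `|u m - u n|)).
  by apply: cvg_norm; apply: cvgB => //; exact: cvg_cst.
near=> n; rewrite distrC (le_trans (du m n _)) ?gerBl//.
by near: n; exact: nbhs_infty_ge.
Unshelve. all: by end_near. Qed.

End limit.

Lemma sqrt_natS_gt0 (k : nat) : 0 < Num.sqrt k.+1%:R :> R.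
Proof. by rewrite sqrtr_gt0. Qed.

Lemma toll_bound_cst (c : R) k : 0 <= c ->
  toll_weight k * c <= 2 * c / k.+1%:R - 2 * c / k.+2%:R.
Proof.
move=> c0; rewrite /toll_weight le_eqVlt; apply/orP; left; apply/eqP.
rewrite -[k.+2%:R]natr1; have : 0 < k.+1%:R :> R by [].
by move: (k.+1%:R) => x x0; field; rewrite !gt_eqF//; lra.
Qed.

(** Tolls of order [sqrt k] give summable weighted tolls of order [k ^ (-3/2)], with
    a telescoping bound that comes from [2 q (q - p) >= q^2 - p^2 = 1] for
    [p = sqrt (k + 1)] and [q = sqrt (k + 2)]. *)
Lemma toll_bound_sqrt (c : R) k : 0 <= c ->
  toll_weight k * (c * Num.sqrt k.+1%:R) <=
  4 * c / Num.sqrt k.+1%:R - 4 * c / Num.sqrt k.+2%:R.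
Proof.
move=> c0; rewrite /toll_weight.
have := sqrt_natS_gt0 k; have := sqrt_natS_gt0 k.+1.
have : Num.sqrt k.+2%:R ^+ 2 = Num.sqrt k.+1%:R ^+ 2 + 1 :> R.
  by rewrite !sqr_sqrtr// natr1.
have -> : k.+1%:R * k.+2%:R = Num.sqrt k.+1%:R ^+ 2 * Num.sqrt k.+2%:R ^+ 2 :> R.
  by rewrite !sqr_sqrtr.
move: (Num.sqrt k.+1%:R) (Num.sqrt k.+2%:R) => p q pq q0 p0.
have p1 : p != 0 by rewrite gt_eqF.
have q1 : q != 0 by rewrite gt_eqF.
have -> : 4 * c / p - 4 * c / q = (2 * c / (p * q ^+ 2)) * (2 * q * (q - p)).
  by field; rewrite p1 q1.
have -> : 2 / (p ^+ 2 * q ^+ 2) * (c * p) = 2 * c / (p * q ^+ 2).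
  by field; rewrite p1 q1.
rewrite ler_peMr//; last by nra.
by rewrite divr_ge0// mulr_ge0// ltW// exprn_gt0.
Qed.

Lemma cvg_inv_sqrt (c : R) : c / Num.sqrt k.+1%:R @[k --> \oo] --> 0.
Proof.
rewrite -[X in _ --> X](mulr0 c); apply: cvgM; first exact: cvg_cst.
have -> : (fun k : nat => (Num.sqrt k.+1%:R)^-1) = Num.sqrt \o harmonic :> (nat -> R).
  by apply/funext => k /=; rewrite sqrtrV.
rewrite -[X in _ --> X](@sqrtr0 R).
by apply: continuous_cvg; [exact: sqrt_continuous|exact: cvg_harmonic].
Qed.

Lemma cvg_inv_nat (c : R) : c / k.+1%:R @[k --> \oo] --> 0.
Proof.
rewrite -[X in _ --> X](mulr0 c); apply: cvgM; first exact: cvg_cst.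
exact: cvg_harmonic.
Qed.

Lemma linear_cvg (u : nat -> R) (s C : R) :
  (forall n, `|u n - n.+1%:R * s| <= C * Num.sqrt n.+1%:R) ->
  u n / n.+1%:R @[n --> \oo] --> s.
Proof.
move=> hu; apply/cvgrPdist_le => e e0; near=> n.
rewrite distrC (@le_trans _ _ (`|C / Num.sqrt n.+1%:R|))//; last first.
  near: n; have /cvgrPdist_le/(_ e e0) := cvg_inv_sqrt C.
  by apply: filterS => n; rewrite sub0r normrN.
have -> : u n / n.+1%:R - s = (u n - n.+1%:R * s) / n.+1%:R.
  by rewrite mulrBl mulrAC divff// mul1r.
rewrite normrM normfV [`|n.+1%:R|]ger0_norm// ler_pdivrMr//.
rewrite (le_trans (hu n))// (le_trans (ler_norm _))// normrM normrM -mulrA.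
rewrite normfV ler_wpM2l// !ger0_norm//.
have qq : n.+1%:R = Num.sqrt n.+1%:R * Num.sqrt n.+1%:R :> R.
  by rewrite -expr2 sqr_sqrtr.
by rewrite [X in _ <= _ * X]qq mulKf// gt_eqF// sqrt_natS_gt0.
Unshelve. all: by end_near. Qed.

End recursion.

(** * Mean and variance of additive functionals *)

Definition lsub (t : bshape) : bshape := if t is Fork a _ then a else Tip.
Definition rsub (t : bshape) : bshape := if t is Fork _ b then b else Tip.

Fixpoint total {R : realType} (f : bshape -> R) (t : bshape) : R :=
  if t is Fork a b then f t + total f a + total f b else 0.

Section subtrees.
Context {R : realType}.
Implicit Types (g h : bshape -> R).

Lemma nforks_subtrees n t : nforks t = n.+1 ->
  (nforks (lsub t) + nforks (rsub t) = n)%N.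
Proof. by case: t => //= a b []. Qed.

Lemma avg_mul n g h : avg n.+1 (fun t => g (lsub t) * h (rsub t)) =
  n.+1%:R^-1 * \sum_(k < n.+1) avg k g * avg (n - k) h.
Proof.
rewrite avgS; congr (_ * _); apply: eq_bigr => k _.
by rewrite -avgZr; apply: eq_avg => a _; rewrite -avgZ.
Qed.

Lemma avg_lsub n g :
  avg n.+1 (fun t => g (lsub t)) = n.+1%:R^-1 * \sum_(k < n.+1) avg k g.
Proof.
transitivity (avg n.+1 (fun t => g (lsub t) * cst 1 (rsub t))).
  by apply: eq_avg => t _; rewrite mulr1.
by rewrite avg_mul; congr (_ * _); apply: eq_bigr => k _; rewrite avg_cst mulr1.
Qed.

Lemma avg_rsub n g :
  avg n.+1 (fun t => g (rsub t)) = n.+1%:R^-1 * \sum_(k < n.+1) avg k g.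
Proof.
transitivity (avg n.+1 (fun t => cst 1 (lsub t) * g (rsub t))).
  by apply: eq_avg => t _; rewrite mul1r.
rewrite avg_mul; congr (_ * _); rewrite (reindex_inj rev_ord_inj)/=.
by apply: eq_bigr => k _; rewrite avg_cst mul1r subSS subKn// -ltnS.
Qed.

Lemma avg_subtrees n g : avg n.+1 (fun t => g (lsub t) + g (rsub t)) =
  2 / n.+1%:R * \sum_(k < n.+1) avg k g.
Proof. by rewrite avgD avg_lsub avg_rsub; ring. Qed.

(** Jensen's inequality, from [2 y |g| <= g^2 + y^2]. *)
Lemma avg_abs_le n g (y : R) : 0 < y -> avg n (fun t => g t ^+ 2) <= y ^+ 2 ->
  avg n (fun t => `|g t|) <= y.
Proof.
move=> y0 gy; have y1 : y != 0 by rewrite gt_eqF.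
rewrite (@le_trans _ _ (avg n (fun t => (2 * y)^-1 * (g t ^+ 2 + y ^+ 2))))//.
  apply: avg_le => t _; rewrite ler_pdivlMl ?mulr_gt0//.
  by rewrite -(real_normK (num_real (g t))); have := sqr_ge0 (`|g t| - y); lra.
rewrite avgZ avgD avg_cst ler_pdivrMl ?mulr_gt0//.
lra.
Qed.

Lemma sum_natS n : \sum_(k < n) k.+1%:R = n%:R * n.+1%:R / 2 :> R.
Proof.
elim: n => [|n IH]; first by rewrite big_ord0 !mul0r.
by rewrite big_ord_recr/= IH -[n.+2%:R]natr1 -[n.+1%:R]natr1; field.
Qed.

End subtrees.

Section moments.
Context {R : realType} (f : bshape -> R) (B : R).
Hypothesis fB : forall t, `|f t| <= B.

Let F := total f.

Let B0 : 0 <= B. Proof. exact: le_trans (fB Tip). Qed.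

Lemma totalE n t : nforks t = n.+1 -> F t = f t + F (lsub t) + F (rsub t).
Proof. by case: t. Qed.

Lemma avg_total_rec n :
  avg n.+1 F = avg n.+1 f + 2 / n.+1%:R * \sum_(k < n.+1) avg k F.
Proof.
rewrite -avg_subtrees -avgD; apply: eq_avg => t ht.
by rewrite (totalE ht) addrA.
Qed.

Lemma ler_norm_avg_toll n : `|avg n f| <= B.
Proof.
by rewrite (le_trans (ler_norm_avg _ _))// -[leRHS](avg_cst n); exact: avg_le.
Qed.

(** For bounded tolls the series of weighted tolls converges with an error [O(1/n)],
    which the factor [n + 2] in [rec_eq] turns into [O(1)]. *)
Lemma avg_total_cvg : exists mu : R,
  (\sum_(1 <= k < n.+1) toll_weight k * avg k f @[n --> \oo] --> mu) /\
  forall n, `|avg n F - n.+1%:R * mu| <= 3 * B.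
Proof.
pose theta k := 2 * B / k.+1%:R.
have [k|||k _|mu [cmu hmu]] := @toll_series_cvg R (fun=> B) theta _ (fun k => avg k f).
- by move=> _; exact: toll_bound_cst.
- by move=> k; rewrite divr_ge0// mulr_ge0.
- exact: cvg_inv_nat.
- exact: ler_norm_avg_toll.
exists mu; split => // -[|n].
  rewrite avg0/= sub0r normrN mul1r.
  have := hmu 0%N; rewrite big_geq// sub0r normrN /theta mulrAC divff// mul1r.
  by have := B0; lra.
have /= -> := @rec_eq R (fun n => avg n F) (fun n => avg n f) n avg_total_rec.
rewrite avg0 add0r -addrA -mulrBr.
rewrite (le_trans (ler_normD _ _))// normrM ger0_norm//.
have h2 : n.+2%:R * theta n.+1 = 2 * B by rewrite /theta mulrCA divff ?mulr1.
rewrite (_ : 3 * B = B + 2 * B); last by ring.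
apply: lerD; first exact: ler_norm_avg_toll.
by rewrite -h2 ler_wpM2l//; exact: hmu.
Qed.

Definition centered t := F t - avg (nforks t) F.

Let W := centered.

(** The toll of the centered functional: besides the centered [f], it contains the
    fluctuation of the conditional mean given the sizes of the two subtrees. *)
Definition innovation t := W t - W (lsub t) - W (rsub t).

(* The innovation is a toll and three errors of means, so at most
   [B + 3 (3 B)]; the summand 1 makes [H >= 1]. *)
Let H := 10 * B + 1.

Lemma avg_centered n : avg n W = 0.
Proof.
rewrite (eq_avg (h := fun t => F t - avg n F)); last by move=> t; rewrite /W /centered => ->.
by rewrite avgB avg_cst subrr.
Qed.

Lemma innovation_le t : (0 < nforks t)%N -> `|innovation t| <= H.
Proof.
case: t => // a b _; have [mu [_ hmu]] := avg_total_cvg.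
rewrite /innovation /W /centered /= -/F.
set n := (nforks a + nforks b)%N.
have := fB (Fork a b); have := hmu n.+1; have := hmu (nforks a); have := hmu (nforks b).
have e : n.+2%:R = (nforks a).+1%:R + (nforks b).+1%:R :> R.
  by rewrite -natrD addSn addnS.
rewrite e [(_ + _) * mu]mulrDl; set x := avg n.+1 F.
move: ((nforks a).+1%:R * mu) ((nforks b).+1%:R * mu) => ma mb.
rewrite !ler_norml => /andP[? ?] /andP[? ?] /andP[? ?] /andP[? ?].
by have FE : F (Fork a b) = f (Fork a b) + F a + F b by []; apply/andP; split; rewrite FE /H; lra.
Qed.

Lemma centeredE t : W t = W (lsub t) + W (rsub t) + innovation t.
Proof. by rewrite /innovation; ring. Qed.

Lemma avg_innovation n : avg n.+1 innovation = 0.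
Proof.
rewrite /innovation avgB avgB avg_lsub avg_rsub.
rewrite (_ : avg n.+1 (fun t => W t) = 0); last exact: avg_centered.
by rewrite big1 ?mulr0 ?subr0// => k _; exact: avg_centered.
Qed.

Let v n := avg n (fun t => W t ^+ 2).
Let X t := W (lsub t) + W (rsub t).
Let r n := avg n (fun t => innovation t ^+ 2 + 2 * (innovation t * X t)).

(** The cross term vanishes: given their sizes, the subtrees are independent and
    their functionals have mean zero. *)
Lemma avg_sum_sqr n :
  avg n.+1 (fun t => X t ^+ 2) = 2 / n.+1%:R * \sum_(k < n.+1) v k.
Proof.
rewrite -avg_subtrees.
transitivity (avg n.+1 (fun t => W (lsub t) ^+ 2 + W (rsub t) ^+ 2 +
    2 * (W (lsub t) * W (rsub t)))).
  by apply: eq_avg => t _; rewrite /X; ring.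
rewrite [LHS]avgD avgZ avg_mul big1 ?mulr0 ?addr0// => k _.
by rewrite avg_centered mul0r.
Qed.

(** The toll [r] in the recursion of the variance contains the covariance of the
    innovation and the sum over the subtrees, which depends on the variance again. *)
Lemma avg_sqr_rec n : v n.+1 = r n.+1 + 2 / n.+1%:R * \sum_(k < n.+1) v k.
Proof.
rewrite -avg_sum_sqr -avgD; apply: eq_avg => t _.
by rewrite centeredE -/(X t); ring.
Qed.

Lemma avg_abs_subtrees (U : R) n : 0 < U ->
  (forall k, (k <= n)%N -> v k <= U ^+ 2 * k.+1%:R) ->
  avg n.+1 (fun t => `|X t|) <= U * Num.sqrt n.+2%:R.
Proof.
move=> U0 vU; apply: avg_abs_le; first by rewrite mulr_gt0// sqrt_natS_gt0.
rewrite avg_sum_sqr exprMn sqr_sqrtr//.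
rewrite (_ : U ^+ 2 * n.+2%:R = 2 / n.+1%:R * (U ^+ 2 * (n.+1%:R * n.+2%:R / 2))).
  rewrite ler_wpM2l// -sum_natS mulr_sumr; apply: ler_sum => k _.
  by apply: vU; rewrite -ltnS.
by field; rewrite nat1r pnatr_eq0.
Qed.

Lemma avg_innovation_mul n g (c : R) : avg n.+1 (fun t => `|g t|) <= c ->
  `|avg n.+1 (fun t => innovation t * g t)| <= H * c.
Proof.
have H0 : 0 <= H by rewrite /H; have := B0; lra.
move=> gc; rewrite (le_trans (ler_norm_avg _ _))//.
rewrite (le_trans _ (ler_wpM2l H0 gc))// -avgZ; apply: avg_le => t ht.
by rewrite normrM ler_wpM2r// innovation_le// ht.
Qed.

Lemma var_toll_le n (U : R) : 0 < U ->
  (forall k, (k <= n)%N -> v k <= U ^+ 2 * k.+1%:R) ->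
  `|r n.+1| <= H ^+ 2 + 2 * H * (U * Num.sqrt n.+2%:R).
Proof.
move=> U0 vU; rewrite /r avgD avgZ (le_trans (ler_normD _ _))// lerD//.
  rewrite (le_trans (ler_norm_avg _ _))// -[leRHS](avg_cst n.+1); apply: avg_le => t ht.
  have H0 : 0 <= H by rewrite /H; have := B0; lra.
  by rewrite normrX ler_pXn2r ?nnegrE// innovation_le// ht.
rewrite normrM ger0_norm// -mulrA ler_wpM2l//.
by apply: avg_innovation_mul; exact: avg_abs_subtrees.
Qed.

Let theta k : R := 4 * (19 * H ^+ 2) / Num.sqrt k.+1%:R.

Lemma var_toll_le_sqrt n : (forall k, (k <= n)%N -> v k <= (9 * H) ^+ 2 * k.+1%:R) ->
  `|r n.+1| <= 19 * H ^+ 2 * Num.sqrt n.+2%:R.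
Proof.
have H0 : 1 <= H by rewrite /H; have := B0; lra.
move=> vU; have U0 : 0 < 9 * H by lra.
rewrite (le_trans (var_toll_le U0 vU))//.
have : 1 <= Num.sqrt n.+2%:R :> R by rewrite -[leLHS]sqrtr1 ler_sqrt// ler1n.
move: (Num.sqrt _) => q q1.
have : 0 <= H ^+ 2 * (q - 1) by rewrite mulr_ge0 ?sqr_ge0// subr_ge0.
lra.
Qed.

(** The constant reproduces itself: variances up to [U^2 (k+1)] with [U = 9 H]
    give tolls up to [(1 + 2 * 9) H^2 sqrt (k+1)] in the recursion, whose solution
    is at most [(19 + 4 * 19 / sqrt 2) H^2 (n+2)], below [81 H^2 (n+2)]. *)
Lemma var_linear n : v n <= (9 * H) ^+ 2 * n.+1%:R.
Proof.
have H0 : 0 <= H ^+ 2 by exact: sqr_ge0.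
have [m] := ubnP n; elim: m n => // m IH [_|n]; last rewrite ltnS => nm.
  by rewrite /v avg0 /W /centered avg0 subrr expr0n/= mulr_ge0// sqr_ge0.
have vle k : (k <= n)%N -> v k <= (9 * H) ^+ 2 * k.+1%:R.
  by move=> kn; apply: IH; lia.
have rle k : (1 <= k < n.+2)%N -> `|r k| <= 19 * H ^+ 2 * Num.sqrt k.+1%:R.
  by case: k => // k kn; apply: var_toll_le_sqrt => j jk; apply: vle; lia.
have /= -> := @rec_eq R v r n avg_sqr_rec.
rewrite {1}/v avg0 /W /centered avg0 subrr expr0n/= add0r.
have h1 := rle n.+1 ltac:(lia).
have h2 : `|\sum_(1 <= k < n.+1) toll_weight k * r k| <= theta 1 - theta n.+1.
  apply: (toll_sum_le (rho := fun k => 19 * H ^+ 2 * Num.sqrt k.+1%:R)) => //.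
    by move=> k _; apply: toll_bound_sqrt; rewrite mulr_ge0.
  by move=> k hk; apply: rle; lia.
(* [theta 1 = 76 H^2 / sqrt 2], and [76/54 <= sqrt 2]. *)
have th : theta 1 <= 54 * H ^+ 2.
  rewrite /theta ler_pdivrMr ?sqrtr_gt0//.
  have s2 : 76 / 54 * (76 / 54) <= 2 :> R by lra.
  have : 76 / 54 <= Num.sqrt 2 :> R.
    by rewrite -[leLHS]ger0_norm// -sqrtr_sqr ler_sqrt// expr2.
  move: (Num.sqrt 2) => q q1.
  have : 0 <= H ^+ 2 * (q - 76 / 54) by rewrite mulr_ge0// subr_ge0.
  lra.
have th0 : 0 <= theta n.+1 by rewrite /theta divr_ge0 ?sqrtr_ge0// mulr_ge0// mulr_ge0.
have sq : Num.sqrt n.+2%:R <= n.+2%:R :> R.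
  rewrite -[leRHS]ger0_norm// -sqrtr_sqr ler_sqrt ?exprn_ge0//.
  by rewrite expr2 ler_peMr// ler1n.
have : n.+2%:R * (\sum_(1 <= k < n.+1) toll_weight k * r k) <= n.+2%:R * (54 * H ^+ 2).
  rewrite ler_wpM2l// (le_trans (ler_norm _))// (le_trans h2)//; lra.
have : r n.+1 <= 19 * H ^+ 2 * n.+2%:R.
  by rewrite (le_trans (ler_norm _))// (le_trans h1)// ler_wpM2l// mulr_ge0.
have : 0 <= H ^+ 2 * n.+2%:R by rewrite mulr_ge0.
rewrite exprMn; lra.
Qed.

Lemma avg_abs_subtrees_le n : avg n.+1 (fun t => `|X t|) <= 9 * H * Num.sqrt n.+2%:R.
Proof.
apply: avg_abs_subtrees => [|k _]; last exact: var_linear.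
by rewrite /H; have := B0; lra.
Qed.

(** Now that tolls are known to be [O(sqrt n)], the series of weighted tolls
    converges with tail [O(1/sqrt n)]. The constant [95] is [19] from the last
    toll and [76 = 4 * 19] from the tail. *)
Lemma var_cvg : exists2 s2, 0 <= s2 &
  forall n, `|v n - n.+1%:R * s2| <= 95 * H ^+ 2 * Num.sqrt n.+1%:R.
Proof.
have H0 : 0 <= H ^+ 2 by exact: sqr_ge0.
have th_ge0 k : 0 <= theta k by rewrite /theta divr_ge0 ?sqrtr_ge0// mulr_ge0// mulr_ge0.
have [k _||||s2 [cs2 hs2]] := @toll_series_cvg R
    (fun k => 19 * H ^+ 2 * Num.sqrt k.+1%:R) theta _ r.
- by apply: toll_bound_sqrt; rewrite mulr_ge0.
- exact: th_ge0.
- exact: cvg_inv_sqrt.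
- by case=> // k _; apply: var_toll_le_sqrt => j _; exact: var_linear.
have vs n : `|v n - n.+1%:R * s2| <= 95 * H ^+ 2 * Num.sqrt n.+1%:R.
  case: n => [|n].
    rewrite {1}/v avg0 /W /centered avg0 subrr expr0n/= sub0r normrN mul1r sqrtr1 mulr1.
    have := hs2 0%N; rewrite big_geq// sub0r normrN => /le_trans; apply.
    rewrite /theta ler_pdivrMr ?sqrtr_gt0//.
    have : 1 <= Num.sqrt 2 :> R by rewrite -[leLHS]sqrtr1 ler_sqrt// ler1n.
    move: (Num.sqrt 2) => q q1.
    have : 0 <= H ^+ 2 * (q - 1) by rewrite mulr_ge0// subr_ge0.
    lra.
  have /= -> := @rec_eq R v r n avg_sqr_rec.
  rewrite {1}/v avg0 /W /centered avg0 subrr expr0n/= add0r -addrA -mulrBr.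
  rewrite (le_trans (ler_normD _ _))// normrM ger0_norm//.
  have /(ler_wpM2l (ler0n R n.+2)) h := hs2 n.
  have h2 : n.+2%:R * theta n.+1 = 76 * H ^+ 2 * Num.sqrt n.+2%:R.
    rewrite /theta -[n.+2%:R in X in X * _](@sqr_sqrtr R)//.
    have := sqrt_natS_gt0 (R := R) n.+1; move: (Num.sqrt _) => q q0.
    by field; rewrite gt_eqF.
  have h3 : `|r n.+1| <= 19 * H ^+ 2 * Num.sqrt n.+2%:R.
    by apply: var_toll_le_sqrt => j _; exact: var_linear.
  rewrite (le_trans (lerD h3 h))// h2; lra.
exists s2 => //; apply: (cvgr_to_ge (linear_cvg vs)); near=> n.
by rewrite divr_ge0//; apply: avg_ge0 => t _; exact: sqr_ge0.
Unshelve. all: by end_near. Qed.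

End moments.

(** * Normal densities *)

Section normal_density.
Context {R : realType}.
Notation mu := (@lebesgue_measure R).
Implicit Types (m s t : R) (g : R -> R).

(** [normal_prob] seen as a probability on the Borel sets, which fixes the
    measurable structure in the integrals below. *)
Definition normal_law m s : probability (measurableTypeR R) R := normal_prob m s.

Lemma ge0_integral_normal m s (f : R -> \bar R) :
  measurable_fun [set: R] f -> (forall x, 0 <= f x)%E ->
  (\int[normal_law m s]_x f x = \int[mu]_x (f x * (normal_pdf m s x)%:E))%E.
Proof.
move=> mf f0; have dom : normal_law m s `<< mu := @normal_prob_dominates R m s.
rewrite -(Radon_Nikodym_SigmaFinite.change_of_variables dom f0)//.
have mpdf : measurable_fun [set: R]
    (fun x => (normal_pdf m s x)%:E).
  by apply/measurable_EFinP; exact: measurable_normal_pdf.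
have mRN := measurable_int _ (Radon_Nikodym_SigmaFinite.f_integrable dom).
apply: ae_eq_integral => //; do 1?exact: emeasurable_funM.
apply: ae_eqe_mul2l; apply: integral_ae_eq => //.
  exact: Radon_Nikodym_SigmaFinite.f_integrable.
by move=> E ET mE; rewrite -(Radon_Nikodym_SigmaFinite.f_integral dom).
Qed.

Lemma ge0_integral_affine m s g : 0 < s -> continuous g -> (forall x, 0 <= g x) ->
  (\int[mu]_x (g x)%:E = \int[mu]_x (g (m + s * x) * s)%:E)%E.
Proof.
move=> s0 cg g0; pose F : R -> R := fun x => m + s * x.
have dF (x : R) : is_derive x 1 F s.
  by apply: is_derive_eq; rewrite add0r mul1r /GRing.scale/= mulr1.
have F'E : F^`()%classic = cst s.
  by apply/funext => x; rewrite derive1E derive_val.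
rewrite (@increasing_ge0_integration_by_substitutionT _ F)//.
- by apply: eq_integral => x _; rewrite F'E.
- by move=> x y xy; rewrite /F ltrD2l ltr_pM2l.
- by rewrite F'E => ?; exact: cvg_cst.
- by rewrite F'E; exact: is_cvg_cst.
- by rewrite F'E; exact: is_cvg_cst.
- apply: cvg_comp (cvg_addrl_Ny _).
  exact: gt0_cvgMrNy.
- apply: cvg_comp (cvg_addrl _).
  exact: gt0_cvgMry.
Qed.

Let c0 : R := (Num.sqrt (pi *+ 2))^-1.

Lemma normal_pdf_gt0E m s x : 0 < s ->
  normal_pdf m s x = c0 / s * expR (- (x - m) ^+ 2 / (2 * s ^+ 2)).
Proof.
move=> s0; rewrite normal_pdfE ?gt_eqF// /normal_peak /normal_fun.
rewrite -mulrnAr sqrtrM ?sqr_ge0// sqrtr_sqr gtr0_norm// invfM [s^-1 * _]mulrC.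
by rewrite -(mulr_natl (s ^+ 2)).
Qed.

Lemma normal_pdf_affine m s x : 0 < s ->
  normal_pdf m s (m + s * x) * s = normal_pdf 0 1 x.
Proof.
move=> s0; have s0' : s != 0 by rewrite gt_eqF.
rewrite !normal_pdf_gt0E// mulrAC divfK// divr1; congr (_ * expR _).
by field.
Qed.

(** The joint density of [Y] and [s Y + t Z], for independent standard normal
    [Y] and [Z], factors through the law of the sum: complete the square. *)
Lemma normal_pdf_mul (s t r y w : R) : 0 < s -> 0 < t -> 0 < r ->
  r ^+ 2 = s ^+ 2 + t ^+ 2 ->
  normal_pdf 0 1 y * normal_pdf (s * y) t w =
  normal_pdf 0 r w * normal_pdf (s * w / r ^+ 2) (t / r) y.
Proof.
move=> s0 t0 r0 rE; have tr0 : 0 < t / r by rewrite divr_gt0.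
have [t0' r0'] : t != 0 /\ r != 0 by rewrite !gt_eqF.
have st0 : s ^+ 2 + t ^+ 2 != 0 by rewrite gt_eqF// addr_gt0// exprn_gt0.
rewrite !normal_pdf_gt0E// mulrACA [RHS]mulrACA -!expRD; congr (_ * expR _).
  by field; rewrite t0' r0'.
have -> : (t / r) ^+ 2 = t ^+ 2 / (s ^+ 2 + t ^+ 2) by rewrite expr_div_n rE.
by rewrite rE; field; rewrite t0' st0.
Qed.

Lemma integral_normal_affine m s g : 0 < s -> continuous g ->
  (forall x, 0 <= g x) ->
  (\int[normal_law 0 1]_x (g (m + s * x))%:E =
   \int[mu]_x (g x * normal_pdf m s x)%:E)%E.
Proof.
move=> s0 cg g0.
have cga : continuous (fun x => g (m + s * x)).
  move=> x; apply: continuous_comp; last exact: cg.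
  by apply: cvgD; [exact: cvg_cst|apply: cvgM; [exact: cvg_cst|exact: cvg_id]].
rewrite (@ge0_integral_affine m s (fun x => g x * normal_pdf m s x))//; first last.
- by move=> x; rewrite mulr_ge0// normal_pdf_ge0.
- by move=> x; apply: cvgM; [exact: cg|apply: continuous_normal_pdf; rewrite gt_eqF].
rewrite ge0_integral_normal; first last.
- by move=> x; rewrite /= lee_fin.
- by apply/measurable_EFinP; exact: continuous_measurable_fun.
by apply: eq_integral => x _; rewrite -EFinM -mulrA normal_pdf_affine.
Qed.

Lemma integral_normal_scale s g : 0 < s -> continuous g ->
  (forall x, 0 <= g x) ->
  (\int[normal_law 0 s]_x (g x)%:E = \int[normal_law 0 1]_x (g (s * x))%:E)%E.
Proof.
move=> s0 cg g0; have := integral_normal_affine 0 s0 cg g0.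
under eq_integral do rewrite add0r.
move=> ->; rewrite ge0_integral_normal//.
by apply/measurable_EFinP; exact: continuous_measurable_fun.
Qed.

Lemma measurable_normal_kernel s t g : 0 < t -> continuous g ->
  measurable_fun [set: R * R]
    (fun p : R * R => g p.2 * normal_pdf (s * p.1) t p.2).
Proof.
move=> t0 cg; apply: measurable_funM.
  apply: measurableT_comp => //; exact: continuous_measurable_fun.
under eq_fun do rewrite normal_pdf_gt0E//.
apply: measurable_funM => //; apply: measurableT_comp => //.
apply: measurable_funM => //; apply: measurableT_comp => //.
apply: measurable_funX; apply: measurable_funB => //.
exact: measurable_funM.
Qed.

(** Integrate [normal_pdf_mul] over the second factor, after an exchange of the
    integrals. *)
Lemma integral_normal_conv (s t r : R) g : 0 < s -> 0 < t -> 0 < r ->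
  r ^+ 2 = s ^+ 2 + t ^+ 2 -> continuous g -> (forall x, 0 <= g x) ->
  (\int[normal_law 0 1]_y \int[normal_law 0 1]_z (g (s * y + t * z))%:E =
   \int[normal_law 0 1]_z (g (r * z))%:E)%E.
Proof.
move=> s0 t0 r0 rE cg g0.
pose K (p : R * R) := (g p.2 * normal_pdf (s * p.1) t p.2)%:E.
have K0 p : (0 <= K p)%E by rewrite lee_fin mulr_ge0// normal_pdf_ge0.
have mK : measurable_fun [set: R * R] K.
  by apply/measurable_EFinP; exact: measurable_normal_kernel.
transitivity (\int[normal_law 0 1]_y \int[mu]_w K (y, w))%E.
  by apply: eq_integral => y _; rewrite integral_normal_affine.
rewrite ge0_integral_normal; first last.
- by move=> y; exact: integral_ge0.
- exact: (measurable_fun_fubini_tonelli_F (m2 := mu)).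
transitivity (\int[mu]_y \int[mu]_w (K (y, w) * (normal_pdf 0 1 y)%:E))%E.
  apply: eq_integral => y _; rewrite ge0_integralZr//.
  - exact: (measurableT_comp mK).
  - by rewrite lee_fin normal_pdf_ge0.
rewrite (@fubini_tonelli _ _ _ _ _ mu mu
    (fun p => (K p * (normal_pdf 0 1 p.1)%:E)%E)) /=; first last.
- by move=> p; rewrite mule_ge0// lee_fin normal_pdf_ge0.
- apply: emeasurable_funM => //; apply/measurable_EFinP.
  by apply: measurableT_comp => //; exact: measurable_normal_pdf.
transitivity (\int[mu]_w (g w * normal_pdf 0 r w)%:E)%E; last first.
  rewrite -integral_normal_affine//.
  by apply: eq_integral => x _; rewrite add0r.
apply: eq_integral => w _.
transitivity (\int[mu]_y ((g w * normal_pdf 0 r w)%:E *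
    (normal_pdf (s * w / r ^+ 2) (t / r) y)%:E))%E.
  apply: eq_integral => y _; rewrite /K/= -!EFinM -!mulrA; congr (_ * _)%:E.
  by rewrite mulrC (normal_pdf_mul _ _ s0 t0 r0 rE) mulrA.
rewrite (@ge0_integralZl _ _ _ mu _ measurableT
  (fun y => (normal_pdf (s * w / r ^+ 2) (t / r) y)%:E))//.
- by rewrite integral_normal_pdf mule1.
- by apply/measurable_EFinP; exact: measurable_normal_pdf.
- by move=> y _; rewrite lee_fin normal_pdf_ge0.
- by rewrite lee_fin mulr_ge0// normal_pdf_ge0.
Qed.

(** The exponential turns the standard density into [s] times the density with
    standard deviation [s]. *)
Lemma integral_normal_expR_sqr s : 0 < s ->
  (\int[normal_law 0 1]_z (expR ((1 - s ^- 2) / 2 * z ^+ 2))%:E = s%:E)%E.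
Proof.
move=> s0; rewrite ge0_integral_normal; first last.
- by move=> x; rewrite lee_fin expR_ge0.
- apply/measurable_EFinP; apply: measurableT_comp => //.
  by apply: measurable_funM => //; exact: measurable_funX.
transitivity (\int[mu]_x (s%:E * (normal_pdf 0 s x)%:E))%E.
  apply: eq_integral => x _; rewrite -!EFinM !normal_pdf_gt0E//.
  rewrite [in RHS]mulrA [s * _]mulrC divfK ?gt_eqF// divr1 mulrCA -expRD.
  by congr (_ * expR _)%:E; field; rewrite gt_eqF.
rewrite (@ge0_integralZl _ _ _ mu _ measurableT (fun x => (normal_pdf 0 s x)%:E))//.
- by rewrite integral_normal_pdf mule1.
- by apply/measurable_EFinP; exact: measurable_normal_pdf.
- by move=> y _; rewrite lee_fin normal_pdf_ge0.
- by rewrite lee_fin ltW.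
Qed.

(** The exponential shifts the mean of the density to [a]. *)
Lemma integral_normal_expR (a : R) :
  (\int[normal_law 0 1]_z (expR (a * (z : R)))%:E = (expR (a ^+ 2 / 2))%:E)%E.
Proof.
rewrite ge0_integral_normal; first last.
- by move=> x; rewrite lee_fin expR_ge0.
- apply/measurable_EFinP; apply: measurableT_comp => //.
transitivity (\int[mu]_x ((expR (a ^+ 2 / 2))%:E * (normal_pdf a 1 x)%:E))%E.
  apply: eq_integral => x _; rewrite -!EFinM !normal_pdf_gt0E//.
  rewrite mulrCA [in RHS]mulrCA -!expRD.
  by congr (_ * expR _)%:E; field.
rewrite (@ge0_integralZl _ _ _ mu _ measurableT (fun x => (normal_pdf a 1 x)%:E))//.
- by rewrite integral_normal_pdf mule1.
- by apply/measurable_EFinP; exact: measurable_normal_pdf.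
- by move=> y _; rewrite lee_fin normal_pdf_ge0.
Qed.

End normal_density.

(** * Moments of the standard normal law *)

Section moments.
Context {R : realType}.
Notation N := (@normal_law R 0 1).

Lemma normal_integrable_le (f h : R -> R) : measurable_fun setT f ->
  (forall z, `|f z| <= h z) -> N.-integrable setT (EFin \o h) ->
  N.-integrable setT (EFin \o f).
Proof.
move=> mf fh ih; apply: (le_integrable _ _ _ ih) => //.
  exact/measurable_EFinP.
by move=> x _; rewrite /= lee_fin (le_trans (fh x))// ler_norm.
Qed.

Lemma normal_integrableD (f g : R -> R) : N.-integrable setT (EFin \o f) ->
  N.-integrable setT (EFin \o g) ->
  N.-integrable setT (EFin \o (fun z => f z + g z)).
Proof. by move=> fi gi; exact: (integrableD measurableT fi gi). Qed.

Lemma normal_integrableZ (c : R) (f : R -> R) : N.-integrable setT (EFin \o f) ->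
  N.-integrable setT (EFin \o (fun z => c * f z)).
Proof. by move=> fi; exact: (integrableZl measurableT c fi). Qed.

Lemma normal_integrable_cst (c : R) : N.-integrable setT (EFin \o cst c).
Proof. by apply: finite_measure_integrable_cst. Qed.

Lemma normal_integrable_expR_sqr (s : R) : 0 < s ->
  N.-integrable setT (EFin \o (fun z => expR ((1 - s ^- 2) / 2 * z ^+ 2))).
Proof.
move=> s0; apply/integrableP; split.
  apply/measurable_EFinP; apply: measurableT_comp => //.
  by apply: measurable_funM => //; exact: measurable_funX.
under eq_integral do rewrite /= ger0_norm ?expR_ge0//.
by rewrite integral_normal_expR_sqr// ltry.
Qed.

Lemma norm_pow3_le_expR (z : R) :
  1 + z ^+ 2 + `|z| ^+ 3 <= 80 * expR ((1 - Num.sqrt 2 ^- 2) / 2 * z ^+ 2).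
Proof.
rewrite sqr_sqrtr// (_ : (1 - 2^-1) / 2 * z ^+ 2 = z ^+ 2 / 8 + z ^+ 2 / 8); last by field.
rewrite expRD -expr2.
(* The exponent is [z^2/4]; the square of [1 + z^2/8] grows like [z^4/64], which
   dominates the left-hand side up to the factor 80. *)
have h : 1 + z ^+ 2 / 8 <= expR (z ^+ 2 / 8) by exact: expR_ge1Dx.
have z2 : 0 <= z ^+ 2 by exact: sqr_ge0.
have : (1 + z ^+ 2 / 8) ^+ 2 <= expR (z ^+ 2 / 8) ^+ 2.
  by rewrite ler_pXn2r// ?nnegrE ?expR_ge0// addr_ge0// divr_ge0.
rewrite -(real_normK (num_real z)); set y := `|z|.
have : 0 <= y by exact: normr_ge0.
nra.
Qed.

Lemma normal_integrable_poly :
  N.-integrable setT (EFin \o (fun z : R => 1 + z ^+ 2 + `|z| ^+ 3)).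
Proof.
have s2 : 0 < Num.sqrt 2 :> R by rewrite sqrtr_gt0.
have := integrableZl measurableT 80 (normal_integrable_expR_sqr s2).
move=> /(normal_integrable_le _ _); apply.
- apply: measurable_funD; first by apply: measurable_funD => //; exact: measurable_funX.
  by apply: measurable_funX; exact: normr_measurable.
- move=> z; rewrite ger0_norm ?norm_pow3_le_expR//.
  by rewrite !addr_ge0// ?sqr_ge0// exprn_ge0.
Qed.

Lemma normal_integrable_sqr : N.-integrable setT (EFin \o (fun z : R => z ^+ 2)).
Proof.
apply: normal_integrable_le normal_integrable_poly.
  exact: measurable_funX.
move=> z; rewrite ger0_norm ?sqr_ge0//.
by have := exprn_ge0 3 (normr_ge0 z); have := sqr_ge0 z; lra.
Qed.

Lemma normal_integrable_pow3 : N.-integrable setT (EFin \o (fun z : R => `|z| ^+ 3)).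
Proof.
apply: normal_integrable_le normal_integrable_poly.
  by apply: measurable_funX; exact: normr_measurable.
move=> z; rewrite ger0_norm ?exprn_ge0//.
by have := exprn_ge0 3 (normr_ge0 z); have := sqr_ge0 z; lra.
Qed.

Lemma normal_integrable_id : N.-integrable setT (EFin \o (fun z : R => z)).
Proof.
apply: normal_integrable_le normal_integrable_poly => // z.
have := exprn_ge0 3 (normr_ge0 z).
by rewrite -(real_normK (num_real z)); nra.
Qed.

Lemma normal_Rintegral_cst (c : R) : \int[N]_z c = c.
Proof.
have N1 : N setT = 1%E by exact: probability_setT.
transitivity (c * fine (N setT)); first exact: Rintegral_cst.
by rewrite N1 mulr1.
Qed.

(** As [1 + a z <= expR (a z)], the mean [m] satisfies [1 + a m <= expR (a^2/2)] for
    all [a]; this fails for small [a] with the sign of [m] if [m != 0]. *)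
Lemma normal_mean : \int[N]_z z = 0.
Proof.
set m := Rintegral _ _ _.
have key (a : R) : a ^+ 2 < 2 -> (1 + a * m) * (1 - a ^+ 2 / 2) <= 1.
  move=> a2.
  have i1 : N.-integrable setT (EFin \o (fun z : R => a * z)).
    by have := integrableZl measurableT a normal_integrable_id.
  have : 1 + a * m <= expR (a ^+ 2 / 2).
    rewrite -[leRHS]/(fine (expR (a ^+ 2 / 2))%:E) -integral_normal_expR.
    rewrite -[X in X + _](normal_Rintegral_cst 1).
    rewrite -RintegralZl//; last exact: normal_integrable_id.
    rewrite -RintegralD//; last exact: normal_integrable_cst.
    apply: le_Rintegral => //.
    - by apply: normal_integrableD => //; exact: normal_integrable_cst.
    - apply/integrableP; split.
        apply/measurable_EFinP; apply: measurableT_comp => //.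
      under eq_integral do rewrite /= ger0_norm ?expR_ge0//.
      by rewrite integral_normal_expR ltry.
    - by move=> z _; exact: expR_ge1Dx.
  have h : 1 - a ^+ 2 / 2 <= expR (- (a ^+ 2 / 2)) by exact: expR_ge1Dx.
  move=> h1; have h0 : 0 <= 1 - a ^+ 2 / 2 by lra.
  rewrite (le_trans (ler_wpM2r h0 h1))// (le_trans (ler_wpM2l (expR_ge0 _) h))//.
  by rewrite -expRD subrr expR0.
have k1 := key (Num.min (1/2) `|m| * Num.sg m).
apply/eqP; apply/negPn/negP => m0.
have sg2 : Num.sg m ^+ 2 = 1 by rewrite sqr_sg m0.
have mm : Num.sg m * m = `|m| by rewrite -normrEsg.
move: k1; rewrite exprMn sg2 mulr1 -mulrA mm.
have : 0 < `|m| by rewrite normr_gt0.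
move: (`|m|) => x x0; have [h|h] := leP (1 / 2) x => k.
  by have := k ltac:(lra); lra.
move: k; rewrite -expr2; have : 0 < x ^+ 2 by rewrite exprn_gt0.
have : x ^+ 2 < 1 by nra.
by move: (x ^+ 2) => u u1 u0 k; have := k ltac:(lra); nra.
Qed.

(** As [1 + c z^2 <= expR (c z^2)] with [c = (1 - s^-2)/2], whose mean is [s], the
    second moment [m] satisfies [1 + c m <= s] for all [s > 0]; to first order at
    [s = 1], from above and from below, this says [m = 1]. *)
Lemma normal_sqr : \int[N]_z z ^+ 2 = 1.
Proof.
set m := Rintegral _ _ _.
have m0 : 0 <= m by apply: Rintegral_ge0 => z _; exact: sqr_ge0.
have key (s : R) : 0 < s -> s ^+ 2 + (s ^+ 2 - 1) / 2 * m <= s ^+ 3.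
  move=> s0.
  have i1 := integrableZl measurableT ((1 - s ^- 2) / 2) normal_integrable_sqr.
  have : 1 + (1 - s ^- 2) / 2 * m <= s.
    rewrite -[leRHS]/(fine s%:E) -integral_normal_expR_sqr//.
    rewrite -[X in X + _](normal_Rintegral_cst 1).
    rewrite -RintegralZl//; last exact: normal_integrable_sqr.
    rewrite -RintegralD//; last exact: normal_integrable_cst.
    apply: le_Rintegral => //.
    - by apply: normal_integrableD => //; exact: normal_integrable_cst.
    - exact: normal_integrable_expR_sqr.
    - by move=> z _; exact: expR_ge1Dx.
  move=> /(ler_wpM2r (sqr_ge0 s)); rewrite -exprS.
  by congr (_ <= _); field; rewrite gt_eqF.
apply/eqP; rewrite eq_le; apply/andP; split; rewrite leNgt; apply/negP => m1.
- have [e [e0 e1 em]] : exists e, [/\ 0 < e, e <= 1 & e * 4 <= m - 1].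
    exists (Num.min 1 ((m - 1) / 4)); rewrite lt_min ge_min lexx/= ltr01/=; split=> //.
      lra.
    by rewrite -ler_pdivlMr// ge_min lexx orbT.
  have := key (1 + e) ltac:(lra); nra.
- have e0 : 0 < (1 - m) / 4 by lra.
  have := key (1 - (1 - m) / 4) ltac:(lra); move: e0.
  set e := (1 - m) / 4; have mE : m = 1 - 4 * e by rewrite /e; field.
  rewrite mE in m0 * => e0'.
  have : 0 < e * e * (5 / 2 - e) by rewrite !mulr_gt0//; lra.
  lra.
Qed.
End moments.

(** * Gaussian averages *)

(** The mean of [g] under the normal law with mean [x] and variance [v]; this form
    covers [v = 0]. *)
Definition gauss_avg {R : realType} (v : R) (g : R -> R) (x : R) : R :=
  \int[normal_law 0 1]_z g (x + Num.sqrt v * z).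

Section gauss_avg.
Context {R : realType}.
Notation N := (@normal_law R 0 1).
Implicit Types (g f : R -> R) (v x u M L : R).

Definition normal_abs3 : R := \int[N]_z (`|z| ^+ 3).

Lemma continuous_affine (g : R -> R) (x c : R) : continuous g ->
  continuous (fun z => g (x + c * z)).
Proof.
move=> cg z; apply: (@continuous_comp _ _ _ (fun z => x + c * z)); last exact: cg.
by apply: cvgD; [exact: cvg_cst|apply: cvgM; [exact: cvg_cst|exact: cvg_id]].
Qed.

Lemma normal_Rintegral_le (h : R -> R) (a b c : R) : measurable_fun setT h ->
  (forall z, `|h z| <= a + b * z ^+ 2 + c * `|z| ^+ 3) ->
  N.-integrable setT (EFin \o h) /\
  `|\int[N]_z h z| <= a + b + c * normal_abs3.
Proof.
move=> mh hle.
have i1 := normal_integrableD (normal_integrable_cst a)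
  (normal_integrableZ b normal_integrable_sqr).
have i2 := normal_integrableD i1 (normal_integrableZ c normal_integrable_pow3).
have ih := normal_integrable_le mh hle i2.
split => //; rewrite (le_trans (le_normr_Rintegral measurableT ih))//.
have <- : \int[N]_z (a + b * z ^+ 2 + c * `|z| ^+ 3) = a + b + c * normal_abs3.
  rewrite (RintegralD measurableT i1); last exact: normal_integrableZ normal_integrable_pow3.
  rewrite (RintegralZl _ measurableT normal_integrable_pow3).
  rewrite (RintegralD measurableT (normal_integrable_cst a)); last first.
    exact: normal_integrableZ normal_integrable_sqr.
  rewrite (RintegralZl _ measurableT normal_integrable_sqr).
  by rewrite normal_sqr mulr1 normal_Rintegral_cst.
apply: le_Rintegral => //.
by have := integrable_norm ih.
Qed.

Lemma integrable_gauss g M v x : continuous g -> (forall y, `|g y| <= M) ->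
  N.-integrable setT (EFin \o (fun z => g (x + Num.sqrt v * z))).
Proof.
move=> cg gM; have [||//] := @normal_Rintegral_le
  (fun z => g (x + Num.sqrt v * z)) M 0 0.
- by apply: continuous_measurable_fun; exact: continuous_affine.
- by move=> z; rewrite !mul0r !addr0.
Qed.

Lemma gauss_avg_le_poly f g M v x (a b c : R) : continuous f -> continuous g ->
  (forall y, `|f y| <= M) -> (forall y, `|g y| <= M) ->
  (forall z, `|f (x + Num.sqrt v * z) - g (x + Num.sqrt v * z)| <=
    a + b * z ^+ 2 + c * `|z| ^+ 3) ->
  `|gauss_avg v f x - gauss_avg v g x| <= a + b + c * normal_abs3.
Proof.
move=> cf cg fM gM fg.
have [||_] := @normal_Rintegral_le
  (fun z => f (x + Num.sqrt v * z) - g (x + Num.sqrt v * z)) a b c.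
- by apply: measurable_funB; apply: continuous_measurable_fun; exact: continuous_affine.
- exact: fg.
- by rewrite RintegralB//; exact: (integrable_gauss (M := M)).
Qed.

Lemma gauss_avg_dist f g M v x (d : R) : continuous f -> continuous g ->
  (forall y, `|f y| <= M) -> (forall y, `|g y| <= M) ->
  (forall y, `|f y - g y| <= d) ->
  `|gauss_avg v f x - gauss_avg v g x| <= d.
Proof.
move=> cf cg fM gM fg.
have := @gauss_avg_le_poly f g M v x d 0 0 cf cg fM gM.
by rewrite mul0r !addr0; apply => z; rewrite !mul0r !addr0.
Qed.

Lemma gauss_avg_sqr f g M v (e : R) : 0 <= v -> continuous f -> continuous g ->
  (forall y, `|f y| <= M) -> (forall y, `|g y| <= M) ->
  (forall y, `|f y - g y| <= e * (1 + y ^+ 2)) ->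
  `|gauss_avg v f 0 - gauss_avg v g 0| <= e * (1 + v).
Proof.
move=> v0 cf cg fM gM fg.
have := @gauss_avg_le_poly f g M v 0 e (e * v) 0 cf cg fM gM.
rewrite mul0r !addr0 mulrDr mulr1; apply => z.
rewrite mul0r addr0 add0r (le_trans (fg _))//.
by rewrite exprMn sqr_sqrtr// mulrDr mulr1 mulrA.
Qed.

Lemma gauss_avg_ub g M v x : continuous g -> (forall y, `|g y| <= M) ->
  `|gauss_avg v g x| <= M.
Proof.
move=> cg gM; have [||_] := @normal_Rintegral_le
  (fun z => g (x + Num.sqrt v * z)) M 0 0.
- by apply: continuous_measurable_fun; exact: continuous_affine.
- by move=> z; rewrite !mul0r !addr0.
- by rewrite mul0r !addr0.
Qed.

(** Normal laws with different variances are coupled through the same standard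
    normal variable, and its absolute mean is at most 1. *)
Lemma gauss_avg_lip g M L v v' x x' : continuous g -> (forall y, `|g y| <= M) ->
  (forall y y', `|g y - g y'| <= L * `|y - y'|) ->
  `|gauss_avg v g x - gauss_avg v' g x'| <=
    L * (`|x - x'| + `|Num.sqrt v - Num.sqrt v'|).
Proof.
move=> cg gM gL.
have L0 : 0 <= L.
  by have := le_trans (normr_ge0 _) (gL 1 0); rewrite subr0 normr1 mulr1.
rewrite /gauss_avg -RintegralB//; [|exact: (integrable_gauss (M := M))..].
have [||_] := @normal_Rintegral_le (fun z =>
    g (x + Num.sqrt v * z) - g (x' + Num.sqrt v' * z))
  (L * (`|x - x'| + `|Num.sqrt v - Num.sqrt v'| / 2))
  (L * (`|Num.sqrt v - Num.sqrt v'| / 2)) 0.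
- by apply: measurable_funB; apply: continuous_measurable_fun; exact: continuous_affine.
- move=> z; rewrite mul0r addr0 (le_trans (gL _ _))// -mulrA -mulrDr ler_wpM2l//.
  have -> : x + Num.sqrt v * z - (x' + Num.sqrt v' * z) =
    (x - x') + (Num.sqrt v - Num.sqrt v') * z by ring.
  rewrite (le_trans (ler_normD _ _))// -addrA lerD2l normrM.
  rewrite -[in leRHS]mulrA -mulrDr ler_wpM2l//.
  by rewrite -(real_normK (num_real z)); have := sqr_ge0 (`|z| - 1); lra.
- by move/le_trans; apply; rewrite mul0r addr0 -mulrDr ler_wpM2l//; lra.
Qed.

(** Integrate the Taylor expansion: the first moment vanishes, the second is [v]. *)
Lemma gauss_avg_taylor g M (g1 g2 : R) L v x : 0 <= v -> continuous g ->
  (forall y, `|g y| <= M) ->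
  (forall y, `|g (x + y) - g x - g1 * y - g2 * y ^+ 2 / 2| <= L * `|y| ^+ 3) ->
  `|gauss_avg v g x - g x - g2 * v / 2| <= L * (Num.sqrt v ^+ 3 * normal_abs3).
Proof.
move=> v0 cg gM gT.
have ig := integrable_gauss v x cg gM.
pose T1 (z : R) := g x + g1 * Num.sqrt v * z.
pose T2 (z : R) := T1 z + g2 * v / 2 * z ^+ 2.
have i0 := normal_integrableZ (g1 * Num.sqrt v) normal_integrable_id.
have i1 : N.-integrable setT (EFin \o T1).
  exact: (normal_integrableD (normal_integrable_cst _) i0).
have is2 := normal_integrableZ (g2 * v / 2) normal_integrable_sqr.
have i2 : N.-integrable setT (EFin \o T2) by exact: normal_integrableD.
have I2 : \int[N]_z T2 z = g x + g2 * v / 2.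
  rewrite RintegralD// RintegralZl//; last exact: normal_integrable_sqr.
  rewrite RintegralD//; last exact: normal_integrable_cst.
  rewrite RintegralZl//; last exact: normal_integrable_id.
  by rewrite normal_Rintegral_cst normal_mean normal_sqr mulr0 addr0 mulr1.
rewrite -addrA -opprD -I2 /gauss_avg -RintegralB//.
have [||_] := @normal_Rintegral_le (fun z => g (x + Num.sqrt v * z) - T2 z) 0 0
  (L * Num.sqrt v ^+ 3).
- apply: measurable_funB; first by apply: continuous_measurable_fun; exact: continuous_affine.
  by have /measurable_int /measurable_EFinP := i2.
- move=> z; rewrite mul0r !add0r -mulrA.
  rewrite (_ : g (x + Num.sqrt v * z) - T2 z = g (x + Num.sqrt v * z) - g x -
    g1 * (Num.sqrt v * z) - g2 * (Num.sqrt v * z) ^+ 2 / 2).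
    by rewrite (le_trans (gT _))// normrM (ger0_norm (sqrtr_ge0 v)) exprMn.
  by rewrite /T2 /T1 exprMn sqr_sqrtr//; field.
- by rewrite !add0r -[in X in X -> _]mulrA.
Qed.

Lemma gauss_avg0 g x : gauss_avg 0 g x = g x.
Proof.
rewrite /gauss_avg sqrtr0; under eq_Rintegral do rewrite mul0r addr0.
exact: normal_Rintegral_cst.
Qed.

Lemma EFin_gauss_avg g M v x : continuous g -> (forall y, `|g y| <= M) ->
  (gauss_avg v g x)%:E = (\int[N]_z (g (x + Num.sqrt v * z))%:E)%E.
Proof.
move=> cg gM; rewrite /gauss_avg /Rintegral fineK//.
by apply: integrable_fin_num => //; exact: (integrable_gauss _ _ cg gM).
Qed.

Lemma lipschitz_continuous_fun g (L : R) :
  (forall y y', `|g y - g y'| <= L * `|y - y'|) -> continuous g.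
Proof.
move=> gL x; apply/cvgrPdist_le => /= e e0.
have L0 : 0 <= L.
  by have := le_trans (normr_ge0 _) (gL 1 0); rewrite subr0 normr1 mulr1.
near=> y; rewrite (le_trans (gL _ _))//.
rewrite (@le_trans _ _ ((L + 1) * `|x - y|))//; first by rewrite ler_wpM2r// lerDl.
rewrite -ler_pdivlMl ?ltr_wpDl//; near: y.
apply/nbhs_ballP; exists ((L + 1)^-1 * e) => [|y]; last by rewrite /ball/= => /ltW.
by rewrite /= mulr_gt0// invr_gt0 ltr_wpDl.
Unshelve. all: by end_near. Qed.

Lemma continuous_gauss_avg g M L v : continuous g -> (forall y, `|g y| <= M) ->
  (forall y y', `|g y - g y'| <= L * `|y - y'|) -> continuous (gauss_avg v g).
Proof.
move=> cg gM gL; apply: (@lipschitz_continuous_fun _ L) => y y'.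
by rewrite (le_trans (gauss_avg_lip v v y y' cg gM gL))// subrr normr0 addr0.
Qed.

Lemma gauss_avgD_cst g M v x (c : R) : continuous g -> (forall y, `|g y| <= M) ->
  gauss_avg v (fun y => g y + c) x = gauss_avg v g x + c.
Proof.
move=> cg gM; rewrite /gauss_avg RintegralD//.
- by rewrite normal_Rintegral_cst.
- exact: (integrable_gauss _ _ cg gM).
- exact: normal_integrable_cst.
Qed.

(** Sums of independent centered normal variables: variances add. *)
Lemma gauss_avg_semigroup g M L u v x : 0 <= u -> 0 <= v -> continuous g ->
  (forall y, `|g y| <= M) ->
  (forall y y', `|g y - g y'| <= L * `|y - y'|) ->
  gauss_avg u (gauss_avg v g) x = gauss_avg (u + v) g x.
Proof.
rewrite le_eqVlt => /predU1P[<- _ cg gM gL|u0]; first by rewrite gauss_avg0 add0r.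
rewrite le_eqVlt => /predU1P[<-|v0] cg gM gL.
  by rewrite addr0; congr gauss_avg; apply/funext => y; rewrite gauss_avg0.
(* The addition of [M] makes the function nonnegative, as Tonelli's theorem
   requires. *)
pose h y := g y + M.
have ch : continuous h by move=> y; apply: cvgD; [exact: cg|exact: cvg_cst].
have h0 y : 0 <= h y by have := gM y; rewrite ler_norml /h => /andP[]; lra.
have hM y : `|h y| <= M + M.
  by rewrite (le_trans (ler_normD _ _))// lerD// ger0_norm// (le_trans _ (gM 0)).
have M0 : forall y, `|gauss_avg v g y| <= M by move=> y; exact: gauss_avg_ub.
have cG : continuous (gauss_avg v g) by exact: continuous_gauss_avg cg gM gL.
apply: (addIr M); rewrite -(gauss_avgD_cst _ _ _ cG M0) -(gauss_avgD_cst _ _ _ cg gM).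
have -> : (fun y => gauss_avg v g y + M) = gauss_avg v h.
  by apply/funext => y; rewrite -(gauss_avgD_cst _ _ _ cg gM).
have gvh y : `|gauss_avg v h y| <= M + M by exact: gauss_avg_ub.
have hL y y' : `|h y - h y'| <= L * `|y - y'|.
  by rewrite /h opprD addrACA subrr addr0 gL.
apply/EFin_inj; rewrite (EFin_gauss_avg _ _ (continuous_gauss_avg ch hM hL) gvh).
rewrite (EFin_gauss_avg _ _ ch hM).
under eq_integral do rewrite (EFin_gauss_avg _ _ ch hM).
rewrite -(@integral_normal_conv _ (Num.sqrt u) (Num.sqrt v) (Num.sqrt (u + v)) (fun w => h (x + w))) ?sqrtr_gt0 ?addr_gt0//.
- by apply: eq_integral => y _; apply: eq_integral => z _; rewrite addrA.
- by rewrite !sqr_sqrtr ?addr_ge0// ltW.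
- by move=> y; apply: (@continuous_comp _ _ _ (fun z => x + z)); [apply: cvgD; [exact: cvg_cst|exact: cvg_id]|exact: ch].
Qed.

(** Independence of a normal variable and a random shape: the order in which their
    effects on [g] are averaged does not matter. *)
Lemma gauss_avg_avg n (w : bshape -> R) g M v x : continuous g ->
  (forall y, `|g y| <= M) ->
  avg n (fun t => gauss_avg v g (x + w t)) =
  gauss_avg v (fun y => avg n (fun t => g (y + w t))) x.
Proof.
move=> cg gM; rewrite avg.unlock /gauss_avg.
have shiftE t : gauss_avg v g (x + w t) =
    \int[N]_z g (x + Num.sqrt v * z + w t).
  by apply: eq_Rintegral => z _; rewrite addrAC.
have ig t : N.-integrable setT
    (EFin \o (fun z => g (x + Num.sqrt v * z + w t))).
  have := integrable_gauss v (x + w t) cg gM.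
  by under eq_fun do rewrite addrAC.
pose S s (z : R) := \sum_(t <- s) g (x + Num.sqrt v * z + w t).
have S0 : S [::] = cst 0 by apply/funext => z; rewrite /S big_nil.
have SC t s : S (t :: s) = (fun z => g (x + Num.sqrt v * z + w t) + S s z).
  by apply/funext => z; rewrite /S big_cons.
have [isum sumE] : N.-integrable setT (EFin \o S (grown n)) /\
    \int[N]_z S (grown n) z = \sum_(t <- grown n) gauss_avg v g (x + w t).
  elim: (grown n) => [|t s [isum sE]].
    rewrite S0 big_nil; split; first exact: normal_integrable_cst.
    exact: normal_Rintegral_cst.
  rewrite SC big_cons -sE shiftE -RintegralD//; split=> //.
  exact: normal_integrableD.
by rewrite RintegralZl// sumE.
Qed.

End gauss_avg.

(** Scaling of the standard normal law, where [f + M] replaces [f] because the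
    scaling is stated for nonnegative functions. *)
Lemma integral_centered_normal (R : realType) (v M : R) (f : R -> R) : 0 <= v ->
  continuous f -> (forall x, `|f x| <= M) ->
  (\int[centered_normal v]_x (f x)%:E = (gauss_avg v f 0)%:E)%E.
Proof.
move=> v0 cf fM; rewrite /centered_normal; case: eqVneq => [->|vn0].
  rewrite gauss_avg0 integral_dirac ?diracT ?mul1e//.
  by apply/measurable_EFinP; exact: continuous_measurable_fun.
have s0 : 0 < Num.sqrt v by rewrite sqrtr_gt0 lt_neqAle eq_sym vn0.
pose h y := f y + M.
have ch : continuous h by move=> y; apply: cvgD; [exact: cf|exact: cvg_cst].
have h0 y : 0 <= h y by have := fM y; rewrite ler_norml /h => /andP[]; lra.
have hM y : `|h y| <= M + M.
  by rewrite (le_trans (ler_normD _ _))// lerD// ger0_norm// (le_trans _ (fM 0)).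
have ib (u : R -> R) (K : R) : continuous u -> (forall x, `|u x| <= K) ->
    (normal_law 0 (Num.sqrt v)).-integrable setT (EFin \o u).
  move=> cu uK; apply: measurable_bounded_integrable => //.
  - by rewrite (le_lt_trans (probability_le1 _ _))// ltry.
  - exact: continuous_measurable_fun.
  - exists K; split; rewrite ?num_real// => x Kx y _ /=.
    by rewrite (le_trans (uK _))// ltW.
have -> : (\int[normal_law 0 (Num.sqrt v)]_x (f x)%:E =
    \int[normal_law 0 (Num.sqrt v)]_x ((h x)%:E - M%:E))%E.
  by apply: eq_integral => x _; rewrite /h -EFinB addrK.
rewrite integralB//; last 2 first.
- exact: ib ch hM.
- by apply: (ib (cst M) `|M|) => // x; exact: cvg_cst.
have -> : (\int[normal_law 0 (Num.sqrt v)]_x M%:E = M%:E)%E.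
  have N1 : normal_law 0 (Num.sqrt v) setT = 1%E by exact: probability_setT.
  transitivity (M%:E * normal_law 0 (Num.sqrt v) setT)%E; last by rewrite N1 mule1.
  exact: integral_cst.
rewrite (integral_normal_scale s0 ch h0).
have -> : (\int[normal_law 0 1]_x (h (Num.sqrt v * x))%:E = (gauss_avg v h 0)%:E)%E.
  by rewrite (EFin_gauss_avg _ _ ch hM); apply: eq_integral => x _; rewrite add0r.
by rewrite (gauss_avgD_cst _ _ _ cf fM) -EFinB addrK.
Qed.

(** * Smoothing of continuous functions *)

Section smoothing.
Context {R : realType}.
Notation mu := (@lebesgue_measure R).
Implicit Types (u f g : R -> R).

Lemma derive_continuous u (u' : R -> R) :
  (forall x : R, is_derive x 1 u (u' x)) -> continuous u.
Proof.
move=> du x; apply: differentiable_continuous; apply/derivable1_diffP.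
by have [] := du x.
Qed.

Lemma MVT_le u (u' : R -> R) (B x y : R) :
  (forall x : R, is_derive x 1 u (u' x)) ->
  (forall z, `|z - x| <= `|y - x| -> `|u' z| <= B) ->
  `|u y - u x| <= B * `|y - x|.
Proof.
move=> du u'B.
have cu := derive_continuous du.
have [xy|yx|->] := ltgtP x y; last by rewrite !subrr normr0 mulr0.
- have [c cxy ->] := MVT xy (fun z _ => du z) (continuous_subspaceT cu).
  rewrite normrM ler_wpM2r// u'B//; move: cxy; rewrite in_itv/= => /andP[xc cy].
  by rewrite !ger0_norm ?subr_ge0 ?lerD2r// ltW.
- have [c cxy e] := MVT yx (fun z _ => du z) (continuous_subspaceT cu).
  rewrite distrC e normrM [`|y - x|]distrC ler_wpM2r// u'B//.
  move: cxy; rewrite in_itv/= => /andP[xc cy].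
  by rewrite [`|c - x|]distrC [`|y - x|]distrC !ger0_norm ?subr_ge0 ?lerD2l ?lerN2// ltW.
Qed.

Lemma antiderivative f : continuous f ->
  exists F : R -> R, forall x : R, is_derive x 1 F (f x).
Proof.
move=> cf; pose G (a x : R) := \int[mu]_(t in [set` `[a, x]]) f t.
have intf (a b : R) : mu.-integrable `[a, b] (EFin \o f).
  apply: continuous_compact_integrable; first exact: segment_compact.
  exact: continuous_subspaceT.
have dG a x : a < x -> is_derive (x : R) 1 (G a) (f x).
  move=> ax; have xx1 : x < x + 1 by rewrite ltrDl.
  have [d e] := continuous_FTC1_closed xx1 (intf a (x + 1)) ax (cf x).
  by apply: DeriveDef; [exact: d|rewrite -derive1E; exact: e].
have GB a b x : a <= x -> x <= b ->
    G a b - G a x = \int[mu]_(t in [set` `]x, b]]) f t.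
  by move=> ax xb; apply: Rintegral_itvB; rewrite ?bnd_simp.
have GG a b x : a <= b -> b <= x -> b <= 0 -> G a x - G a 0 = G b x - G b 0.
  move=> ab bx b0.
  have : G a x - G a b = G b x - G b b by rewrite !GB.
  have : G a 0 - G a b = G b 0 - G b b by rewrite !GB.
  lra.
(* Integrals start at a point left of both [x] and 0; by [GG] this point does
   not matter, so it can be held fixed near [x]. *)
pose F x := G (- (`|x| + 1)) x - G (- (`|x| + 1)) 0.
exists F => x; set a := - (`|x| + 2).
have ax : a < x by have := ler_norm (- x); rewrite normrN /a; lra.
apply: (@near_eq_is_derive _ _ _ (fun y => G a y - G a 0)).
- near=> y; have yx : `|x - y| < 1.
    by near: y; apply/nbhs_ballP; exists 1 => //= y.
  have yx2 : `|y| <= `|x| + 1.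
    rewrite -[y](subrK x) addrC (le_trans (ler_normD _ _))// lerD2l.
    by rewrite distrC ltW.
  rewrite /F (GG a (- (`|y| + 1)))//.
  + by rewrite /a lerN2; lra.
  + by have := ler_norm (- y); rewrite normrN; lra.
- by have := dG _ _ ax => dGx; apply: is_derive_eq; rewrite subr0.
Unshelve. all: by end_near. Qed.

Section difference.
Variables (d : R) (d0 : 0 < d).

Definition diffq u (x : R) := (u (x + d) - u x) / d.

Lemma diffq_le u (M x : R) : (forall y, `|u y| <= M) -> `|diffq u x| <= 2 * M / d.
Proof.
move=> uM; rewrite normrM normfV (gtr0_norm d0) ler_wpM2r ?invr_ge0 ?(ltW d0)//.
by rewrite (le_trans (ler_normB _ _))// mulr_natl mulr2n lerD.
Qed.

Lemma is_derive_shift u (u' : R -> R) (a x : R) :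
  (forall x : R, is_derive x 1 u (u' x)) ->
  is_derive x 1 (fun y => u (y + a)) (u' (x + a)).
Proof.
move=> du.
have h1 : is_derive x 1 (fun y : R => y + a) (1 : R).
  by apply: is_derive_eq; rewrite addr0.
by have := @is_derive1_comp _ u (fun y => y + a) x _ _ (du (x + a)) h1; rewrite mulr1.
Qed.

Lemma is_derive_diffq u (u' : R -> R) : (forall x : R, is_derive x 1 u (u' x)) ->
  forall x : R, is_derive x 1 (diffq u) (diffq u' x).
Proof.
move=> du x; have h1 := is_derive_shift d x du.
have h2 := du x.
have : is_derive x 1 (fun y => (u (y + d) - u y) * d^-1) ((u' (x + d) - u' x) * d^-1).
  apply: is_derive_eq.
  by rewrite scaler0 add0r /GRing.scale/= mulrC.
by [].
Qed.

(** The mean of [u] over the window from [x] to [x + d], a difference quotient of an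
    antiderivative, has one derivative more than [u], and its values are values
    of [u] nearby. *)
Lemma smoothing_step u : continuous u -> exists su : R -> R,
  (forall x : R, is_derive x 1 su (diffq u x)) /\
  (forall x, exists2 y, x <= y <= x + d & su x = u y).
Proof.
move=> cu; have [F dF] := antiderivative cu.
exists (diffq F); split; first exact: is_derive_diffq.
move=> x; have xd : x < x + d by rewrite ltrDl.
have [c cxy e] := MVT xd (fun z _ => dF z) (continuous_subspaceT (derive_continuous dF)).
exists c; first by move: cxy; rewrite in_itv/= => /andP[/ltW-> /ltW->].
by rewrite /diffq e addrAC subrr add0r mulfK// gt_eqF.
Qed.

End difference.
End smoothing.

(** * Test functions with a Taylor expansion *)

Section testfun.
Context {R : realType}.
Implicit Types (f g : R -> R).

(** The bounds that the comparison with normal laws needs of a test function that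
    varies at scale [1/a]; [g1] and [g2] are its first two derivatives. *)
Record taylor_fun (M a : R) (g g1 g2 : R -> R) : Prop := TaylorFun {
  taylor_ub : forall x, `|g x| <= M;
  taylor_lip : forall x y, `|g x - g y| <= M * a * `|x - y|;
  taylor_ub2 : forall x, `|g2 x| <= M * a ^+ 2;
  taylor_lip1 : forall x y, `|g1 x - g1 y| <= M * a ^+ 2 * `|x - y|;
  taylor_order1 : forall x y, `|g (x + y) - g x - g1 x * y| <= M * a ^+ 2 * y ^+ 2;
  taylor_order2 : forall x y,
    `|g (x + y) - g x - g1 x * y - g2 x * y ^+ 2 / 2| <= M * a ^+ 3 * `|y| ^+ 3 }.

Lemma taylor_continuous M a g g1 g2 : taylor_fun M a g g1 g2 -> continuous g.
Proof. by move=> h; exact: lipschitz_continuous_fun (taylor_lip h). Qed.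

Lemma taylor_scale M (a : R) g g1 g2 : 0 <= a -> taylor_fun M 1 g g1 g2 ->
  taylor_fun M a (fun x => g (a * x)) (fun x => a * g1 (a * x))
    (fun x => a ^+ 2 * g2 (a * x)).
Proof.
move=> a0 h; split.
- by move=> x; exact: taylor_ub h _.
- move=> x y; rewrite (le_trans (taylor_lip h _ _))// -mulrBr normrM mulr1.
  by rewrite (ger0_norm a0) mulrA.
- move=> x; rewrite normrM ger0_norm ?exprn_ge0// mulrC ler_wpM2r ?exprn_ge0//.
  by have := taylor_ub2 h (a * x); rewrite expr1n mulr1.
- move=> x y; rewrite -mulrBr normrM (ger0_norm a0).
  have := taylor_lip1 h (a * x) (a * y); rewrite expr1n mulr1 -mulrBr normrM (ger0_norm a0).
  by move=> /(ler_wpM2l a0)/le_trans; apply; rewrite le_eqVlt; apply/orP; left; apply/eqP; ring.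
- move=> x y; rewrite (_ : M * a ^+ 2 * y ^+ 2 = M * 1 ^+ 2 * (a * y) ^+ 2); last by ring.
  rewrite (_ : a * g1 (a * x) * y = g1 (a * x) * (a * y)); last by ring.
  by rewrite mulrDr; exact: taylor_order1 h _ _.
- move=> x y; rewrite (_ : M * a ^+ 3 * `|y| ^+ 3 = M * 1 ^+ 3 * `|a * y| ^+ 3); last first.
    by rewrite normrM (ger0_norm a0); ring.
  rewrite (_ : a * g1 (a * x) * y = g1 (a * x) * (a * y)); last by ring.
  rewrite (_ : a ^+ 2 * g2 (a * x) * y ^+ 2 = g2 (a * x) * (a * y) ^+ 2); last by ring.
  by rewrite mulrDr; exact: taylor_order2 h _ _.
Qed.

Lemma is_derive_quad (c d z : R) :
  is_derive z 1 (fun y : R => c * y + d / 2 * y ^+ 2) (c + d * z).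
Proof. by apply: is_derive_eq; rewrite /GRing.scale/=; field. Qed.

(** The mean value inequality for [u] minus a quadratic polynomial. *)
Lemma MVT_quad (u u' : R -> R) (x c d B y : R) :
  (forall x : R, is_derive x 1 u (u' x)) ->
  (forall z, `|z| <= `|y| -> `|u' (x + z) - (c + d * z)| <= B) ->
  `|u (x + y) - u x - (c * y + d / 2 * y ^+ 2)| <= B * `|y|.
Proof.
move=> du uB; pose K z := u (x + z) - (c * z + d / 2 * z ^+ 2).
have dK (z : R) : is_derive z 1 K (u' (x + z) - (c + d * z)).
  apply: is_deriveB; last exact: is_derive_quad.
  have := is_derive_shift x z du; rewrite [z + x]addrC.
  by congr (is_derive _ _ _ _); apply/funext => w; rewrite addrC.
have := @MVT_le _ K _ B 0 y dK.
rewrite /K !subr0 addr0 expr0n/= !mulr0 addr0 subr0 addrAC; apply => z.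
by rewrite subr0; exact: uB.
Qed.

Lemma taylor_funI (M : R) (g g1 g2 g3 : R -> R) :
  (forall x : R, is_derive x 1 g (g1 x)) ->
  (forall x : R, is_derive x 1 g1 (g2 x)) ->
  (forall x : R, is_derive x 1 g2 (g3 x)) ->
  (forall x, `|g x| <= M) -> (forall x, `|g1 x| <= M) ->
  (forall x, `|g2 x| <= M) -> (forall x, `|g3 x| <= M) ->
  taylor_fun M 1 g g1 g2.
Proof.
move=> d0 d1 d2 gM g1M g2M g3M.
have l1 x y : `|g1 x - g1 y| <= M * `|x - y| by exact: MVT_le d1 _.
have l2 x y : `|g2 x - g2 y| <= M * `|x - y| by exact: MVT_le d2 _.
have M0 : 0 <= M by exact: le_trans (gM 0).
have o1 (u u' : R -> R) (x y : R) : (forall x : R, is_derive x 1 u (u' x)) ->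
    (forall x y, `|u' x - u' y| <= M * `|x - y|) ->
    `|u (x + y) - u x - u' x * y| <= M * y ^+ 2.
  move=> du lu; have := @MVT_quad u u' x (u' x) 0 (M * `|y|) y du.
  rewrite -[M * `|y| * _]mulrA -expr2 real_normK ?num_real// !mul0r addr0; apply => z zy.
  by rewrite mul0r addr0 (le_trans (lu _ _))// addrAC subrr add0r ler_wpM2l.
split; rewrite ?expr1n ?mulr1//.
- by move=> x y; exact: MVT_le d0 _.
- by move=> x y; exact: o1.
- move=> x y; have := @MVT_quad g g1 x (g1 x) (g2 x) (M * `|y| ^+ 2) y d0.
  rewrite -[M * _ * _]mulrA -exprSr opprD addrA [g2 x / 2 * _]mulrAC; apply => z zy.
  rewrite opprD addrA (le_trans (o1 _ _ _ _ d1 l2))//.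
  by rewrite ler_wpM2l// -(real_normK (num_real z)) ler_pXn2r// ?nnegrE.
Qed.

(** Only one of the two points is confined to the interval, as averages over windows
    near its ends require. *)
Lemma segment_uniform_continuity f (A e : R) : continuous f -> 0 < e ->
  exists2 d, 0 < d & forall x y, `|x| <= A -> `|y - x| <= d -> `|f x - f y| <= e.
Proof.
move=> cf e0.
have /compact_near_coveringP cpt : compact `[- A, A] by exact: segment_compact.
pose P (d : R) x := forall y, `|y - x| <= d -> `|f x - f y| <= e.
have [|d] := cpt R (0 : R)^'+ P _.
  move=> x _.
  have : \forall y \near x, `|f x - f y| <= e / 2.
    by have /cvgrPdist_le := cf x; apply; rewrite divr_gt0.
  move=> /nbhs_ballP[r /= r0 hr].
  exists (ball x (r / 2), [set d | d < r / 2]) => /=.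
    split; first by apply: nbhsx_ballx; rewrite divr_gt0.
    by apply: nbhs_right_lt; rewrite divr_gt0.
  move=> [x' d] /= [xx' dr] y yx'.
  rewrite -(subrK (f x) (f x')) -addrA (le_trans (ler_normD _ _))//.
  rewrite [e]splitr lerD//.
    rewrite distrC hr//; rewrite /ball/= in xx' *.
    by rewrite (lt_trans xx')// ltr_pdivrMr// ltr_pMr// ltr1n.
  apply: hr; rewrite /ball/= -(subrK x' x) -addrA (le_lt_trans (ler_normD _ _))//.
  rewrite [r]splitr ltrD//.
  by rewrite distrC (le_lt_trans yx').
move=> /= d0 dP; exists (d / 2); first by rewrite divr_gt0.
move=> x y xA; apply: dP; rewrite /= ?divr_gt0//.
  by rewrite sub0r normrN gtr0_norm ?divr_gt0// ltr_pdivrMr// ltr_pMr// ltr1n.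
by rewrite in_itv/= -ler_norml.
Qed.

(** Averaging three times over short windows gives three bounded derivatives. On
    [[-A, A]] the error is small by uniform continuity; outside, the trivial
    error [2 M] is below [e x^2]. *)
Lemma taylor_approx f (M e : R) : continuous f -> (forall x, `|f x| <= M) -> 0 < e ->
  exists M' g g1 g2, [/\ taylor_fun M' 1 g g1 g2, forall x, `|g x| <= M &
    forall x, `|f x - g x| <= e * (1 + x ^+ 2)].
Proof.
move=> cf fM e0.
have M0 : 0 <= M by exact: le_trans (fM 0).
pose A := 1 + 2 * M / e.
have A1 : 1 <= A by rewrite lerDl divr_ge0 ?(ltW e0)// mulr_ge0.
have [d d0 unif] := segment_uniform_continuity A cf e0.
have d30 : 0 < d / 3 by rewrite divr_gt0.
have [s1 [ds1 vs1]] := smoothing_step d30 cf.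
have cs1 := derive_continuous ds1.
have [s2 [ds2 vs2]] := smoothing_step d30 cs1.
have cs2 := derive_continuous ds2.
have [s3 [ds3 vs3]] := smoothing_step d30 cs2.
have val3 x : exists2 y, `|y - x| <= d & s3 x = f y.
  have [y3 /andP[a3 b3] ->] := vs3 x; have [y2 /andP[a2 b2] ->] := vs2 y3.
  have [y1 /andP[a1 b1] ->] := vs1 y2; exists y1 => //.
  by rewrite ger0_norm; lra.
pose D := @diffq R (d / 3).
(* A difference quotient over [d / 3] of a function bounded by [K] is bounded by
   [K c]. *)
pose c := 2 / (d / 3).
have c0 : 0 < c by rewrite divr_gt0.
have DM u K x : (forall y, `|u y| <= K) -> `|D u x| <= K * c.
  by move=> uK; rewrite mulrCA mulrA; exact: diffq_le.
have fD := fun x => DM f M x fM.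
have fDD := fun x => DM _ _ x fD.
have fDDD := fun x => DM _ _ x fDD.
have s3M x : `|s3 x| <= M by have [y _ ->] := val3 x.
have s2M x : `|s2 x| <= M.
  by have [y _ ->] := vs2 x; have [z _ ->] := vs1 y.
pose M' := M + M * c + M * c * c + M * c * c * c.
have M1 : 0 <= M * c by exact: mulr_ge0 M0 (ltW c0).
have M2 : 0 <= M * c * c by exact: mulr_ge0 M1 (ltW c0).
have M3 : 0 <= M * c * c * c by exact: mulr_ge0 M2 (ltW c0).
exists M', s3, (D s2), (D (D s1)); split => //.
  have dd1 : forall x : R, is_derive x 1 (D s2) (D (D s1) x).
    exact: is_derive_diffq ds2.
  have dd2 : forall x : R, is_derive x 1 (D (D s1)) (D (D (D f)) x).
    exact: is_derive_diffq (is_derive_diffq (d / 3) ds1).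
  apply: (taylor_funI ds3 dd1 dd2).
  - by move=> x; rewrite (le_trans (s3M x))// /M'; lra.
  - by move=> x; rewrite (le_trans (DM _ _ _ s2M))// /M'; lra.
  - move=> x; rewrite (le_trans (DM (D s1) (M * c) _ _))//; last by rewrite /M'; lra.
    by move=> y; apply: DM => z; have [w _ ->] := vs1 z.
  - by move=> x; rewrite (le_trans (fDDD x))// /M'; lra.
move=> x; have [y yx ->] := val3 x.
have x2 := sqr_ge0 x.
have [xA|/ltW Ax] := leP `|x| A.
  rewrite (le_trans (unif _ _ xA yx))// ler_pMr//; lra.
rewrite (le_trans (ler_normB _ _))// (le_trans (lerD (fM _) (fM _)))//.
have h : 2 * M <= e * A.
  have -> : e * A = e + 2 * M by rewrite /A; field; rewrite gt_eqF.
  by rewrite lerDr ltW.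
have : A <= x ^+ 2 by rewrite -(real_normK (num_real x)); nra.
nra.
Qed.
End testfun.

(** * Distance to the normal law *)

Section lindeberg.
Context {R : realType} (f : bshape -> R) (B : R).
Hypothesis fB : forall t, `|f t| <= B.
Variables (s2 C : R).
Hypothesis s20 : 0 <= s2.
Hypothesis varC : forall n,
  `|avg n (fun t => centered f t ^+ 2) - n.+1%:R * s2| <= C * Num.sqrt n.+1%:R.

Let W := centered f.
Let H := 10 * B + 1.
Let B0 : 0 <= B. Proof. exact: le_trans (fB Tip). Qed.
Let H1 : 1 <= H. Proof. by rewrite /H; have := B0; lra. Qed.
Let C0 : 0 <= C.
Proof. by have := le_trans (normr_ge0 _) (varC 0); rewrite sqrtr1 mulr1. Qed.

(* Third moments, which enter with [a ^ 3]: finite for each size, and used for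
   the finitely many sizes up to [K] only. *)
Let base_cst k := avg k (fun t => `|W t| ^+ 3) +
  Num.sqrt (k.+1%:R * s2) ^+ 3 * @normal_abs3 R.

Section testfun.
Variables (M a : R) (g g1 g2 : R -> R).
Hypothesis gt : taylor_fun M a g g1 g2.
Hypothesis a0 : 0 <= a.

Let M0 : 0 <= M. Proof. exact: le_trans (taylor_ub gt 0). Qed.
Let cg : continuous g. Proof. exact: taylor_continuous gt. Qed.
Let Ma2 : 0 <= M * a ^+ 2. Proof. by rewrite mulr_ge0// sqr_ge0. Qed.

(** The first-order effect of the innovation at the fixed point [x] is zero in the
    mean. What remains is of second order: its square, and its product with the
    sum over the subtrees, of order [sqrt n]. *)
Lemma innovation_step n x :
  `|avg n.+1 (fun t => g (x + W t)) -
    avg n.+1 (fun t => g (x + (W (lsub t) + W (rsub t))))| <=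
  M * a ^+ 2 * (10 * H ^+ 2 * Num.sqrt n.+2%:R).
Proof.
pose X t := W (lsub t) + W (rsub t).
have -> : avg n.+1 (fun t => g (x + W t)) - avg n.+1 (fun t => g (x + X t)) =
    avg n.+1 (fun t => g (x + W t) - g (x + X t) - g1 x * innovation f t).
  by rewrite !avgB avgZ avg_innovation mulr0 subr0.
rewrite (le_trans (ler_norm_avg _ _))//.
rewrite (@le_trans _ _ (avg n.+1 (fun t => M * a ^+ 2 * (H ^+ 2 + H * `|X t|))))//.
  apply: avg_le => t ht; have ih : `|innovation f t| <= H by apply: (innovation_le fB); rewrite ht.
  have -> : W t = X t + innovation f t by rewrite /W centeredE.
  have := taylor_order1 gt (x + X t) (innovation f t).
  have := taylor_lip1 gt (x + X t) x; rewrite [x + X t - x]addrAC subrr add0r.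
  set i := innovation f t in ih *; set y := x + X t => l1 o1.
  have i2 : i ^+ 2 <= H ^+ 2 by rewrite -(real_normK (num_real i)) ler_pXn2r// nnegrE (le_trans _ H1).
  have -> : g (x + (X t + i)) - g y - g1 x * i =
    (g (y + i) - g y - g1 y * i) + (g1 y - g1 x) * i by rewrite /y addrA; ring.
  rewrite (le_trans (ler_normD _ _))// [leRHS]mulrDr lerD//.
    by rewrite (le_trans o1)// ler_wpM2l.
  rewrite normrM [H * _]mulrC mulrA ler_pM//.
rewrite avgZ ler_wpM2l// avgD avg_cst avgZ.
have h := avg_abs_subtrees_le fB n.
have H0 : 0 <= H by exact: le_trans H1.
have q1 : 1 <= Num.sqrt n.+2%:R :> R by rewrite -[leLHS]sqrtr1 ler_sqrt// ler1n.
apply: (le_trans (lerD (lexx (H ^+ 2)) (ler_wpM2l H0 h))).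
move: q1; rewrite -/H; move: (Num.sqrt _) => q q1.
have : 0 <= H ^+ 2 * (q - 1) by rewrite mulr_ge0 ?sqr_ge0// subr_ge0.
lra.
Qed.

(** Replace the functional of each subtree in turn by a normal variable of the
    matching variance; the other subtree only shifts the argument, and the bound
    [d] holds for all shifts. The resulting normal law is the right one since
    [(k + 1) + (n - k + 1) = n + 2]. *)
Lemma lindeberg_step n (d : nat -> R) :
  (forall k, (k <= n)%N -> forall x,
    `|avg k (fun t => g (x + W t)) - gauss_avg (k.+1%:R * s2) g x| <= d k) ->
  forall x, `|avg n.+1 (fun t => g (x + W t)) - gauss_avg (n.+2%:R * s2) g x| <=
    M * a ^+ 2 * (10 * H ^+ 2) * Num.sqrt n.+2%:R +
    2 / n.+1%:R * \sum_(k < n.+1) d k.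
Proof.
move=> hd x.
have gM := taylor_ub gt; have gL := taylor_lip gt.
rewrite -(subrK (avg n.+1 (fun t => g (x + (W (lsub t) + W (rsub t)))))
  (avg n.+1 (fun t => g (x + W t)))) -addrA.
rewrite (le_trans (ler_normD _ _))// -mulrA lerD ?innovation_step//.
have -> : gauss_avg (n.+2%:R * s2) g x =
    n.+1%:R^-1 * \sum_(k < n.+1) gauss_avg (n.+2%:R * s2) g x.
  by rewrite sumr_const card_ord -[gauss_avg _ _ _ *+ _]mulr_natl mulrA mulVf ?mul1r// pnatr_eq0.
rewrite avgS -mulrBr -sumrB normrM normfV [`|n.+1%:R|]ger0_norm//.
have -> : 2 / n.+1%:R * \sum_(k < n.+1) d k =
    n.+1%:R^-1 * \sum_(k < n.+1) (d k + d (n - k)%N).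
  rewrite big_split/= [X in _ + X](_ : _ = \sum_(k < n.+1) d k); first ring.
  rewrite [RHS](reindex_inj rev_ord_inj)/=.
  by apply: eq_bigr => k _; rewrite subSS.
rewrite ler_wpM2l// (le_trans (ler_norm_sum _ _ _))//; apply: ler_sum => k _.
have kn : (k <= n)%N by rewrite -ltnS.
pose G := gauss_avg ((n - k).+1%:R * s2) g.
have pos j : 0 <= j%:R * s2 by exact: mulr_ge0.
(* The intermediate term [m] has a normal variable for the right subtree and the
   functional for the left one. *)
have split_avg : gauss_avg (n.+2%:R * s2) g x =
    gauss_avg ((n - k).+1%:R * s2) (gauss_avg (k.+1%:R * s2) g) x.
  rewrite (gauss_avg_semigroup _ _ _ cg gM gL)// -mulrDl -natrD.
  by rewrite addSn addnS subnK.
pose m := avg k (fun t => G (x + W t)).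
rewrite -(subrK m (avg k _)) -addrA (le_trans (ler_normD _ _))// [leRHS]addrC lerD//; last first.
  pose u y := avg k (fun t => g (y + W t)).
  have uM y : `|u y| <= M.
    by rewrite (le_trans (ler_norm_avg _ _))// -[leRHS](avg_cst k); apply: avg_le.
  have cu : continuous u.
    apply: (@lipschitz_continuous_fun _ _ (M * a)) => y y'.
    rewrite /u -avgB (le_trans (ler_norm_avg _ _))// -[leRHS](avg_cst k).
    apply: avg_le => t _; rewrite (le_trans (gL _ _))//.
    by rewrite opprD addrACA subrr addr0.
  rewrite /m /G (gauss_avg_avg _ _ _ _ cg gM) split_avg.
  apply: (gauss_avg_dist _ _ cu (continuous_gauss_avg cg gM gL) uM).
    by move=> y; exact: gauss_avg_ub.
  exact: hd.
rewrite /m -avgB (le_trans (ler_norm_avg _ _))// -[leRHS](avg_cst k).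
apply: avg_le => s _ /=.
have := hd (n - k)%N (leq_subr _ _) (x + W s).
by rewrite /G; under [X in `|X - _|]eq_avg => t _ do rewrite -addrA.
Qed.

(** Taylor expansion of both means at [x]: the first moments vanish, the second
    moments differ by at most [C sqrt (k + 1)], the third moments go into the remainder. *)
Lemma lindeberg_base k x :
  `|avg k (fun t => g (x + W t)) - gauss_avg (k.+1%:R * s2) g x| <=
  M * a ^+ 2 * C * Num.sqrt k.+1%:R + M * a ^+ 3 * base_cst k.
Proof.
have v0 : 0 <= k.+1%:R * s2 by exact: mulr_ge0.
set v := avg k (fun t => W t ^+ 2).
have h1 : `|avg k (fun t => g (x + W t)) - g x - g2 x * v / 2| <=
    M * a ^+ 3 * avg k (fun t => `|W t| ^+ 3).
  have -> : avg k (fun t => g (x + W t)) - g x - g2 x * v / 2 =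
      avg k (fun t => g (x + W t) - g x - g1 x * W t - g2 x * W t ^+ 2 / 2).
    rewrite !avgB avgZr !avgZ avg_cst (_ : avg k W = 0) ?mulr0 ?subr0//.
    exact: avg_centered.
  rewrite (le_trans (ler_norm_avg _ _))// -avgZ; apply: avg_le => t _.
  exact: taylor_order2 gt _ _.
have h2 := gauss_avg_taylor v0 cg (taylor_ub gt) (taylor_order2 gt x).
have h3 : `|g2 x * (v - k.+1%:R * s2) / 2| <= M * a ^+ 2 * C * Num.sqrt k.+1%:R.
  rewrite normrM normrM -mulrA [leRHS](_ : _ = M * a ^+ 2 * (C * Num.sqrt k.+1%:R)); last by ring.
  rewrite ler_pM ?mulr_ge0 ?taylor_ub2//; first exact: taylor_ub2 gt _.
  rewrite (le_trans _ (varC k))// -/v ler_piMr// normfV ger0_norm//; lra.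
have -> : avg k (fun t => g (x + W t)) - gauss_avg (k.+1%:R * s2) g x =
  (avg k (fun t => g (x + W t)) - g x - g2 x * v / 2) -
  (gauss_avg (k.+1%:R * s2) g x - g x - g2 x * (k.+1%:R * s2) / 2) +
  g2 x * (v - k.+1%:R * s2) / 2 by ring.
rewrite (le_trans (ler_normD _ _))// addrC lerD//.
by rewrite (le_trans (ler_normB _ _))// mulrDr lerD.
Qed.

Section bound.
Variable K : nat.

(* The bounds [d] on the distances: given by [lindeberg_base] up to [K], and
   propagated by [lindeberg_step] beyond; [dsum n] is the sum of the first [n] *)
Let base k := M * a ^+ 2 * C * Num.sqrt k.+1%:R + M * a ^+ 3 * base_cst k.
Let err k := M * a ^+ 2 * (10 * H ^+ 2) * Num.sqrt k.+1%:R.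
Let d_of k s := if (k <= K)%N then base k else err k + 2 / k%:R * s.
Let dsum := fix dsum n := if n is m.+1 then dsum m + d_of m (dsum m) else 0.
Let d k := d_of k (dsum k).

Let dsumE n : dsum n = \sum_(k < n) d k.
Proof. by elim: n => [|n IH]; rewrite ?big_ord0// big_ord_recr/= -IH. Qed.

Let d_base k : (k <= K)%N -> d k = base k.
Proof. by rewrite /d /d_of => ->. Qed.

Let d_rec k : (K <= k)%N -> d k.+1 = err k.+1 + 2 / k.+1%:R * \sum_(j < k.+1) d j.
Proof. by move=> Kk; rewrite /d /d_of ltnNge Kk -dsumE. Qed.

Let d_correct n x :
  `|avg n (fun t => g (x + W t)) - gauss_avg (n.+1%:R * s2) g x| <= d n.
Proof.
have [m] := ubnP n; elim: m n x => // m IH n x; rewrite ltnS => nm.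
have [nK|Kn] := leqP n K; first by rewrite d_base//; exact: lindeberg_base.
case: n Kn nm => // n; rewrite ltnS => Kn nm; rewrite d_rec//.
by apply: lindeberg_step => k kn y; apply: IH; lia.
Qed.

(** The recursion for the distances, started at [K]: the tolls beyond [K] add
    [4 * 10 H^2 / sqrt (K + 1)], the variance errors up to [K] add
    [2 C / sqrt (K + 1)], per unit of [n + 2]. *)
Lemma lindeberg_bound n x : (K <= n)%N ->
  `|avg n.+1 (fun t => g (x + W t)) - gauss_avg (n.+2%:R * s2) g x| <=
  M * a ^+ 2 * (10 * H ^+ 2) * Num.sqrt n.+2%:R +
  n.+2%:R * (M * a ^+ 2 * (2 * C + 40 * H ^+ 2) / Num.sqrt K.+1%:R +
    M * a ^+ 3 * (toll_weight K * \sum_(k < K.+1) base_cst k)).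
Proof.
move=> Kn; rewrite (le_trans (d_correct _ _))//.
have := @rec_le R d err K n Kn (fun m hm => ltac:(by rewrite d_rec//; lia)).
move=> /le_trans; apply; rewrite lerD2l ler_wpM2l//.
have h1 : \sum_(K.+1 <= k < n.+1) toll_weight k * err k <=
    M * a ^+ 2 * (40 * H ^+ 2) / Num.sqrt K.+1%:R.
  have c0 : 0 <= M * a ^+ 2 * (10 * H ^+ 2) by rewrite mulr_ge0// mulr_ge0// sqr_ge0.
  pose theta k : R := 4 * (M * a ^+ 2 * (10 * H ^+ 2)) / Num.sqrt k.+1%:R.
  have th0 k : 0 <= theta k by rewrite /theta divr_ge0 ?sqrtr_ge0// mulr_ge0.
  have err0 k : 0 <= err k by rewrite /err mulr_ge0.
  have h : `|\sum_(K.+1 <= k < n.+1) toll_weight k * err k| <= theta K.+1 - theta n.+1.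
    apply: (toll_sum_le (rho := err)) => // [k _|k _]; first exact: toll_bound_sqrt.
    by rewrite ger0_norm.
  rewrite (le_trans (ler_norm _))// (le_trans h)//.
  rewrite (@le_trans _ _ (theta K.+1)) ?gerBl// /theta.
  rewrite (_ : M * a ^+ 2 * (40 * H ^+ 2) = 4 * (M * a ^+ 2 * (10 * H ^+ 2))); last by ring.
  apply: ler_wpM2l; first by rewrite mulr_ge0.
  by rewrite lef_pV2 ?posrE ?sqrt_natS_gt0// ler_sqrt// ler_nat.
have sumsq : toll_weight K * \sum_(k < K.+1) Num.sqrt k.+1%:R <= 2 / Num.sqrt K.+1%:R :> R.
  rewrite (@le_trans _ _ (toll_weight K * (K.+1%:R * Num.sqrt K.+1%:R)))//.
    rewrite ler_wpM2l ?(ltW (toll_weight_gt0 _))//.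
    rewrite (@le_trans _ _ (\sum_(k < K.+1) Num.sqrt K.+1%:R))//.
      by apply: ler_sum => k _; rewrite ler_sqrt// ler_nat ltn_ord.
    by rewrite sumr_const card_ord mulr_natl.
  rewrite /toll_weight ler_pdivlMr ?sqrt_natS_gt0// -[leLHS]mulrA -[_ * _ * Num.sqrt _]mulrA.
  rewrite -expr2 sqr_sqrtr// -[K.+2%:R]natr1.
  have : 0 < K.+1%:R :> R by []; move: (K.+1%:R) => y y0.
  have -> : 2 / (y * (y + 1)) * (y * y) = 2 * (y / (y + 1)).
    by field; rewrite !gt_eqF//; lra.
  by rewrite ler_piMr// ler_pdivrMr; lra.
have -> : \sum_(k < K.+1) d k = M * a ^+ 2 * C * \sum_(k < K.+1) Num.sqrt k.+1%:R +
    M * a ^+ 3 * \sum_(k < K.+1) base_cst k.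
  rewrite !mulr_sumr -big_split/=; apply: eq_bigr => k _.
  by rewrite d_base// -ltnS.
have h2 := ler_wpM2l (mulr_ge0 Ma2 C0) sumsq.
rewrite mulrDr -addrA [X in _ + X]addrC addrA.
rewrite (_ : M * a ^+ 2 * (2 * C + 40 * H ^+ 2) / Num.sqrt K.+1%:R + M * a ^+ 3 * (toll_weight K * \sum_(k < K.+1) base_cst k) =
  M * a ^+ 2 * C * (2 / Num.sqrt K.+1%:R) + M * a ^+ 2 * (40 * H ^+ 2) / Num.sqrt K.+1%:R + toll_weight K * (M * a ^+ 3 * \sum_(k < K.+1) base_cst k)); last by ring.
by rewrite lerD2r lerD// mulrCA.
Qed.

End bound.
End testfun.
End lindeberg.

(** * The central limit theorem *)

Lemma gauss_avg_scale (R : realType) (a v x : R) (g : R -> R) : 0 <= a ->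
  gauss_avg v (fun y => g (a * y)) x = gauss_avg (a ^+ 2 * v) g (a * x).
Proof.
move=> a0; rewrite /gauss_avg; apply: eq_Rintegral => z _.
by rewrite sqrtrM ?sqr_ge0// sqrtr_sqr ger0_norm// mulrDr mulrA.
Qed.

Section clt.
Context {R : realType} (f : bshape -> R) (B : R).
Hypothesis fB : forall t, `|f t| <= B.
Variables (s2 C : R).
Hypothesis s20 : 0 <= s2.
Hypothesis varC : forall n,
  `|avg n (fun t => centered f t ^+ 2) - n.+1%:R * s2| <= C * Num.sqrt n.+1%:R.
Variables (c : nat -> R) (N : nat -> nat) (b : R).
Hypothesis cb : forall n, `|c n| <= b.
Hypothesis Nn : forall n, (n <= N n <= n.+1)%N.

Let b0 : 0 <= b. Proof. exact: le_trans (cb 0). Qed.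

(** The norming [sqrt (N n)] may differ from [sqrt (n + 1)], as the numbers of nodes
    of search trees and of recursive trees with [n] forks differ by one. *)
Lemma scale_bounds n : let a := (Num.sqrt (N n.+1)%:R)^-1 in
  let q := Num.sqrt n.+2%:R : R in
  [/\ 0 <= a, a ^+ 2 * q <= 2 / q, q ^+ 2 * a ^+ 2 <= 2, a <= 2 / q &
    `|a * q - 1| <= 2 / q].
Proof.
move=> a q; have [m1 m2] := andP (Nn n.+1).
have q1 : 1 <= q by rewrite -[leLHS]sqrtr1 ler_sqrt// ler1n.
have qq : q ^+ 2 = n.+2%:R by rewrite sqr_sqrtr.
have N0 : 0 < (N n.+1)%:R :> R by rewrite ltr0n; apply: leq_trans m1.
have a0 : 0 < a by rewrite invr_gt0 sqrtr_gt0.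
have aa : a ^+ 2 = (N n.+1)%:R^-1 by rewrite exprVn sqr_sqrtr// ltW.
have qa : q ^+ 2 * a ^+ 2 <= 2.
  rewrite qq aa ler_pdivrMr// -natrM ler_nat; lia.
have qa1 : 1 <= q ^+ 2 * a ^+ 2.
  by rewrite qq aa ler_pdivlMr// mul1r ler_nat.
have qa2 : q ^+ 2 * a ^+ 2 <= 1 + a ^+ 2.
  rewrite qq aa ler_pdivrMr// mulrDl mul1r mulVf ?gt_eqF// natr1 ler_nat; lia.
have q0 : 0 < q by lra.
have aq1 : 1 <= a * q by rewrite -(@ler_pXn2r _ 2)// ?nnegrE ?mulr_ge0 ?(ltW a0) ?(ltW q0)// expr1n exprMn mulrC.
have aq2 : a * q <= 2 by rewrite -exprMn in qa; nra.
split; rewrite ?(ltW a0)//.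
- by rewrite ler_pdivlMr// -mulrA -expr2 mulrC.
- by rewrite ler_pdivlMr.
- rewrite ger0_norm ?subr_ge0// ler_pdivlMr//.
  have : a * q - 1 <= a ^+ 2 by rewrite mulrC -exprMn mulrC in qa2; nra.
  have : a ^+ 2 * q <= 2 / q by rewrite ler_pdivlMr// -mulrA -expr2 mulrC.
  have : 2 / q <= 2 by rewrite ler_pdivrMr//; lra.
  nra.
Qed.

(** In [lindeberg_bound] for [g] rescaled by [a], the terms of order
    [n a^2 / sqrt K] are made small by the choice of [K]; for this [K], all others,
    as well as the effects of the shift [c] and of the norming, are
    [O(1/sqrt n)]. *)
Lemma clt_taylor (M : R) (g g1 g2 : R -> R) : taylor_fun M 1 g g1 g2 ->
  avg n (fun t => g ((centered f t + c n) / Num.sqrt (N n)%:R)) @[n --> \oo] -->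
  gauss_avg s2 g 0.
Proof.
move=> gt; have M0 : 0 <= M by exact: le_trans (taylor_ub gt 0).
rewrite -(cvg_shiftS _ _); apply/cvgrPdist_le => /= e e0.
pose C2 := 2 * C + 40 * (10 * B + 1) ^+ 2.
have C0 : 0 <= C.
  by have := le_trans (normr_ge0 _) (varC 0); rewrite sqrtr1 mulr1.
have C20 : 0 <= C2 by rewrite addr_ge0// mulr_ge0// sqr_ge0.
have [K hK] : exists K, 2 * M * C2 / Num.sqrt K.+1%:R <= e / 2.
  have e20 : 0 < e / 2 by rewrite divr_gt0.
  have /cvgrPdist_le/(_ _ e20)[K _ /(_ K (leqnn _))] := cvg_inv_sqrt (2 * M * C2).
  by rewrite sub0r normrN => h; exists K; rewrite (le_trans (ler_norm _)).
pose cK : R := `|toll_weight K * \sum_(k < K.+1) (avg k (fun t => `|centered f t| ^+ 3) +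
  Num.sqrt (k.+1%:R * s2) ^+ 3 * @normal_abs3 R)|.
(* The constant in front of [1/sqrt n], collected from [p1], [p3], [p4] and [p5]
   below. *)
pose A := 20 * M * (10 * B + 1) ^+ 2 + 4 * M * cK + 2 * M * b + 2 * M * Num.sqrt s2.
near=> n.
have [a0 aq qa2 a2 aq1] := scale_bounds n.
set a := (Num.sqrt (N n.+1)%:R)^-1 in a0 aq qa2 a2 aq1 *.
have q0 := sqrt_natS_gt0 (R := R) n.+1.
have Kn : (K <= n)%N by near: n; exact: nbhs_infty_ge.
have hA : A / Num.sqrt n.+2%:R <= e / 2.
  rewrite (le_trans (ler_norm _))//.
  near: n; have e20 : 0 < e / 2 by rewrite divr_gt0.
  have cA : A / Num.sqrt n.+2%:R @[n --> \oo] --> 0.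
    by rewrite (cvg_shiftS (fun k => A / Num.sqrt k.+1%:R)); exact: cvg_inv_sqrt.
  have /cvgrPdist_le/(_ _ e20) := cA.
  by apply: filterS => n; rewrite sub0r normrN.
set q := Num.sqrt n.+2%:R in q0 aq qa2 a2 aq1 hA *.
have h := lindeberg_bound fB s20 varC (taylor_scale a0 gt) a0 (c n.+1) Kn.
rewrite gauss_avg_scale// in h.
have h2 := gauss_avg_lip (a ^+ 2 * (n.+2%:R * s2)) s2 (a * c n.+1) 0
  (taylor_continuous gt) (taylor_ub gt) (taylor_lip gt).
have sE : Num.sqrt (a ^+ 2 * (n.+2%:R * s2)) = a * q * Num.sqrt s2.
  by rewrite sqrtrM ?sqr_ge0// sqrtr_sqr ger0_norm// sqrtrM ?ler0n// mulrA.
rewrite mulr1 subr0 sE in h2.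
rewrite [X in _ - X](_ : _ = avg n.+1 (fun t => g (a * (c n.+1 + centered f t)))); last first.
  by apply: eq_avg => t _; congr g; rewrite mulrC [c n.+1 + _]addrC.
rewrite distrC.
pose H := 10 * B + 1; pose X := toll_weight K * \sum_(k < K.+1)
  (avg k (fun t => `|centered f t| ^+ 3) +
  Num.sqrt (k.+1%:R * s2) ^+ 3 * @normal_abs3 R).
have p1 : M * a ^+ 2 * (10 * H ^+ 2) * q <= M * (10 * H ^+ 2) * (2 / q).
  rewrite (_ : _ * q = M * (10 * H ^+ 2) * (a ^+ 2 * q)); last by ring.
  by rewrite ler_wpM2l// mulr_ge0// mulr_ge0// sqr_ge0.
have p2 : q ^+ 2 * (M * a ^+ 2 * C2 / Num.sqrt K.+1%:R) <=
    2 * M * C2 / Num.sqrt K.+1%:R.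
  rewrite (_ : _ * (_ / _) = (q ^+ 2 * a ^+ 2) * (M * C2 / Num.sqrt K.+1%:R)); last by ring.
  rewrite (_ : 2 * M * C2 / _ = 2 * (M * C2 / Num.sqrt K.+1%:R)); last by ring.
  by rewrite ler_wpM2r// divr_ge0 ?sqrtr_ge0// mulr_ge0.
have p3 : q ^+ 2 * (M * a ^+ 3 * X) <= 4 * M * cK / q.
  rewrite (_ : _ * (_ * X) = (q ^+ 2 * a ^+ 2) * a * (M * X)); last by ring.
  rewrite (_ : 4 * M * cK / q = 2 * (2 / q) * (M * cK)); last by ring.
  rewrite (le_trans (ler_norm _))// normrM [`|M * X|]normrM (ger0_norm M0).
  rewrite ler_wpM2r ?mulr_ge0 ?normr_ge0// ger0_norm.
    by rewrite ler_pM// mulr_ge0// sqr_ge0.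
  by rewrite mulr_ge0// mulr_ge0// sqr_ge0.
have p4 : `|a * c n.+1| <= 2 / q * b by rewrite normrM ger0_norm// ler_pM.
have p5 : `|a * q * Num.sqrt s2 - Num.sqrt s2| <= 2 / q * Num.sqrt s2.
  rewrite -[X in _ - X]mul1r -mulrBl normrM [`|Num.sqrt s2|]ger0_norm ?sqrtr_ge0//.
  by rewrite ler_wpM2r ?sqrtr_ge0.
have p6 := ler_wpM2l M0 (lerD p4 p5).
have qq : n.+2%:R = q ^+ 2 by rewrite sqr_sqrtr.
rewrite qq in h2; rewrite -/q qq mulrDr -/C2 -/H -/X in h.
apply: (le_trans (ler_distD (gauss_avg (a ^+ 2 * (n.+2%:R * s2)) g (a * c n.+1)) _ _)).
rewrite qq.
apply: (le_trans (lerD h h2)).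
have -> : e = e / 2 + e / 2 by rewrite -splitr.
rewrite (le_trans _ (lerD hA hK))//.
rewrite (_ : A / q = M * (10 * H ^+ 2) * (2 / q) + 4 * M * cK / q + M * (2 / q * b + 2 / q * Num.sqrt s2)); last first.
  by rewrite /A /H; field; rewrite gt_eqF.
move: p1 p2 p3 p6; lra.
Unshelve. all: by end_near. Qed.

(** Keeps the error [e (1 + x^2)] of [taylor_approx] small in the mean. *)
Lemma second_moment_bounded n :
  avg n.+1 (fun t => ((centered f t + c n.+1) / Num.sqrt (N n.+1)%:R) ^+ 2) <=
  4 * (s2 + C) + 2 * b ^+ 2.
Proof.
have [m1 m2] := andP (Nn n.+1).
have N1 : 1 <= (N n.+1)%:R :> R by rewrite ler1n (leq_trans _ m1).
have N0 : 0 < (N n.+1)%:R :> R by lra.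
have C0 : 0 <= C.
  by have := le_trans (normr_ge0 _) (varC 0); rewrite sqrtr1 mulr1.
rewrite (@le_trans _ _ (avg n.+1 (fun t => (N n.+1)%:R^-1 *
    (2 * centered f t ^+ 2 + 2 * b ^+ 2))))//.
  apply: avg_le => t _ /=; rewrite exprMn exprVn sqr_sqrtr ?ler0n// [leLHS]mulrC.
  rewrite ler_wpM2l ?invr_ge0 ?ler0n//.
  have c2 : c n.+1 ^+ 2 <= b ^+ 2.
    by rewrite -(real_normK (num_real (c _))) ler_pXn2r ?nnegrE.
  move: c2; have := sqr_ge0 (centered f t - c n.+1).
  by move: (centered f t) (c n.+1) => w y; lra.
rewrite avgZ avgD avgZ avg_cst ler_pdivrMl//.
have h := varC n.+1; have : Num.sqrt n.+2%:R <= n.+2%:R :> R.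
  rewrite -[leRHS]ger0_norm// -sqrtr_sqr ler_sqrt ?exprn_ge0//.
  by rewrite expr2 ler_peMr// ler1n.
move=> /(ler_wpM2l C0) h1.
have h2 : avg n.+1 (fun t => centered f t ^+ 2) <= n.+2%:R * (s2 + C).
  by move: h; rewrite ler_norml => /andP[_]; lra.
have h3 : n.+2%:R <= 2 * (N n.+1)%:R :> R.
  by rewrite -natrM ler_nat; lia.
have h4 : n.+2%:R * (s2 + C) <= 2 * (N n.+1)%:R * (s2 + C) by rewrite ler_wpM2r// addr_ge0.
have : 2 * b ^+ 2 <= (N n.+1)%:R * (2 * b ^+ 2) by rewrite ler_peMl// mulr_ge0// sqr_ge0.
lra.
Qed.

Lemma clt_bounded (u : R -> R) (M : R) : continuous u -> (forall x, `|u x| <= M) ->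
  avg n (fun t => u ((centered f t + c n) / Num.sqrt (N n)%:R)) @[n --> \oo] -->
  gauss_avg s2 u 0.
Proof.
move=> cu uM; rewrite -(cvg_shiftS _ _); apply/cvgrPdist_le => /= e e0.
have C0 : 0 <= C.
  by have := le_trans (normr_ge0 _) (varC 0); rewrite sqrtr1 mulr1.
pose V := 4 * (s2 + C) + 2 * b ^+ 2.
have V0 : 0 <= V by rewrite addr_ge0// mulr_ge0// ?sqr_ge0// addr_ge0.
pose e1 := e / 3 / (1 + V + s2).
have D0 : 0 < 1 + V + s2 by rewrite ltr_wpDr// ltr_wpDr.
have e10 : 0 < e1 by rewrite !divr_gt0.
have [M' [g [g1 [g2 [gt gM ug]]]]] := taylor_approx cu uM e10.
have cg := taylor_continuous gt.
have e30 : 0 < e / 3 by rewrite divr_gt0.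
have eE : e1 * (1 + V + s2) = e / 3 by rewrite divfK// gt_eqF.
near=> n.
have h1 : `|gauss_avg s2 g 0 -
    avg n.+1 (fun t => g ((centered f t + c n.+1) / Num.sqrt (N n.+1)%:R))| <= e / 3.
  near: n; have := clt_taylor gt; rewrite -(cvg_shiftS _ _).
  by move=> /cvgrPdist_le/(_ _ e30).
have h2 := gauss_avg_sqr s20 cu cg uM gM ug.
have h3 : `|avg n.+1 (fun t => g ((centered f t + c n.+1) / Num.sqrt (N n.+1)%:R)) -
    avg n.+1 (fun t => u ((centered f t + c n.+1) / Num.sqrt (N n.+1)%:R))| <=
    e1 * (1 + V).
  rewrite -avgB (le_trans (ler_norm_avg _ _))//.
  rewrite (@le_trans _ _ (avg n.+1 (fun t => e1 *
      (1 + ((centered f t + c n.+1) / Num.sqrt (N n.+1)%:R) ^+ 2))))//.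
    by apply: avg_le => t _; rewrite distrC.
  rewrite avgZ avgD avg_cst ler_wpM2l ?(ltW e10)// lerD2l.
  exact: second_moment_bounded.
apply: (le_trans (ler_distD (gauss_avg s2 g 0) _ _)).
have -> : e = e / 3 + (e / 3 + e / 3) by field.
have h4 : e1 * (1 + s2) <= e / 3.
  rewrite -eE; apply: ler_wpM2l; first exact: ltW.
  by rewrite lerD2r lerDl.
have h5 : e1 * (1 + V) <= e / 3.
  by rewrite -eE; apply: ler_wpM2l; [exact: ltW|rewrite lerDl].
apply: lerD; first exact: le_trans h4.
apply: (le_trans (ler_distD (avg n.+1
  (fun t => g ((centered f t + c n.+1) / Num.sqrt (N n.+1)%:R))) _ _)).
by apply: lerD => //; exact: le_trans h5.
Unshelve. all: by end_near. Qed.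
End clt.

(** * A lower bound for the variance *)

Section positivity.
Context {R : realType}.

Lemma avg_exchange m n (g : bshape -> bshape -> R) :
  avg m (fun a => avg n (fun b => g a b)) = avg n (fun b => avg m (fun a => g a b)).
Proof.
rewrite !avg.unlock.
by rewrite -!mulr_sumr exchange_big/= mulrCA.
Qed.

(** The probability of [t] among random shapes of its size. *)
Definition shape_prob (t : bshape) : R := avg (nforks t) (fun u => (u == t)%:R).

Lemma Fork_eq a b c d : (Fork a b == Fork c d) = (a == c) && (b == d).
Proof.
by apply/eqP/andP => [[-> ->]|[/eqP -> /eqP ->]].
Qed.

Lemma shape_prob_gt0 t : 0 < shape_prob t.
Proof.
elim: t => [|a IHa b IHb]; first by rewrite /shape_prob avg0 eqxx ltr01.
rewrite /shape_prob /= avgS mulr_gt0//.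
have ka : (nforks a < (nforks a + nforks b).+1)%N by rewrite ltnS leq_addr.
rewrite (bigD1 (Ordinal ka))//= addKn ltr_pwDl//; last first.
  by apply: sumr_ge0 => k _; apply: avg_ge0 => c _; apply: avg_ge0 => d _; rewrite ler0n.
suff -> : avg (nforks a) (fun c => avg (nforks b) (fun d => (Fork c d == Fork a b)%:R)) =
    shape_prob a * shape_prob b by exact: mulr_gt0.
rewrite /shape_prob -avgZr; apply: eq_avg => c _; rewrite -avgZ.
by apply: eq_avg => d _; rewrite Fork_eq -natrM mulnb.
Qed.

Lemma avg_indic t (psi : bshape -> R) :
  avg (nforks t) (fun u => (u == t)%:R * psi u) = shape_prob t * psi t.
Proof.
rewrite /shape_prob -avgZr; apply: eq_avg => u _.
by have [->//|_] := eqVneq u t; rewrite !mul0r.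
Qed.

Lemma avg_gt0 (g : bshape -> R) t : (forall u, 0 <= g u) -> 0 < g t ->
  0 < avg (nforks t) g.
Proof.
move=> g0 gt0; apply: (@lt_le_trans _ _ (shape_prob t * g t)).
  by rewrite mulr_gt0// shape_prob_gt0.
rewrite -avg_indic; apply: avg_le => u _.
by case: (u == t); rewrite ?mul1r// mul0r.
Qed.

Section variance.
(* The state of a shape is all that the tolls of larger shapes depend on. *)
Context (S : Type) (state : bshape -> S) (merge : S -> S -> S) (phi : S -> S -> R).
Variables (f : bshape -> R) (t1 t2 : bshape).
Hypothesis stateE : forall a b, state (Fork a b) = merge (state a) (state b).
Hypothesis fE : forall a b, f (Fork a b) = phi (state a) (state b).
Hypothesis t_size : nforks t1 = nforks t2.
Hypothesis t_state : state t1 = state t2.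
Hypothesis t_gt0 : (0 < nforks t1)%N.

Let m := nforks t1.
Let F := total f.

(* The difference of the indicators of two shapes of the same size and state, each
   normalized to mean 1; [G] sums it over all fringe subtrees. *)
Let contrast t : R := (t == t1)%:R / shape_prob t1 - (t == t2)%:R / shape_prob t2.
Let G := total contrast.

Lemma avg_contrast (psi : bshape -> R) n :
  avg n (fun t => contrast t * psi t) = (n == m)%:R * (psi t1 - psi t2).
Proof.
have [->|nm] := eqVneq n m; last first.
  rewrite mul0r (eq_avg (h := cst 0)) ?avg_cst// => t tn.
  have nt u : nforks u = m -> (t == u) = false.
    by move=> um; apply/eqP => tu; move: nm; rewrite -tn tu um eqxx.
  by rewrite /contrast !nt// !mul0r subrr mul0r.
rewrite mul1r (eq_avg (h := fun t => (shape_prob t1)^-1 * ((t == t1)%:R * psi t) -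
   (shape_prob t2)^-1 * ((t == t2)%:R * psi t))); last first.
  by move=> t _; rewrite /contrast; ring.
rewrite avgB !avgZ avg_indic /m t_size avg_indic.
by rewrite !mulrA !mulVf ?mul1r// gt_eqF// shape_prob_gt0.
Qed.

Lemma total_contrast_small t : (nforks t < m)%N -> G t = 0.
Proof.
elim: t => [//|a IHa b IHb] ab; rewrite /G /= -/(G a) -/(G b) IHa ?IHb; last 2 first.
- by move: ab => /=; lia.
- by move: ab => /=; lia.
have nt u : nforks u = m -> (Fork a b == u) = false.
  by move=> um; apply/eqP => tu; move: ab; rewrite tu um ltnn.
by rewrite /contrast !nt// !mul0r subrr !addr0.
Qed.

Lemma total_contrastE n t : nforks t = n.+1 -> G t = contrast t + (G (lsub t) + G (rsub t)).
Proof. by move=> tn; rewrite /G (totalE _ tn) addrA. Qed.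

(** The contrast carries no information on the states. *)
Lemma avg_state_contrast n : forall psi : S -> R,
  avg n (fun t => psi (state t) * G t) = 0.
Proof.
have [k] := ubnP n; elim: k n => // k IH [_ psi|n]; first by rewrite avg0 mulr0.
rewrite ltnS => nk psi.
rewrite (eq_avg (h := fun t => contrast t * psi (state t) +
   (psi (state t) * G (lsub t) + psi (state t) * G (rsub t)))); last first.
  by move=> t tn; rewrite (total_contrastE tn); ring.
rewrite avgD avg_contrast t_state subrr mulr0 add0r avgD !avgS.
rewrite big1 ?mulr0 ?add0r => [|j _]; last first.
  rewrite avg_exchange (eq_avg (h := cst 0)) ?avg_cst// => b _.
  under eq_avg => a _ do rewrite stateE /=.
  by have jn := ltn_ord j; apply: (IH j _ (fun s => psi (merge s (state b)))); lia.
rewrite big1 ?mulr0// => j _.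
rewrite (eq_avg (h := cst 0)) ?avg_cst// => a _.
under eq_avg => b _ do rewrite stateE /=.
by have jn := ltn_ord j; apply: (IH (n - j)%N _ (fun s => psi (merge (state a) s))); lia.
Qed.

Lemma avg_total_contrast n : avg n G = 0.
Proof.
rewrite -[RHS](avg_state_contrast n (fun=> 1)).
by apply: eq_avg => t _; rewrite mul1r.
Qed.

(** The toll depends on one subtree through its state only, given the other. *)
Lemma avg_toll_contrast n : avg n.+1 (fun t => f t * (G (lsub t) + G (rsub t))) = 0.
Proof.
rewrite (eq_avg (h := fun t => f t * G (lsub t) + f t * G (rsub t))); last first.
  by move=> t _; rewrite mulrDr.
rewrite avgD !avgS.
rewrite big1 ?mulr0 ?add0r => [|j _]; last first.
  rewrite avg_exchange (eq_avg (h := cst 0)) ?avg_cst// => b _.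
  under eq_avg => a _ do rewrite fE /=.
  exact: (avg_state_contrast j (fun s => phi s (state b))).
rewrite big1 ?mulr0// => j _.
rewrite (eq_avg (h := cst 0)) ?avg_cst// => a _.
under eq_avg => b _ do rewrite fE /=.
exact: (avg_state_contrast (n - j) (fun s => phi (state a) s)).
Qed.

(** Covariances with [G] obey the recursion of means, since the cross terms
    between the two subtrees vanish. *)
Lemma avg_mul_contrast_rec (T : bshape -> R) n :
  avg n.+1 (fun t => (T (lsub t) + T (rsub t)) * (G (lsub t) + G (rsub t))) =
  2 / n.+1%:R * \sum_(k < n.+1) avg k (fun t => T t * G t).
Proof.
rewrite -avg_subtrees.
rewrite (eq_avg (h := fun t => (T (lsub t) * G (lsub t) + T (rsub t) * G (rsub t)) +
  (T (lsub t) * G (rsub t) + G (lsub t) * T (rsub t)))); last by move=> t _; ring.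
rewrite [LHS]avgD [X in _ + X]avgD !avg_mul.
rewrite big1 ?mulr0 ?add0r => [|k _]; last by rewrite avg_total_contrast mulr0.
by rewrite big1 ?mulr0 ?addr0// => k _; rewrite avg_total_contrast mul0r.
Qed.

(** Where [contrast] is nonzero, the subtrees are too small to contain [t1] or [t2]. *)
Lemma avg_contrast_subtrees n :
  avg n.+1 (fun t => contrast t * (G (lsub t) + G (rsub t))) = 0.
Proof.
rewrite avg_contrast; have [nm|] := eqVneq; last by rewrite mul0r.
have small t : nforks t = m -> G (lsub t) + G (rsub t) = 0.
  by rewrite -nm => /nforks_subtrees tn; rewrite !total_contrast_small ?addr0// -nm; lia.
by rewrite !small// subrr mulr0.
Qed.

Let cov n := avg n (fun t => F t * G t).
Let var n := avg n (fun t => G t * G t).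
Let delta := F t1 - F t2.
Let q := avg m (fun t => contrast t * contrast t).

Lemma contrast_cov_rec n : cov n.+1 = (n.+1 == m)%:R * delta +
  2 / n.+1%:R * \sum_(k < n.+1) cov k.
Proof.
rewrite -avg_mul_contrast_rec -avg_contrast -[in RHS](addr0 (avg _ _)) -(avg_toll_contrast n) -!avgD.
apply: eq_avg => t tn; rewrite [in LHS](total_contrastE tn) mulrDr [F t * contrast t]mulrC -addrA.
by congr (_ + _); rewrite /F {1}(totalE _ tn) -addrA mulrDl.
Qed.

Lemma contrast_var_rec n : var n.+1 = (n.+1 == m)%:R * q +
  2 / n.+1%:R * \sum_(k < n.+1) var k.
Proof.
have -> : (n.+1 == m)%:R * q = avg n.+1 (fun t => contrast t * contrast t).
  by rewrite /q !avg_contrast eqxx mul1r.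
rewrite -avg_mul_contrast_rec.
have := avg_contrast_subtrees n; set z := avg _ _ => z0.
rewrite -[in RHS](addr0 (avg _ _)) -[X in _ + X + _](mulr0 2) -z0 /z -avgZ -!avgD.
by apply: eq_avg => t tn; rewrite (total_contrastE tn); ring.
Qed.

(** A toll at the single size [m]. *)
Lemma rec_single (a : nat -> R) (x : R) n : a 0%N = 0 -> (m <= n)%N ->
  (forall n, a n.+1 = (n.+1 == m)%:R * x + 2 / n.+1%:R * \sum_(k < n.+1) a k) ->
  a n.+1 = n.+2%:R * (toll_weight m * x).
Proof.
move=> a0 mn ha; rewrite (@rec_eq R a (fun k => (k == m)%:R * x) n ha) a0 add0r.
rewrite gtn_eqF ?ltnS// mul0r add0r; congr (_ * _).
rewrite (bigD1_seq m) ?iota_uniq ?mem_index_iota//=; last by rewrite t_gt0.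
rewrite eqxx mul1r big1 ?addr0// => k /negbTE ->.
by rewrite mul0r mulr0.
Qed.

(** Cauchy-Schwarz: the second moment of [W - la G] is nonnegative, where both the
    covariance and the variance of [G] solve the recursion with a toll at the
    single size [m], so that they are linear. *)
Lemma variance_linear_lower : F t1 <> F t2 -> exists2 c, 0 < c &
  forall n, (m <= n)%N -> n.+2%:R * c <= avg n.+1 (fun t => centered f t ^+ 2).
Proof.
move=> Ft; have d0 : 0 < delta ^+ 2.
  by rewrite exprn_even_gt0//= subr_eq0; apply/eqP.
have q0 : 0 <= q by apply: avg_ge0 => t _; rewrite -expr2 sqr_ge0.
have w0 := toll_weight_gt0 (R := R) m.
(* The optimal [la] would be [delta / q]; adding 1 avoids a division by zero and
   costs only a constant. *)
pose q' := q + 1; have q'0 : 0 < q' by rewrite /q'; lra.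
exists (toll_weight m * (delta ^+ 2 / q')); first by rewrite mulr_gt0// divr_gt0.
move=> n mn.
have covE : cov n.+1 = n.+2%:R * (toll_weight m * delta).
  by apply: rec_single => //; [rewrite /cov avg0 mulr0|exact: contrast_cov_rec].
have varE : var n.+1 = n.+2%:R * (toll_weight m * q).
  by apply: rec_single => //; [rewrite /var avg0 mulr0|exact: contrast_var_rec].
pose la := delta / q'.
have : 0 <= avg n.+1 (fun t => (centered f t - la * G t) ^+ 2).
  by apply: avg_ge0 => t _; exact: sqr_ge0.
rewrite (eq_avg (h := fun t => centered f t ^+ 2 + (la ^+ 2 * (G t * G t) -
   2 * la * (F t * G t)) + 2 * la * avg n.+1 F * G t)); last first.
  by move=> t tn; rewrite /centered tn -/F; ring.
rewrite avgD avgZ avg_total_contrast mulr0 addr0 avgD avgB !avgZ -/(cov _) -/(var _) covE varE.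
set v := avg _ _ => h.
have : n.+2%:R * toll_weight m * (2 * la * delta - la ^+ 2 * q) <= v by lra.
move=> /(le_trans _); apply; rewrite [leLHS]mulrA; apply: ler_wpM2l; first by rewrite mulr_ge0 ?(ltW w0).
have -> : 2 * la * delta - la ^+ 2 * q = delta ^+ 2 / q' + (delta / q') ^+ 2.
  by rewrite /la /q'; field; rewrite gt_eqF//; lra.
by rewrite lerDl sqr_ge0.
Qed.

End variance.
End positivity.

(** * Protected nodes as additive functionals *)

Section uniform_image.
Context d (T : measurableType d) (R : realType) (I : finType).
Context (hI : (0 < #|I|)%N) (X : I -> T).

Lemma ge0_integral_uniform_image (h : T -> R) : measurable_fun setT h ->
  (forall t, 0 <= h t) ->
  (\int[uniform_image R hI X]_t (h t)%:E =
   (#|I|%:R^-1 * \sum_i h (X i))%:E)%E.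
Proof.
move=> mh h0.
pose x k := X (nth (enum_val (Ordinal hI)) (enum I) k).
rewrite (@eq_measure_integral _ _ _ _
  (mscale (#|I|%:R^-1)%:nng (msum (fun k => dirac (x k)) #|I|))) => [|A mA _].
  rewrite ge0_integral_mscale//; [|exact/measurable_EFinP|by move=> t _; rewrite lee_fin].
  rewrite ge0_integral_measure_sum//; [|by move=> t _; rewrite lee_fin|exact/measurable_EFinP].
  rewrite EFinM; congr (_ * _)%E.
  transitivity (\sum_(k < #|I|) (h (x k))%:E)%E.
    apply: eq_bigr => k _; rewrite integral_dirac ?diracT ?mul1e//.
    exact/measurable_EFinP.
  rewrite sumEFin; congr (_%:E).
  transitivity (\sum_(i in I) h (X i)); last by apply: eq_bigl.
  rewrite [RHS]big_enum_val/=; apply: eq_bigr => k _.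
  by rewrite /x -enum_val_nth.
rewrite /mscale/= /msum/= /uniform_image mulrC EFinM; congr (_ * _)%E.
transitivity (\sum_(i in I) ((X i \in A) : nat)%:R%:E : \bar R)%E.
  rewrite sumEFin -natr_sum -sum1_card big_mkcond/=; congr (_%:R%:E).
rewrite big_enum_val/=; apply: eq_bigr => k _.
by rewrite /= /x -enum_val_nth diracE.
Qed.

Lemma integral_uniform_image (h : T -> R) : (forall g : T -> R, measurable_fun setT g) ->
  (\int[uniform_image R hI X]_t (h t)%:E =
   (#|I|%:R^-1 * \sum_i h (X i))%:E)%E.
Proof.
move=> mT; rewrite integralE.
have -> : (fun t => (h t)%:E)^\+%E = (fun t => (Num.max (h t) 0)%:E).
  by apply/funext => t; rewrite funeposE EFin_max.
have -> : (fun t => (h t)%:E)^\-%E = (fun t => (Num.max (- h t) 0)%:E).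
  by apply/funext => t; rewrite funenegE EFin_max.
rewrite !ge0_integral_uniform_image//; [|by move=> t; rewrite le_max lexx orbT..].
rewrite -EFinB -mulrBr -sumrB; congr (_ * _)%:E; apply: eq_bigr => i _.
have [hx|/ltW hx] := leP 0 (h (X i)).
  by rewrite max_r ?oppr_le0// subr0.
by rewrite max_l ?oppr_ge0// opprK add0r.
Qed.
End uniform_image.

Lemma measurable_btree (R : realType) (g : btree -> R) : measurable_fun setT g.
Proof. by move=> _ A _; rewrite setTI. Qed.

Lemma measurable_rtree (R : realType) (g : rtree -> R) : measurable_fun setT g.
Proof. by move=> _ A _; rewrite setTI. Qed.

Lemma expectation_bst (R : realType) n (h : btree -> R) (g : bshape -> R) :
  (forall t, h t = g (shape_of_btree t)) ->
  ('E_(bst_law R n)[h] = (avg n g)%:E)%E.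
Proof.
move=> hg; rewrite expectation.unlock integral_uniform_image; last exact: measurable_btree.
rewrite avg.unlock card_Sn -sum_bst; congr (_ * _)%:E.
by apply: eq_bigr => s _; rewrite hg.
Qed.

Lemma card_rrt_choices n : #|{: rrt_choices n.+1}| = n`!.
Proof.
rewrite card_dep_ffun foldrE big_image/= fact_prod big_add1/= big_mkord.
by apply: eq_bigr => i _; rewrite card_ord.
Qed.

Lemma expectation_rrt (R : realType) n (h : rtree -> R) (g : bshape -> R) :
  (forall t, h t = g (shape_of_rtree t)) ->
  ('E_(rrt_law R n.+1)[h] = (avg n g)%:E)%E.
Proof.
move=> hg; rewrite expectation.unlock integral_uniform_image; last exact: measurable_rtree.
rewrite avg.unlock card_rrt_choices -sum_rrt; congr (_ * _)%:E.
by apply: eq_bigr => s _; rewrite hg.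
Qed.

Lemma uniform_image_pred d (T : measurableType d) (R : realType) (I : finType)
    (hI : (0 < #|I|)%N) (X : I -> T) (p : pred T) :
  uniform_image R hI X [set t | p t] = (#|I|%:R^-1 * \sum_i (p (X i))%:R)%:E.
Proof.
rewrite /uniform_image mulrC -natr_sum; congr (_ * _%:R)%:E.
rewrite -sum1_card big_mkcond/=; apply: eq_bigr => i _.
by rewrite !inE; case: ifP => [/set_mem /= ->//|/negP h]; case: (boolP (p _)) => // hp; case: h; rewrite inE.
Qed.

Lemma bst_law_pred (R : realType) n (p : pred btree) (g : bshape -> bool) :
  (forall t, t != BEmpty -> p t = g (shape_of_btree t)) ->
  bst_law R n.+1 [set t | p t] = (avg n.+1 (fun t => (g t)%:R))%:E.
Proof.
move=> pg; rewrite [LHS]uniform_image_pred avg.unlock card_Sn -sum_bst.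
congr (_ * _)%:E; apply: eq_bigr => s _; rewrite pg//.
have ss : size (inorder (bst_of_perm s)) = n.+1.
  by rewrite (perm_size (inorder_bst _)) size_map size_enum_ord.
by apply/eqP => s0; rewrite s0 in ss.
Qed.

Lemma rrt_law_pred (R : realType) n (p : pred rtree) (g : bshape -> bool) :
  (forall t, p t = g (shape_of_rtree t)) ->
  rrt_law R n.+1 [set t | p t] = (avg n (fun t => (g t)%:R))%:E.
Proof.
move=> pg; rewrite [LHS]uniform_image_pred avg.unlock card_rrt_choices -sum_rrt.
by congr (_ * _)%:E; apply: eq_bigr => s _; rewrite pg.
Qed.

Section bst_statistics.

(** A missing child, with value 0, has no leaf below it and is ignored. *)
Definition bst_merge (x y : nat) : nat :=
  (if x == 0 then y else if y == 0 then x else minn x y).+1.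

(** The number of nodes on a shortest path from the root to a leaf; the
    root is [l]-protected if this number exceeds [l]. *)
Fixpoint bst_depth (t : bshape) : nat :=
  if t is Fork a b then bst_merge (bst_depth a) (bst_depth b) else 0.

Lemma bst_depth_eq0 t : (bst_depth t == 0) = (t == Tip).
Proof. by case: t => [|a b]; [rewrite eqxx|apply/esym/eqP]. Qed.

Lemma broot_protectedE l t : broot_protected l t =
  (shape_of_btree t == Tip) || (l < bst_depth (shape_of_btree t))%N.
Proof.
elim: t l => [|a IHa x b IHb] l; first by rewrite eqxx.
have -> : (shape_of_btree (BNode a x b) == Tip) = false by apply/eqP.
case: l => [|l].
  by rewrite /broot_protected; apply/allP => d _.
have bE : (a == BEmpty) && (b == BEmpty) = (shape_of_btree a == Tip) && (shape_of_btree b == Tip).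
  by case: (a) (b) => [|? ? ?] [|? ? ?]; rewrite ?eqxx//; apply/idP/idP => /andP[/eqP ? /eqP ?].
have [/andP[/eqP -> /eqP ->] //|ab] := boolP ((a == BEmpty) && (b == BEmpty)).
have -> : broot_protected l.+1 (BNode a x b) = broot_protected l a && broot_protected l b.
  transitivity (all (leq l.+1) [seq d.+1 | d <- bleaf_dists a ++ bleaf_dists b]).
    by move: ab; rewrite /broot_protected; case: (a) (b) => [|? ? ?] [|? ? ?] //; rewrite !eqxx.
  by rewrite all_map -all_cat.
move: ab; rewrite bE IHa IHb /= /bst_merge !bst_depth_eq0 ltnS.
set ta := shape_of_btree a; set tb := shape_of_btree b.
have [->|a0] := eqVneq ta Tip; have [->|b0] := eqVneq tb Tip => //= _.
- by rewrite andbT.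
- by rewrite leq_min.
Qed.

Definition bst_toll {R : realType} (l : nat) (t : bshape) : R :=
  (l < bst_depth t)%N%:R.

Lemma bprotected_countE (R : realType) l t :
  (bprotected_count l t)%:R = total (@bst_toll R l) (shape_of_btree t) :> R.
Proof.
elim: t => // a IHa x b IHb.
have -> : bprotected_count l (BNode a x b) =
  (broot_protected l (BNode a x b) + (bprotected_count l a + bprotected_count l b))%N.
  by rewrite /bprotected_count /= count_cat.
rewrite !natrD IHa IHb broot_protectedE addrA.
by have -> : (shape_of_btree (BNode a x b) == Tip) = false by apply/eqP.
Qed.

End bst_statistics.

Section rrt_statistics.

(** [x] is the distance in the first child, [y] in the tree without the first child;
    the latter is 0 if the root has no other child, and must then be ignored. *)
Definition rrt_merge (x y : nat) : nat :=
  if y == 0 then x.+1 else minn x.+1 y.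

(** The distance from the root of the coded recursive tree to its nearest leaf. *)
Fixpoint rrt_dist (t : bshape) : nat :=
  if t is Fork a b then rrt_merge (rrt_dist a) (rrt_dist b) else 0.

Lemma rrt_dist_eq0 t : (rrt_dist t == 0) = (t == Tip).
Proof.
elim: t => [|a _ b IHb]; first by rewrite eqxx.
apply/idP/idP => [|/eqP//].
rewrite /= /rrt_merge; have [//|y0 /eqP hm] := eqVneq (rrt_dist b) 0%N.
by exfalso; lia.
Qed.

Lemma rroot_protectedE l t :
  rroot_protected l t = (l <= rrt_dist (shape_of_rtree t))%N.
Proof.
elim/rtree_ind_first: t l => [x|x c cs IHc IHt] l.
  by rewrite /rroot_protected /= andbT.
have IHt' := IHt; rewrite /= in IHt'.
have -> : shape_of_rtree (RNode x (c :: cs)) =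
  Fork (shape_of_rtree c) (shape_of_rtree (RNode x cs)) by [].
case: l => [|l]; first by apply/allP => d _.
rewrite [rrt_dist _]/= /rrt_merge rrt_dist_eq0.
have -> : rroot_protected l.+1 (RNode x (c :: cs)) = rroot_protected l c &&
    ((cs == [::]) || rroot_protected l.+1 (RNode x cs)).
  rewrite /rroot_protected /= map_cat all_cat all_map; congr (_ && _).
  by case: cs {IHt IHt'} => [|c' cs].
rewrite IHc IHt; case: cs {IHt IHt'} => [|c' cs]; first by rewrite /= !eqxx andbT ltnS.
have -> : (shape_of_rtree (RNode x (c' :: cs)) == Tip) = false by apply/eqP.
by rewrite /= leq_min ltnS.
Qed.

(** Summed over the right spine of a shape, these differences telescope to the
    protection of the root of the coded tree, as a root without children is not
    [l]-protected for [l >= 1]. *)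
Definition rrt_toll {R : realType} (l : nat) (t : bshape) : R :=
  if t is Fork _ b then (l <= rrt_dist t)%N%:R - (l <= rrt_dist b)%N%:R else 0.

Lemma rprotected_countE (R : realType) l t : (0 < l)%N ->
  (rprotected_count l t)%:R = total (@rrt_toll R l) (shape_of_rtree t) :> R.
Proof.
move=> l0; elim/rtree_ind_first: t => [x|x c cs IHc IHt].
  by rewrite /rprotected_count /= rroot_protectedE /= leqNgt l0.
(* The two trees with root [x] count the same nodes apart from this root. *)
have e : (rprotected_count l (RNode x (c :: cs)) + rroot_protected l (RNode x cs) =
  rroot_protected l (RNode x (c :: cs)) + rprotected_count l c + rprotected_count l (RNode x cs))%N.
  by rewrite /rprotected_count [rfringe (RNode _ (_ :: _))]/= [rfringe (RNode _ cs)]/= /= count_cat; lia.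
have -> : total (@rrt_toll R l) (shape_of_rtree (RNode x (c :: cs))) =
    (l <= rrt_dist (shape_of_rtree (RNode x (c :: cs))))%N%:R -
    (l <= rrt_dist (shape_of_rtree (RNode x cs)))%N%:R +
    total (rrt_toll l) (shape_of_rtree c) +
    total (rrt_toll l) (shape_of_rtree (RNode x cs)) by [].
rewrite -IHc -IHt -!rroot_protectedE.
move: e; move: (rprotected_count l (RNode x (c :: cs))) (rprotected_count l c)
  (rprotected_count l (RNode x cs)) => u v w e.
apply: (addIr (rroot_protected l (RNode x cs))%:R); rewrite -natrD e !natrD.
ring.
Qed.

End rrt_statistics.

(** * Limit theorem for additive functionals *)

Section assembly.
Context {R : realType}.

Lemma cvg_ratio_succ (s : nat) : (s <= 1)%N ->
  n.+1%:R / (n + s)%:R @[n --> \oo] --> (1 : R).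
Proof.
case: s => [_|[_|//]].
  have h : (fun n => 1 + 1 / n.+1%:R) @ \oo --> (1 : R).
    rewrite -[X in _ --> X]addr0; apply: cvgD; first exact: cvg_cst.
    exact: cvg_inv_nat.
  rewrite -(cvg_shiftS (fun n => n.+1%:R / (n + 0)%:R : R)).
  rewrite (_ : (fun n => _) = (fun n => 1 + 1 / n.+1%:R))//.
  by apply/funext => n; rewrite addn0 -[n.+2%:R]natr1 mulrDl divff.
under eq_fun do rewrite addn1 divff//.
exact: cvg_cst.
Qed.

Lemma linear_cvg_shift (u : nat -> R) (x C : R) (s : nat) : (s <= 1)%N ->
  (forall n, `|u n - n.+1%:R * x| <= C * Num.sqrt n.+1%:R) ->
  (n + s)%:R^-1 * u n @[n --> \oo] --> x.
Proof.
move=> s1 /linear_cvg ux; rewrite -[X in _ --> X]mulr1.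
rewrite (_ : (fun n => _) =
  (fun n => u n / n.+1%:R) \* (fun n => n.+1%:R / (n + s)%:R)).
  by apply: cvgM => //; exact: cvg_ratio_succ.
by apply/funext => n /=; rewrite mulrA divfK// mulrC.
Qed.

End assembly.

Section limit_law.
Context {R : realType} d (T : measurableType d).
(* A tree with [n] nodes is coded by a shape with [n - s] forks. *)
Variables (P : nat -> probability T R) (Y : T -> R) (s : nat).
Variables (f : bshape -> R) (B mu : R).
Hypothesis s1 : (s <= 1)%N.
Hypothesis fB : forall t, `|f t| <= B.
Hypothesis meanB : forall n, `|avg n (total f) - n.+1%:R * mu| <= 3 * B.
Hypothesis PY : forall n (phi : R -> R),
  ('E_(P (n + s)%N)[phi \o Y] = (avg n (fun t => phi (total f t)))%:E)%E.

(** The mean is within a bounded distance of [n mu], so both centerings are shifts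
    by bounded amounts of the exact one, which [clt_bounded] allows. *)
Lemma additive_limit_law : exists sigma2 : R,
  [/\ 0 <= sigma2,
   (forall c m, 0 < c -> (forall n, (m <= n)%N ->
      n.+2%:R * c <= avg n.+1 (fun t => centered f t ^+ 2)) -> 0 < sigma2) &
   [/\ ((n%:R^-1)%:E * 'E_(P n)[Y])%E @[n --> \oo] --> mu%:E,
       ((n%:R^-1)%:E * 'V_(P n)[Y])%E @[n --> \oo] --> sigma2%:E,
       cvg_in_distribution P (fun n t => (Y t - n%:R * mu) / Num.sqrt n%:R)
         (centered_normal sigma2) &
       cvg_in_distribution P
         (fun n t => (Y t - fine 'E_(P n)[Y]) / Num.sqrt n%:R)
         (centered_normal sigma2)]].
Proof.
have B0 : 0 <= B by exact: le_trans (fB Tip).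
have [s2 s20 varC] := var_cvg fB.
have EY n : ('E_(P (n + s)%N)[Y] = (avg n (total f))%:E)%E by exact: (PY n id).
have VY n : ('V_(P (n + s)%N)[Y] = (avg n (fun t => centered f t ^+ 2))%:E)%E.
  rewrite /variance covariance.unlock EY /=.
  rewrite -[RHS](_ : (avg n (fun t => (total f t - avg n (total f)) ^+ 2))%:E = _).
    by rewrite -(PY n (fun y => (y - avg n (total f)) ^+ 2)).
  by congr EFin; apply: eq_avg => t tn; rewrite /centered tn.
have clt (c : nat -> R) (b : R) (X : nat -> T -> R) : (forall n, `|c n| <= b) ->
    (forall n t, X (n + s)%N t =
      (Y t - avg n (total f) + c n) / Num.sqrt (n + s)%:R) ->
    cvg_in_distribution P X (centered_normal s2).
  move=> cb XE u cu bu.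
  have [M uM] : exists M, forall x, `|u x| <= M.
    have [M [_ hM]] := bu; exists (M + 1) => x.
    by apply: hM => //; rewrite ltrDl.
  rewrite (integral_centered_normal s20 cu uM) -(cvg_shiftn s).
  have := @clt_bounded R f B fB s2 _ s20 varC c (fun n => (n + s)%N) b cb _ u M cu uM.
  have Ns n : (n <= n + s <= n.+1)%N by rewrite leq_addr -addn1 leq_add2l.
  move=> /(_ Ns) h; rewrite (_ : (fun n => _) = EFin \o (fun n => avg n (fun t =>
      u ((centered f t + c n) / Num.sqrt (n + s)%:R)))).
    by apply: cvg_EFin => //; exact: nearW.
  apply/funext => n /=.
  have -> : u \o X (n + s)%N =
      (fun y => u ((y - avg n (total f) + c n) / Num.sqrt (n + s)%:R)) \o Y.
    by apply/funext => t; rewrite /= XE.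
  by rewrite PY; congr EFin; apply: eq_avg => t tn; rewrite /centered tn.
exists s2; split => //.
  move=> c m c0 hc; apply: (lt_le_trans c0).
  apply: (@cvgr_to_ge _ \oo _ _ _ _ _ (linear_cvg varC)).
  near=> n; rewrite ler_pdivlMr// mulrC; near: n.
  by exists m.+1 => // -[//|k] /= km; exact: hc.
split.
- rewrite -(cvg_shiftn s) /=.
  under eq_fun do rewrite EY -EFinM.
  apply: cvg_EFin; first exact: nearW.
  apply: (@linear_cvg_shift R _ _ (3 * B)) => // n; rewrite (le_trans (meanB n))//.
  by rewrite ler_peMr ?mulr_ge0// -[leLHS]sqrtr1 ler_sqrt// ler1n.
- rewrite -(cvg_shiftn s) /=.
  under eq_fun do rewrite VY -EFinM.
  apply: cvg_EFin; first exact: nearW.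
  exact: linear_cvg_shift varC.
- apply: (clt (fun n => avg n (total f) - (n + s)%:R * mu) (3 * B + `|mu|)).
    move=> n; have -> : avg n (total f) - (n + s)%:R * mu =
        avg n (total f) - n.+1%:R * mu + (n.+1%:R - (n + s)%:R) * mu by ring.
    rewrite (le_trans (ler_normD _ _))// lerD// normrM ler_piMl//.
    by case: s s1 => [|[|//]] _; rewrite ?addn0 ?addn1 ?subrr ?normr0// -natr1 addrAC subrr add0r normr1.
  by move=> n t; congr (_ / _); ring.
- apply: (clt (fun=> 0) 0) => [n|n t]; first by rewrite normr0.
  by rewrite EY /= addr0.
Unshelve. all: by end_near. Qed.
End limit_law.

(** * The root probabilities and the theorem *)

Section random_size.
Context {R : realType}.

Lemma random_index_limit d (T : measurableType d) (w : nat -> {nonneg R})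
    (w1 : (\sum_(1 <= k <oo) (w k)%:num%:E = 1)%E) (P : nat -> probability T R)
    (A : set T) (x : nat -> R) (S : R) :
  (forall k, (w k.+1)%:num%:E * P k.+1 A = (x k)%:E)%E ->
  \sum_(k < n) x k @[n --> \oo] --> S -> random_index w1 P A = S%:E.
Proof.
move=> hx xS; rewrite /random_index /mseries; apply/cvg_lim => //.
rewrite -(cvg_shiftS _ _).
rewrite (_ : (fun n => _) = EFin \o (fun n => \sum_(k < n) x k)).
  by apply: cvg_EFin => //; exact: nearW.
apply/funext => n /=; rewrite big_add1/= big_mkord -sumEFin.
by apply: eq_bigr => k _; exact: hx.
Qed.

Lemma partial_sums_le_limit (x : nat -> R) (S : R) k : (forall k, 0 <= x k) ->
  \sum_(k < n) x k @[n --> \oo] --> S -> x k <= S.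
Proof.
move=> x0 xS; apply: (@cvgr_to_ge _ \oo _ _ _ _ _ xS); near=> n.
have kn : (k < n)%N by near: n; exact: nbhs_infty_gt.
by rewrite (bigD1 (Ordinal kn))//= lerDl sumr_ge0.
Unshelve. all: by end_near. Qed.

(** A single shape of each size whose root is protected as much as the size allows,
    which makes the root probabilities positive. *)
Definition left_chain n : bshape := iter n (fun t => Fork t Tip) Tip.

Lemma nforks_left_chain n : nforks (left_chain n) = n.
Proof. by elim: n => //= n ->; rewrite addn0. Qed.

Lemma bst_depth_left_chain n : bst_depth (left_chain n) = n.
Proof. by elim: n => //= n ->; rewrite /bst_merge; case: n. Qed.

Lemma rrt_dist_left_chain n : rrt_dist (left_chain n) = n.
Proof. by elim: n => //= n ->. Qed.

Section bst.
Variable l : nat.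
Let f := @bst_toll R l.

Lemma bst_toll_le t : `|f t| <= 1.
Proof. by rewrite /f /bst_toll ger0_norm// lern1; case: (_ < _)%N. Qed.

Lemma bst_toll_ge0 t : 0 <= f t. Proof. exact: ler0n. Qed.

(** The size distribution [2/((k+1)(k+2))] is [toll_weight], so the series that
    defines the law of the random tree is the series for [mu]. *)
Lemma bst_random_law_rootE (mu : R) :
  \sum_(1 <= k < n.+1) toll_weight k * avg k f @[n --> \oo] --> mu ->
  bst_random_law R [set t | broot_protected l t] = mu%:E /\ 0 < mu.
Proof.
move=> cmu; pose x k := toll_weight k.+1 * avg k.+1 f.
have xS : \sum_(k < n) x k @[n --> \oo] --> mu.
  move: cmu; rewrite (_ : (fun n => _) = (fun n => \sum_(k < n) x k))//.
  by apply/funext => n; rewrite big_add1/= big_mkord.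
split.
  apply: random_index_limit xS => k.
  rewrite (@bst_law_pred R k _ (fun t => (l < bst_depth t)%N)) -?EFinM// => t t0.
  rewrite broot_protectedE; case: t t0 => [/eqP//|a y b _].
  by rewrite (_ : (shape_of_btree (BNode a y b) == Tip) = false)//; apply/eqP.
apply: (lt_le_trans _ (partial_sums_le_limit l _ xS)) => [|k]; last first.
  by rewrite mulr_ge0 ?(ltW (toll_weight_gt0 _))//; apply: avg_ge0 => t _; exact: bst_toll_ge0.
rewrite mulr_gt0 ?toll_weight_gt0// -{1}(nforks_left_chain l.+1).
apply: avg_gt0; first exact: bst_toll_ge0.
by rewrite /f /bst_toll bst_depth_left_chain ltnSn ltr01.
Qed.
End bst.

Section rrt.
Variable l : nat.
Hypothesis l0 : (0 < l)%N.
Let f := @rrt_toll R l.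
Let root_prob n : R := avg n (fun t => (l <= rrt_dist t)%N%:R).
Let Q n := \sum_(k < n) root_prob k / (k.+1%:R * k.+2%:R).

Lemma rrt_toll_le t : `|f t| <= 1.
Proof.
rewrite /f /rrt_toll; case: t => [|a b]; first by rewrite normr0.
case: (_ <= _)%N; case: (_ <= _)%N; rewrite ?subrr ?subr0 ?sub0r ?normrN ?normr0 ?normr1//.
Qed.

Let sum_Q n : \sum_(k < n.+1) (root_prob k + 2 * (k.+1%:R * Q k)) =
  n.+1%:R * n.+2%:R * Q n.+1.
Proof.
elim: n => [|n IH].
  by rewrite big_ord1 /Q big_ord0 big_ord1 !mulr0 addr0 mulrC divfK.
rewrite big_ord_recr/= IH.
have -> : Q n.+2 = Q n.+1 + root_prob n.+1 / (n.+2%:R * n.+3%:R) by rewrite /Q [LHS]big_ord_recr.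
rewrite -[n.+3%:R]natr1 -[n.+2%:R]natr1.
have : 0 < n.+1%:R :> R by []; move: (n.+1%:R) => y y0.
by field; rewrite !gt_eqF//; lra.
Qed.

(** The mean toll is the probability of a protected root minus the mean of these
    probabilities over all smaller sizes. Summation by parts turns the weights
    [2/((k+1)(k+2))] of the recursion into [1/((k+1)(k+2))], the distribution
    of the size [k + 1] of the random recursive tree. *)
Lemma rrt_mean n : avg n (total f) = root_prob n + n.+1%:R * Q n.
Proof.
have [k] := ubnP n; elim: k n => // k IH [_|n].
  by rewrite /Q /root_prob !avg0 big_ord0 mulr0 addr0 /= leqNgt l0.
rewrite ltnS => nk; rewrite avg_total_rec.
have -> : avg n.+1 f = root_prob n.+1 - n.+1%:R^-1 * \sum_(k < n.+1) root_prob k.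
  rewrite -(avg_rsub n (fun t => (l <= rrt_dist t)%N%:R)) -avgB.
  by apply: eq_avg => -[].
have -> : \sum_(j < n.+1) avg j (total f) =
    \sum_(j < n.+1) (root_prob j + j.+1%:R * Q j).
  by apply: eq_bigr => j _; have jn := ltn_ord j; apply: IH; lia.
rewrite -addrA; congr (_ + _).
have n1 : n.+1%:R != 0 :> R by rewrite pnatr_eq0.
apply: (mulfI n1); rewrite mulrA -sum_Q big_split/= big_split/= -mulr_sumr.
by move: (\sum_(i < n.+1) _) (\sum_(i < n.+1) _) => u v; field.
Qed.

Lemma rrt_random_law_rootE (mu : R) :
  (forall n, `|avg n (total f) - n.+1%:R * mu| <= 3) ->
  rrt_random_law R [set t | rroot_protected l t] = mu%:E /\ 0 < mu.
Proof.
move=> hmu; pose x k := root_prob k / (k.+1%:R * k.+2%:R).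
have p01 n : 0 <= root_prob n <= 1.
  apply/andP; split; first by apply: avg_ge0 => t _; exact: ler0n.
  by rewrite -[leRHS](avg_cst n); apply: avg_le => t _; rewrite lern1; case: (l <= _)%N.
have xS : \sum_(k < n) x k @[n --> \oo] --> mu.
  rewrite (_ : (fun n => _) = (fun n => (avg n (total f) - root_prob n) / n.+1%:R)).
    apply: (@linear_cvg _ _ _ 4) => n.
    have s1 : 1 <= Num.sqrt n.+1%:R :> R by rewrite -[leLHS]sqrtr1 ler_sqrt// ler1n.
    rewrite addrAC (le_trans (ler_normB _ _))//.
    have := hmu n; have := p01 n; rewrite andbC => /andP[p1 p0].
    by rewrite [`|root_prob n|]ger0_norm//; lra.
  by apply/funext => n; rewrite rrt_mean addrAC subrr add0r mulrC mulKf.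
split.
  apply: random_index_limit xS => k.
  rewrite (@rrt_law_pred R k _ (fun t => (l <= rrt_dist t)%N)); last exact: rroot_protectedE.
  by rewrite -EFinM /x /= mul1r mulrC.
apply: (lt_le_trans _ (partial_sums_le_limit l _ xS)) => [|k]; last first.
  by have /andP[p0 _] := p01 k; rewrite divr_ge0.
rewrite divr_gt0 ?mulr_gt0// /root_prob -{1}(nforks_left_chain l).
apply: avg_gt0 => [u|]; first exact: ler0n.
by rewrite rrt_dist_left_chain leqnn ltr01.
Qed.
End rrt.
End random_size.

Theorem theorem8p6 (R : realType) (l : nat) (hl : (1 <= l)%N) :
  (let P := bst_law R in
   let Y := fun t : btree => (bprotected_count l t)%:R : R in
   let mu := fine (bst_random_law R [set t | broot_protected l t]) in
   0 < mu /\
   exists sigma2 : R,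
     (0 <= sigma2 /\ (l = 2%N -> 0 < sigma2)) /\
     [/\ ((n%:R^-1)%:E * 'E_(P n)[Y])%E @[n --> \oo] --> mu%:E,
         ((n%:R^-1)%:E * 'V_(P n)[Y])%E @[n --> \oo] --> sigma2%:E,
         cvg_in_distribution P
           (fun n t => (Y t - n%:R * mu) / Num.sqrt n%:R)
           (centered_normal sigma2) &
         cvg_in_distribution P
           (fun n t => (Y t - fine 'E_(P n)[Y]) / Num.sqrt n%:R)
           (centered_normal sigma2)]) /\
  (let P := rrt_law R in
   let Z := fun t : rtree => (rprotected_count l t)%:R : R in
   let mu := fine (rrt_random_law R [set t | rroot_protected l t]) in
   0 < mu /\
   exists sigma2 : R,
     (0 <= sigma2 /\ (l = 2%N -> 0 < sigma2)) /\
     [/\ ((n%:R^-1)%:E * 'E_(P n)[Z])%E @[n --> \oo] --> mu%:E,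
         ((n%:R^-1)%:E * 'V_(P n)[Z])%E @[n --> \oo] --> sigma2%:E,
         cvg_in_distribution P
           (fun n t => (Z t - fine 'E_(P n)[Z]) / Num.sqrt n%:R)
           (centered_normal sigma2) &
         cvg_in_distribution P
           (fun n t => (Z t - n%:R * mu) / Num.sqrt n%:R)
           (centered_normal sigma2)]).
Proof.
split; cbv zeta.
- have fB := @bst_toll_le R l.
  have [mu [cmu hmu]] := avg_total_cvg fB.
  have [-> mu0] := bst_random_law_rootE cmu; split=> //=.
  have PY n (phi : R -> R) : ('E_(bst_law R (n + 0)%N)[phi \o
        (fun t => (bprotected_count l t)%:R)] =
      (avg n (fun t => phi (total (@bst_toll R l) t)))%:E)%E.
    by rewrite addn0; apply: expectation_bst => t /=; rewrite bprotected_countE.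
  have [sigma2 [s0 spos [h1 h2 h3 h4]]] :=
    @additive_limit_law R _ _ _ _ 0 _ 1 mu isT fB hmu PY.
  exists sigma2; split=> //; split=> // l2.
  (* Two trees with 6 nodes. The left child of the root has a single child, a leaf;
     the right child has below it either a path of two nodes, so that it is
     2-protected, or two leaves. In both trees, the root is at distance 2 from the
     nearest leaf. *)
  pose chain2 := Fork (Fork Tip Tip) Tip.
  have [||||||c c0 hc] := @variance_linear_lower R nat bst_depth bst_merge
    (fun x y => (l < bst_merge x y)%N%:R) (@bst_toll R l)
    (Fork chain2 (Fork chain2 Tip)) (Fork chain2 (Fork (Fork Tip Tip) (Fork Tip Tip))) => //.
    by rewrite l2 /bst_toll /=; lra.
  exact: spos hc.
- have fB := @rrt_toll_le R l.
  have [mu [_ hmu]] := avg_total_cvg fB.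
  have hmu3 n : `|avg n (total (rrt_toll l)) - n.+1%:R * mu| <= 3 by rewrite -[3]mulr1.
  have [-> mu0] := rrt_random_law_rootE hl hmu3; split=> //=.
  have PZ n (phi : R -> R) : ('E_(rrt_law R (n + 1)%N)[phi \o
        (fun t => (rprotected_count l t)%:R)] =
      (avg n (fun t => phi (total (@rrt_toll R l) t)))%:E)%E.
    by rewrite addn1; apply: expectation_rrt => t /=; rewrite rprotected_countE.
  have [sigma2 [s0 spos [h1 h2 h3 h4]]] :=
    @additive_limit_law R _ _ _ _ 1 _ 1 mu isT fB hmu PZ.
  exists sigma2; split=> //; split=> // l2.
  (* Two trees whose root has a child with one leaf below it, and a second child
     with either a path of two nodes below it, so that it is 2-protected, or two
     leaves. In both trees, the root is at distance 2 from the nearest leaf. *)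
  pose A := Fork Tip Tip.
  have [||||||c c0 hc] := @variance_linear_lower R nat rrt_dist rrt_merge
    (fun x y => (l <= rrt_merge x y)%N%:R - (l <= y)%N%:R) (@rrt_toll R l)
    (Fork A (Fork (Fork A Tip) Tip)) (Fork A (Fork (Fork Tip A) Tip)) => //.
    by rewrite l2 /rrt_toll /=; lra.
  exact: spos hc.
Qed.
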